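(* The following gives a complete characterization of all possible accumulation points of the unconditional cdfs (with respect to weak convergence) and of the model selection probabilities along arbitrary parameter sequences with $\sigma^{(n)}$ bounded away from zero and infinity. Let $\theta^{(n)}$ be any sequence in $\mathbb{R}^P$ and let $\sigma^{(n)}$ satisfy $\sigma_*\le\sigma^{(n)}\le\sigma^*$ for constants $0<\sigma_*\le\sigma^*<\infty$. Then every subsequence contains a further subsequence along which $\sqrt n\,\theta^{(n)}$ converges to some $\psi\in(\mathbb{R}\cup\{-\infty,\infty\})^P$ and $\sigma^{(n)}$ converges to some $\sigma\in[\sigma_*,\sigma^*]$. (a) Each accumulation point, with respect to weak convergence, of $G_{n,\theta^{(n)},\sigma^{(n)}}(t)$ is of the form $$\Phi_{\infty,p_*}(t-A\delta^{(p_* )})\prod_{q=p_*+1}^P\Delta_{\sigma\xi_{\infty,q}}(\delta_q^{(q)}+\psi_q,\,c_q\sigma\xi_{\infty,q})$$ $$+\sum_{p=p_*+1}^P\int_{z\le t-A\delta^{(p)}}\Big(1-\Delta_{\sigma\zeta_{\infty,p}}(\delta_p^{(p)}+\psi_p+b_{\infty,p}z,\,c_p\sigma\xi_{\infty,p})\Big)\Phi_{\infty,p}(dz)\times\prod_{q=p+1}^P\Delta_{\sigma\xi_{\infty,q}}(\delta_q^{(q)}+\psi_q,\,c_q\sigma\xi_{\infty,q}),$$ where $\psi$ and $\sigma$ are accumulation points of $\sqrt n\,\theta^{(n)}$ (in $(\mathbb{R}\cup\{-\infty,\infty\})^P$) and $\sigma^{(n)}$, respectively, $p_*$ is the largest index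 $p$ with $\mathcal O<p\le P$ and $|\psi_p|=\infty$ ($p_*=\mathcal O$ if there is none), and $\delta^{(p)}=\begin{pmatrix}Q[p:p]^{-1}Q[p:\neg p]\\-I_{P-p}\end{pmatrix}\psi[\neg p]$ for $p_*\le p\le P$ (with $\delta^{(P)}=0$ and, if necessary, $\delta^{(0)}=-\psi$). The same is true for $G^*_{n,\theta^{(n)},\sigma^{(n)}}(t)$. (b) Likewise, each accumulation point of the vector of model selection probabilities $\big(\pi_{n,\theta^{(n)},\sigma^{(n)}}(p)\big)_{\mathcal O\le p\le P}$, and of $\big(\pi^*_{n,\theta^{(n)},\sigma^{(n)}}(p)\big)_{\mathcal O\le p\le P}$, is of the form: $\big(1-\Delta_{\sigma\xi_{\infty,p}}(\delta_p^{(p)}+\psi_p,c_p\sigma\xi_{\infty,p})\big)\prod_{q=p+1}^P\Delta_{\sigma\xi_{\infty,q}}(\delta_q^{(q)}+\psi_q,c_q\sigma\xi_{\infty,q})$ for $p>p_*$, $\prod_{q=p_*+1}^P\Delta_{\sigma\xi_{\infty,q}}(\delta_q^{(q)}+\psi_q,c_q\sigma\xi_{\infty,q})$ for $p=p_*$, and $0$ for $p<p_*$, with such $\psi$, $\sigma$, $p_*$, $\delta^{(p)}$. (c) The same considerations apply to the weighted conditional cdfs: for each fixed $p$ with $\mathcal O\le p\le P$, each accumulation point, with respect to weak convergence of not necessarily normalized cdfs, of $G_{n,\theta^{(n)},\sigma^{(n)}}(t|p)\,\pi_{n,\theta^{(n)},\sigma^{(n)}}(p)$ is, with such $\psi$,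 $\sigma$, $p_*$, $\delta^{(\cdot)}$, of the following form: if $p=p_*$, it is $$\Phi_{\infty,p_*}(t-A\delta^{(p_* )})\prod_{q=p_*+1}^P\Delta_{\sigma\xi_{\infty,q}}(\delta_q^{(q)}+\psi_q,\,c_q\sigma\xi_{\infty,q});$$ if $p>p_*$, it is $$\int_{z\le t-A\delta^{(p)}}\Big(1-\Delta_{\sigma\zeta_{\infty,p}}(\delta_p^{(p)}+\psi_p+b_{\infty,p}z,\,c_p\sigma\xi_{\infty,p})\Big)\Phi_{\infty,p}(dz)\times\prod_{q=p+1}^P\Delta_{\sigma\xi_{\infty,q}}(\delta_q^{(q)}+\psi_q,\,c_q\sigma\xi_{\infty,q});$$ and if $p<p_*$, it is zero (the convergence to zero along the corresponding subsequence then being in total variation). The same is true for $G^*_{n,\theta^{(n)},\sigma^{(n)}}(t|p)\,\pi^*_{n,\theta^{(n)},\sigma^{(n)}}(p)$.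
   Context: Model: for each sample size $n>P\ge1$, $Y=X\theta+u$ with $X=X_n$ a non-stochastic $n\times P$ matrix of rank $P$, $u\sim N(0,\sigma^2I_n)$, $\theta\in\mathbb{R}^P$, $\sigma>0$; $P_{n,\theta,\sigma}$ is the corresponding probability measure. It is assumed that $Q=\lim_{n\to\infty}X'X/n$ exists and is non-singular. $A$ is a fixed non-stochastic $k\times P$ matrix of rank $k$, $1\le k\le P$; $\mathcal O$ is a fixed integer with $0\le\mathcal O<P$. Inequalities between vectors are componentwise; empty products equal one. An accumulation point is a limit along some subsequence. Notation: for a matrix $D$ with $P$ columns, $D[p]$ is the matrix of its first $p$ columns; for a $P$-vector $x$, $x[\neg p]$ consists of its last $P-p$ components; $x_i$ is the $i$-th component. Estimators: for $0\le p\le P$, $\tilde\theta(p)\in\mathbb{R}^P$ is the restricted least-squares estimator with first $p$ components $(X[p]'X[p])^{-1}X[p]'Y$ and last $P-p$ components zero ($\tilde\theta(0)=0$); $\tilde\theta_p(p)$ is its $p$-th component. $\hat\sigma^2=(n-P)^{-1}(Y-X\tilde\theta(P))'(Y-X\tilde\theta(P))$. For $0<p\le P$, $\xi_{n,p}=\big([(X[p]'X[p]/n)^{-1}]_{p,p}\big)^{1/2}$, $T_p=\sqrt n\,\tilde\theta_p(p)/(\hat\sigma\xi_{n,p})$ and $T^*_p=\sqrt n\,\tilde\theta_p(p)/(\sigma\xi_{n,p})$ (with the true $\sigma$); $T_0=T_0^*=0$. Critical values, not depending on $n$: $0<c_p<\infty$ for $\mathcal O<p\le P$ and $c_{\mathcal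 O}=0$. Model selectors: $\hat p=\max\{p:|T_p|\ge c_p,\ \mathcal O\le p\le P\}$ and $\hat p^*=\max\{p:|T^*_p|\ge c_p,\ \mathcal O\le p\le P\}$. Post-model-selection estimators: $\tilde\theta=\sum_{p=\mathcal O}^P\tilde\theta(p)\mathbf 1\{\hat p=p\}$, $\tilde\theta^*=\sum_{p=\mathcal O}^P\tilde\theta(p)\mathbf 1\{\hat p^*=p\}$. Cdfs, for $t\in\mathbb{R}^k$: $G_{n,\theta,\sigma}(t)=P_{n,\theta,\sigma}(\sqrt nA(\tilde\theta-\theta)\le t)$, $G^*_{n,\theta,\sigma}(t)=P_{n,\theta,\sigma}(\sqrt nA(\tilde\theta^*-\theta)\le t)$. Model selection probabilities (always positive): $\pi_{n,\theta,\sigma}(p)=P_{n,\theta,\sigma}(\hat p=p)$, $\pi^*_{n,\theta,\sigma}(p)=P_{n,\theta,\sigma}(\hat p^*=p)$, $\mathcal O\le p\le P$. Conditional cdfs: $G_{n,\theta,\sigma}(t|p)=P_{n,\theta,\sigma}(\sqrt nA(\tilde\theta-\theta)\le t\mid\hat p=p)$, $G^*_{n,\theta,\sigma}(t|p)=P_{n,\theta,\sigma}(\sqrt nA(\tilde\theta^*-\theta)\le t\mid\hat p^*=p)$. Weak convergence of not necessarily normalized cdfs $H_n$ to a not necessarily normalized cdf $H$ on $\mathbb{R}^k$ means that $H_n(t)\to H(t)$ at each continuity point $t$ of $H$ and that the total mass of $H_n$ on $\mathbb{R}^k$ converges to that of $H$. Limit quantities: $Q$ is partitioned as $Q=\begin{pmatrix}Q[p:p]&Q[p:\neg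 p]\\Q[\neg p:p]&Q[\neg p:\neg p]\end{pmatrix}$ with $Q[p:p]$ of size $p\times p$. $\Phi_{\infty,p}$ is the cdf (and measure) on $\mathbb{R}^k$ of the centered Gaussian distribution with covariance matrix $\sigma^2A[p]Q[p:p]^{-1}A[p]'$ for $0<p\le P$, and of point mass at $0$ for $p=0$. For $1\le p\le P$: $C_\infty^{(p)}=A[p]Q[p:p]^{-1}e_p$ with $e_p$ the $p$-th standard basis vector in $\mathbb{R}^p$; $\xi_{\infty,p}^2=(Q[p:p]^{-1})_{p,p}$; $b_{\infty,p}=C_\infty^{(p)\prime}(A[p]Q[p:p]^{-1}A[p]')^-$; $\zeta_{\infty,p}^2=\xi_{\infty,p}^2-b_{\infty,p}C_\infty^{(p)}$; $\xi_{\infty,p},\zeta_{\infty,p}\ge0$; $(\cdot)^-$ is a generalized inverse ($b_{\infty,p}z$ does not depend on its choice for $z$ in the column space of $A[p]$). $\Delta_s(a,b)=P(|M-a|<b)$ for $M\sim N(0,s^2)$, $s\ge0$ ($M=0$ if $s=0$, so $\Delta_0(a,b)=1$ if $|a|<b$ and $0$ otherwise). *)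

(* Defs.v *)
From HB Require Import structures.
From mathcomp Require Import all_boot all_order all_algebra.
From mathcomp Require Import all_classical all_reals all_analysis.

Set Implicit Arguments.
Unset Strict Implicit.
Unset Printing Implicit Defensive.

Import Order.TTheory GRing.Theory Num.Theory.
Import numFieldNormedType.Exports.

Local Open Scope classical_set_scope.
Local Open Scope ring_scope.

(* Matrices over R carry the product sigma-algebra, generated by the entries;
   on 'cV[R]_n this is the Borel sigma-algebra of R^n. *)
Definition mx_display : measure_display.
Proof. by constructor. Qed.

Section MeasurableMatrix.
Variables (R : realType) (m n : nat).

Definition mx_cylinder : set (set 'M[R]_(m, n)) :=
  [set E | exists i j (B : set R),
     measurable B /\ E = [set M : 'M[R]_(m, n) | B (M i j)]].

Let mx_sigma0 : <<s mx_cylinder >> set0.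
Proof. exact: sigma_algebra0. Qed.

Let mx_sigmaC E : <<s mx_cylinder >> E -> <<s mx_cylinder >> (~` E).
Proof. exact: sigma_algebraC. Qed.

Let mx_sigma_bigcup (F : (set 'M[R]_(m, n))^nat) :
  (forall i, <<s mx_cylinder >> (F i)) -> <<s mx_cylinder >> (\bigcup_i F i).
Proof. exact: sigma_algebra_bigcup. Qed.

HB.instance Definition _ := @isMeasurable.Build mx_display 'M[R]_(m, n)
  <<s mx_cylinder >> mx_sigma0 mx_sigmaC mx_sigma_bigcup.

Lemma measurable_entry i j :
  measurable_fun [set: 'M[R]_(m, n)] (fun M : 'M[R]_(m, n) => M i j).
Proof.
by move=> _ B mB; rewrite setTI; apply: sub_sigma_algebra; exists i, j, B.
Qed.

Lemma measurable_fun_mx d (T : measurableType d) (f : T -> 'M[R]_(m, n)) :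
  (forall i j, measurable_fun [set: T] (fun x => f x i j)) ->
  measurable_fun [set: T] f.
Proof.
move=> mf; apply: (@measurability _ _ _ _ _ _ mx_cylinder) => //.
move=> _ [_ [i [j [B [mB ->]]]] <-].
exact: mf.
Qed.

End MeasurableMatrix.

Section Gaussian.
Variable R : realType.

(* The library's [normal_prob] lives on [measurableTypeR R], which is R with the
   same Borel sets but another measurable structure than the one of [R]. *)
Definition tcons n (z : measurableTypeR R * n.-tuple R) : n.+1.-tuple R :=
  [tuple of (z.1 : R) :: z.2].

Lemma measurable_tcons n :
  measurable_fun [set: measurableTypeR R * n.-tuple R] (@tcons n).
Proof.
apply: (@measurable_cons _ _ _ R (fun z : measurableTypeR R * n.-tuple R => z.1 : R)).
  by move=> mD B mB; exact: (@measurable_fst _ _ (measurableTypeR R) _).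
exact: measurable_snd.
Qed.

HB.instance Definition _ n :=
  isMeasurableFun.Build _ _ _ _ (@tcons n) (@measurable_tcons n).

(* the n-fold product of N(0, 1) *)
Fixpoint std_normal (n : nat) : probability (n.-tuple R) R :=
  match n with
  | 0 => \d_([tuple] : 0.-tuple R)
  | n'.+1 => distribution (normal_prob 0 1 \x std_normal n')%E (@tcons n')
  end.

Definition mul_tuple m n (B : 'M[R]_(m, n)) (z : n.-tuple R) : 'cV[R]_m :=
  B *m \col_i tnth z i.

Lemma measurable_mul_tuple m n (B : 'M[R]_(m, n)) :
  measurable_fun [set: n.-tuple R] (mul_tuple B).
Proof.
apply: measurable_fun_mx => i j.
rewrite (_ : (fun _ => _) = fun z : n.-tuple R => \sum_l B i l * tnth z l).
  apply: measurable_sum => l; apply: measurable_realfun.measurable_funM; first exact: measurable_cst.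
  exact: measurable_tnth.
by apply/funext => z; rewrite mxE; apply: eq_bigr => l _; rewrite mxE.
Qed.

HB.instance Definition _ m n (B : 'M[R]_(m, n)) :=
  isMeasurableFun.Build _ _ _ _ (mul_tuple B) (measurable_mul_tuple B).

(* N(0, S), S positive semi-definite and possibly singular: the law of B Z with
   Z standard normal and B B' = S.  This law does not depend on the root B. *)
Definition root_mx n (S : 'M[R]_n) : 'M[R]_n :=
  xget 0 [set B : 'M[R]_n | B *m B^T = S].

Definition gaussian n (S : 'M[R]_n) : probability 'cV[R]_n R :=
  distribution (std_normal n) (mul_tuple (root_mx S)).

Definition Delta (s a b : R) : R :=
  let E := [set x : R | `|x - a| < b] in
  fine (if s == 0 then \d_(0 : R) E else normal_prob 0 s E).

End Gaussian.

(* Indices.  Block sizes p range over 'I_P.+1, i.e. 0 <= p <= P. *)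
Definition lo P (p : 'I_P.+1) : 'I_p -> 'I_P := widen_ord (leq_ord p).

Definition hi P (p : 'I_P.+1) (j : 'I_(P - p)) : 'I_P :=
  cast_ord (subnKC (leq_ord p)) (rshift p j).

(* [nth1 d x p] is x_p in 1-based numbering; it is only used for 1 <= p <= m. *)
Definition nth1 T (d : T) m (x : 'I_m -> T) (p : nat) : T :=
  oapp x d (insub p.-1).

Section Matrices.
Variable R : realType.

Definition entry1 m (x : 'cV[R]_m) (p : nat) : R := nth1 0 (x ^~ 0) p.

Definition diag1 m (M : 'M[R]_m) (p : nat) : R := nth1 0 (fun i => M i i) p.

Definition basis1 m (p : nat) : 'cV[R]_m := \col_(i < m) (i.+1 == p)%:R.

Definition firstcols m P (p : 'I_P.+1) (D : 'M[R]_(m, P)) : 'M[R]_(m, p) :=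
  colsub (lo (p := p)) D.

Definition stack P (p : 'I_P.+1) (u : 'cV[R]_p) (v : 'cV[R]_(P - p)) : 'cV[R]_P :=
  castmx (subnKC (leq_ord p), erefl 1%N) (col_mx u v).

Definition is_ginv m n (M : 'M[R]_(m, n)) (N : 'M[R]_(n, m)) : Prop :=
  M *m N *m M = M.

End Matrices.

Section Cdf.
Variables (R : realType) (k : nat).

Definition orthant (t : 'cV[R]_k) : set 'cV[R]_k :=
  [set z | forall i, z i 0 <= t i 0].

(* cdfs of finite measures, not necessarily of total mass one *)
Definition is_cdf (H : 'cV[R]_k -> R) : Prop :=
  exists mu : {finite_measure set 'cV[R]_k -> \bar R},
    forall t, H t = fine (mu (orthant t)).

(* For the cdf of a finite measure this is the total mass of the measure. *)
Definition total_mass (H : 'cV[R]_k -> R) : R := sup (range H).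

Definition weak_cvg (Hn : nat -> 'cV[R]_k -> R) (H : 'cV[R]_k -> R) : Prop :=
  (forall t, {for t, continuous H} -> Hn n t @[n --> \oo] --> H t) /\
  total_mass (Hn n) @[n --> \oo] --> total_mass H.

End Cdf.

Section FiniteSample.
Variables (R : realType) (P k : nat) (O : 'I_P.+1).
Variables (X : forall n, 'M[R]_(n, P)) (A : 'M[R]_(k, P)) (c : nat -> R).

Section Estimators.
Variables (n : nat) (Y : 'cV[R]_n).

Definition restricted_ls (p : 'I_P.+1) : 'cV[R]_P :=
  let Xp := firstcols p (X n) in
  stack (invmx (Xp^T *m Xp) *m Xp^T *m Y) 0.

Definition sigma_hat : R :=
  let r := Y - X n *m restricted_ls ord_max in
  Num.sqrt ((n - P)%:R^-1 * (r^T *m r) 0 0).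

Definition xi_n (p : 'I_P.+1) : R :=
  let Xp := firstcols p (X n) in
  Num.sqrt (diag1 (invmx (n%:R^-1 *: (Xp^T *m Xp))) p).

(* [known = false] is the feasible case, where the error standard deviation is
   estimated; [known = true] is the starred case, which uses the true sigma. *)
Variables (known : bool) (sigma : R).

Definition tstat (p : 'I_P.+1) : R :=
  if p == 0%N :> nat then 0 else
  Num.sqrt n%:R * entry1 (restricted_ls p) p /
    ((if known then sigma else sigma_hat) * xi_n p).

(* The index O always qualifies since c O = 0. *)
Definition phat : 'I_P.+1 :=
  [arg max_(p > O | (O <= p)%N && (c p <= `|tstat p|)) (p : nat)].

Definition post_selection : 'cV[R]_P :=
  \sum_(p < P.+1 | (O <= p)%N) (phat == p)%:R *: restricted_ls p.

End Estimators.

(* P_{n,theta,sigma}(Y in E) in the model Y = X theta + u, u ~ N(0, sigma^2 I) *)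
Definition prY n (theta : 'cV[R]_P) (sigma : R) (E : set 'cV[R]_n) : R :=
  fine (gaussian (sigma ^+ 2)%:M [set u | E (X n *m theta + u)]).

Section Laws.
Variables (known : bool) (n : nat) (theta : 'cV[R]_P) (sigma : R).

Definition scaled_error (Y : 'cV[R]_n) : 'cV[R]_k :=
  Num.sqrt n%:R *: (A *m (post_selection Y known sigma - theta)).

Definition selects (p : 'I_P.+1) : set 'cV[R]_n :=
  [set Y | phat Y known sigma = p].

Definition Glaw (B : set 'cV[R]_k) : R := prY theta sigma (scaled_error @^-1` B).

Definition Gcdf (t : 'cV[R]_k) : R := Glaw (orthant t).

Definition sel_prob (p : 'I_P.+1) : R := prY theta sigma (selects p).

Definition Glaw_cond (p : 'I_P.+1) (B : set 'cV[R]_k) : R :=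
  prY theta sigma (scaled_error @^-1` B `&` selects p) / sel_prob p.

Definition Gcdf_cond (p : 'I_P.+1) (t : 'cV[R]_k) : R := Glaw_cond p (orthant t).

End Laws.
End FiniteSample.

Section Limit.
Variables (R : realType) (P k : nat) (O : 'I_P.+1).
Variables (Q : 'M[R]_P) (A : 'M[R]_(k, P)) (c : nat -> R).
Variable ginv : 'I_P.+1 -> 'M[R]_k.
Variables (psi : 'I_P -> \bar R) (sigma : R).

(* the largest p > O with |psi_p| = oo, or O if there is none *)
Definition pstar : 'I_P.+1 :=
  [arg max_(p > O | (p == O) || ((O < p)%N && (`|nth1 0%E psi p| == +oo)%E))
     (p : nat)].

Definition Qpp (p : 'I_P.+1) : 'M[R]_p := mxsub (lo (p := p)) (lo (p := p)) Q.

Definition Qpn (p : 'I_P.+1) : 'M[R]_(p, P - p) :=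
  mxsub (lo (p := p)) (hi (p := p)) Q.

(* Only used for p >= pstar, where all components are finite. *)
Definition psi_tail (p : 'I_P.+1) : 'cV[R]_(P - p) := \col_j fine (psi (hi j)).

Definition delta (p : 'I_P.+1) : 'cV[R]_P :=
  stack (invmx (Qpp p) *m Qpn p *m psi_tail p) (- psi_tail p).

Definition Acov (p : 'I_P.+1) : 'M[R]_k :=
  firstcols p A *m invmx (Qpp p) *m (firstcols p A)^T.

(* For p = 0 the covariance is zero and this is the point mass at zero. *)
Definition Phi (p : 'I_P.+1) : probability 'cV[R]_k R :=
  gaussian (sigma ^+ 2 *: Acov p).

Definition Phi_cdf (p : 'I_P.+1) (t : 'cV[R]_k) : R := fine (Phi p (orthant t)).

Definition Cinf (p : 'I_P.+1) : 'cV[R]_k :=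
  firstcols p A *m invmx (Qpp p) *m basis1 R p p.

Definition xi_inf (p : 'I_P.+1) : R := Num.sqrt (diag1 (invmx (Qpp p)) p).

Definition b_inf (p : 'I_P.+1) : 'rV[R]_k := (Cinf p)^T *m ginv p.

Definition zeta_inf (p : 'I_P.+1) : R :=
  Num.sqrt (xi_inf p ^+ 2 - (b_inf p *m Cinf p) 0 0).

(* delta^(p)_p + psi_p; only used for p > pstar, where psi_p is finite *)
Definition mean_limit (p : 'I_P.+1) : R :=
  entry1 (delta p) p + fine (nth1 0%E psi p).

Definition Delta_xi (q : 'I_P.+1) : R :=
  Delta (sigma * xi_inf q) (mean_limit q) (c q * sigma * xi_inf q).

Definition stay_prod (p : 'I_P.+1) : R :=
  \prod_(q < P.+1 | (p < q)%N) Delta_xi q.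

Definition head_term (t : 'cV[R]_k) : R :=
  Phi_cdf pstar (t - A *m delta pstar) * stay_prod pstar.

Definition tail_term (p : 'I_P.+1) (t : 'cV[R]_k) : R :=
  (\int[Phi p]_(z in orthant (t - A *m delta p))
     (1 - Delta (sigma * zeta_inf p) (mean_limit p + (b_inf p *m z) 0 0)
                (c p * sigma * xi_inf p)))%R * stay_prod p.

Definition Ginf (t : 'cV[R]_k) : R :=
  head_term t + \sum_(p < P.+1 | (pstar < p)%N) tail_term p t.

Definition pi_inf (p : 'I_P.+1) : R :=
  if (pstar < p)%N then (1 - Delta_xi p) * stay_prod p
  else if p == pstar then stay_prod pstar
  else 0.

End Limit.

(* Along the subsequence phi, sqrt n * theta^(n) tends to psi in the extended
   reals, componentwise, and sigma^(n) tends to s. *)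
Definition params_cvg (R : realType) (P : nat) (theta : nat -> 'cV[R]_P)
    (sigma : nat -> R) (phi : nat -> nat) (psi : 'I_P -> \bar R) (s : R) : Prop :=
  (forall i, (Num.sqrt (phi m)%:R * theta (phi m) i 0)%:E @[m --> \oo] --> psi i) /\
  sigma (phi m) @[m --> \oo] --> s.

(* Main.v *)
(** A linear image B Z of a standard normal vector Z has a law that depends on B B'
    only, because the standard normal law is invariant under rotations.  For the
    Cholesky-type factor T of M = X'X/n, whose rows come from the leading blocks of
    M, the vector w = T X'u / (sigma sqrt n) is standard normal in R^P; the statistic
    T_q is (w_q + mean_q) / r, where r is the ratio of the estimated and the true
    standard deviation (r = 1 for the starred quantities), and the error of the
    p-parameter estimator is a constant plus a linear function of w_1, ..., w_p.
    Hence G(t | p) pi(p) is the probability of an event in (w, r), in which r tends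
    to 1 in probability while the means and the linear maps converge along a
    subsequence.  An infinite psi_q makes |mean_q| tend to infinity, so that models
    smaller than p_* are never selected and the test of p_* always rejects.  In the
    limit the coordinates w_q, q > p, are independent of the event on w_1, ..., w_p;
    they give the product of the Delta factors, and conditioning w_p on the limit of
    the estimation error gives the integral term.  The probabilities are sandwiched
    at t and at t + (e, ..., e); since the distribution function has continuity points
    t + (x, ..., x) with x in every interval, and is continuous from the right along
    the diagonal, this determines the accumulation point at every t. *)

Require Import Defs.
From HB Require Import structures.
From mathcomp Require Import all_boot all_order all_algebra.
From mathcomp Require Import all_classical all_reals all_analysis.
From mathcomp Require Import ring lra.

Set Implicit Arguments.
Unset Strict Implicit.
Unset Printing Implicit Defensive.

Import Order.TTheory GRing.Theory Num.Theory.
Import numFieldNormedType.Exports.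
Import measurable_realfun.

Local Open Scope classical_set_scope.
Local Open Scope ring_scope.

(** * The normal law on the line and on the plane *)

(** All limits are taken on one fixed probability space: the rows of [whitener] are orthonormal, so
    the whitened noise has the law [std_normal_cv P] at every sample size. Events in [w] with moving
    parameters can therefore be treated pointwise: an inequality that is strict at [w] in the limit
    holds for all large [m], and [pr_cvg0] turns this into convergence of probabilities. Only the
    variance ratio depends on the whole noise vector; it enters through an event of small
    probability and a widening of the critical values by [1 + e] or [1 - e]. The obstacle is
    degeneracy: the limiting fit may have a singular covariance, and is a point mass for [p = 0], so
    the set where it touches the corner [t] may have positive probability and convergence at [t]
    itself may fail. The boundaries of the tests are always null. Hence the final bounds keep a
    slack in [t] alone. The definition of [gaussian] selects a root of the covariance by choice, so
    the existence of a root has to be shown as well; like the invariance of the law, it comes from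
    plane rotations, written as products of shears. Selection probabilities are treated as the case
    of a matrix with zero rows in place of [A]. *)

Section NormalLine.
Variable R : realType.
Local Notation TR := (measurableTypeR R).
Local Notation mu := (@lebesgue_measure R).
Local Notation N01 := (@normal_prob R 0 1).

Lemma lebesgue_measure_translate (a : R) (A : set R) : measurable A ->
  pushforward mu ((fun x => x + a) : TR -> TR) A = mu A.
Proof.
move=> mA.
have ms : measurable_fun setT ((fun x => x + a) : TR -> TR).
  by apply: measurable_funD => //; exact: measurable_cst.
apply/esym/(@lebesgue_measure_unique _ (pushforward mu _)) => //= _ [[b c]] _ <-.
rewrite /pushforward.
have -> : (fun x => x + a) @^-1` `]b, c]%classic = `]b - a, c - a]%classic.
  by apply/seteqP; split => x /=; rewrite !in_itv/= ltrBlDr lerBrDr.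
by rewrite !lebesgue_measure_itv/= !lte_fin ltrD2r -!EFinB; case: ifP => // _; congr EFin; ring.
Qed.

Lemma ge0_integral_translate (a : R) (f : R -> \bar R) :
  measurable_fun [set: R] f -> (forall x, 0 <= f x)%E ->
  (\int[mu]_x f (x + a)%R = \int[mu]_x f x)%E.
Proof.
move=> mf f0.
have ms : measurable_fun setT ((fun x => x + a) : TR -> TR).
  by apply: measurable_funD => //; exact: measurable_cst.
have /= <- := @ge0_integral_pushforward _ _ TR TR R _ ms mu setT f measurableT mf (fun x _ => f0 x).
by apply: eq_measure_integral => //= A mA _; exact: lebesgue_measure_translate.
Qed.

Lemma ge0_integral_oppr (f : R -> \bar R) :
  measurable_fun [set: R] f -> (forall x, 0 <= f x)%E ->
  (\int[mu]_x f (- x)%R = \int[mu]_x f x)%E.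
Proof.
move=> mf f0.
have ms : measurable_fun setT ((fun x => - x) : TR -> TR).
  exact: (@oppr_measurable R setT).
have /= <- := @ge0_integral_pushforward _ _ TR TR R _ ms mu setT f measurableT mf (fun x _ => f0 x).
by apply: eq_measure_integral => //= A mA _; exact: lebesgue_measureN.
Qed.

(** The Radon-Nikodym derivative of the normal law agrees almost everywhere with [normal_pdf],
    because both integrate to the same measure over every measurable set. *)
Lemma ge0_integral_normal_prob (m s : R) (f : R -> \bar R) :
  measurable_fun [set: R] f -> (forall x, 0 <= f x)%E ->
  (\int[normal_prob m s]_x f x = \int[mu]_x (f x * (normal_pdf m s x)%:E))%E.
Proof.
move=> mf f0.
have dom := @normal_prob_dominates R m s.
rewrite -(@Radon_Nikodym_SigmaFinite.change_of_variables _ TR R (normal_prob m s) mu dom)//.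
apply: ae_eq_integral => //.
- apply: emeasurable_funM => //.
  exact: measurable_int (Radon_Nikodym_SigmaFinite.f_integrable dom).
- apply: emeasurable_funM => //; apply/measurable_EFinP.
  exact: measurable_normal_pdf.
apply: ae_eqe_mul2l => /=.
apply: integral_ae_eq => //=.
- exact: Radon_Nikodym_SigmaFinite.f_integrable.
- by apply/measurable_EFinP; exact: measurable_normal_pdf.
- by move=> E _ mE; rewrite -Radon_Nikodym_SigmaFinite.f_integral.
Qed.

Lemma measurable_idTR : measurable_fun [set: TR] (idfun : TR -> R).
Proof. by move=> _ B mB; rewrite setTI. Qed.

Lemma measurable_pair2 d (T : measurableType d) (h : TR * TR -> \bar R) (u v : T -> R) :
  measurable_fun setT h -> measurable_fun setT u -> measurable_fun setT v ->
  measurable_fun setT (fun z : T => h (u z, v z)).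
Proof.
move=> mh mu' mv.
have H := @measurable_fun_pair _ _ _ T TR TR u v mu' mv.
exact: (measurableT_comp mh H).
Qed.

Lemma measurable_fst2 : measurable_fun setT (fun z : TR * TR => z.1 : R).
Proof. exact: (@measurable_fst _ _ TR TR). Qed.

Lemma measurable_snd2 : measurable_fun setT (fun z : TR * TR => z.2 : R).
Proof. exact: (@measurable_snd _ _ TR TR). Qed.

Lemma measurable_lin2 (a b : R) : measurable_fun setT (fun z : TR * TR => a * (z.1 : R) + b * (z.2 : R)).
Proof.
apply: measurable_funD; apply: measurable_funM; try exact: measurable_cst.
  exact: measurable_fst2.
exact: measurable_snd2.
Qed.

Lemma ge0_integral_shear_y (a : R) (h : TR * TR -> \bar R) :
  measurable_fun setT h -> (forall z, 0 <= h z)%E ->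
  (\int[mu]_x \int[mu]_y h (x, (y + a * x)%R) = \int[mu]_x \int[mu]_y h (x, y))%E.
Proof.
move=> mh h0; apply: eq_integral => x _.
apply: (ge0_integral_translate (a * x) (f := fun y => h (x, y))) => //.
exact: (@measurable_pair2 _ TR h (cst x) idfun _ _ measurable_idTR).
Qed.

Lemma ge0_integral_shear_x (a : R) (h : TR * TR -> \bar R) :
  measurable_fun setT h -> (forall z, 0 <= h z)%E ->
  (\int[mu]_x \int[mu]_y h ((x + a * y)%R, y) = \int[mu]_x \int[mu]_y h (x, y))%E.
Proof.
move=> mh h0.
rewrite (fubini_tonelli (m1 := mu) (m2 := mu) h mh h0).
have := @fubini_tonelli _ _ TR TR R mu mu (fun z => h (z.1 + a * z.2, z.2)) _ (fun z => h0 _).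
move=> /= ->; last first.
  apply: (@measurable_pair2 _ (TR * TR)%type h (fun z : TR * TR => (z.1 : R) + a * z.2) (fun z : TR * TR => z.2 : R) mh _ measurable_snd2).
  rewrite (_ : (fun _ => _) = (fun z : TR * TR => 1 * (z.1:R) + a * (z.2:R))); first exact: measurable_lin2.
  by apply/funext => z; rewrite mul1r.
apply: eq_integral => y _.
apply: (ge0_integral_translate (a * y) (f := fun x => h (x, y))) => //.
exact: (@measurable_pair2 _ TR h idfun (cst y) _ measurable_idTR).
Qed.

(** A rotation by an angle [a] is a product of three shears: along x with factor [- tan (a / 2)],
    along y with factor [sin a], and along x again. Each shear preserves the area by Fubini and
    translation invariance. Here [t = s / (1 + c)] is the half-angle tangent, whence the exclusion
    of [c = -1]. *)
Lemma ge0_lebesgue_rotation (c s : R) (h : TR * TR -> \bar R) :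
  c ^+ 2 + s ^+ 2 = 1 -> c != -1 ->
  measurable_fun setT h -> (forall z, 0 <= h z)%E ->
  (\int[mu]_x \int[mu]_y h ((c * x - s * y)%R, (s * x + c * y)%R) =
   \int[mu]_x \int[mu]_y h (x, y))%E.
Proof.
move=> cs c1 mh h0; pose t := s / (1 + c).
have c10 : 1 + c != 0 by apply: contra c1 => /eqP e; apply/eqP; lra.
have tE : t * (1 + c) = s by rewrite /t divfK.
have stE : 1 - s * t = c.
  apply: (mulIf c10); rewrite mulrBl -mulrA tE; lra.
have mX (f : R) : measurable_fun setT (fun z : TR * TR => (z.1 : R) + f * z.2).
  rewrite (_ : (fun _ => _) = (fun z : TR * TR => 1 * (z.1:R) + f * (z.2:R))); first exact: measurable_lin2.
  by apply/funext => z; rewrite mul1r.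
have mY (f : R) : measurable_fun setT (fun z : TR * TR => (z.2 : R) + f * z.1).
  rewrite (_ : (fun _ => _) = (fun z : TR * TR => f * (z.1:R) + 1 * (z.2:R))); first exact: measurable_lin2.
  by apply/funext => z; rewrite mul1r addrC.
pose h3 (z : TR * TR) := h (z.1 + (- t) * z.2, z.2).
have mh3 : measurable_fun setT h3.
  exact: (@measurable_pair2 _ (TR * TR)%type h (fun z : TR * TR => (z.1 : R) + (- t) * z.2) (fun z : TR * TR => z.2 : R) mh (mX _) measurable_snd2).
pose h2 (z : TR * TR) := h3 (z.1, z.2 + s * z.1).
have mh2 : measurable_fun setT h2.
  exact: (@measurable_pair2 _ (TR * TR)%type h3 (fun z : TR * TR => z.1 : R) (fun z : TR * TR => (z.2 : R) + s * z.1) mh3 measurable_fst2 (mY _)).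
rewrite -(ge0_integral_shear_x (- t) mh h0).
have /= <- := @ge0_integral_shear_y s h3 mh3 (fun z => h0 _).
have /= <- := @ge0_integral_shear_x (- t) h2 mh2 (fun z => h0 _).
apply: eq_integral => x _; apply: eq_integral => y _; rewrite /h2 /h3 /=.
congr (h (_, _)).
  have -> : x + - t * y + - t * (y + s * (x + - t * y)) = (1 - s * t) * x - ((1 - s * t) + 1) * t * y by ring.
  by rewrite stE -tE; ring.
have -> : y + s * (x + - t * y) = s * x + (1 - s * t) * y by ring.
by rewrite stE.
Qed.

Lemma normal_pdf01 (x : R) : normal_pdf 0 1 x = normal_peak 1 * expR (- (x ^+ 2 / 2)).
Proof.
rewrite normal_pdfE ?oner_eq0//= /normal_fun; congr (_ * expR _).
by rewrite subr0 expr1n mulNr.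
Qed.

(** The product density depends on [x ^+ 2 + y ^+ 2] only; it is absorbed into the integrand, and
    the Lebesgue case applies. *)
Lemma ge0_normal_rotation (c s : R) (g : TR * TR -> \bar R) :
  c ^+ 2 + s ^+ 2 = 1 -> c != -1 ->
  measurable_fun setT g -> (forall z, 0 <= g z)%E ->
  (\int[N01]_x \int[N01]_y g ((c * x - s * y)%R, (s * x + c * y)%R) =
   \int[N01]_x \int[N01]_y g (x, y))%E.
Proof.
move=> cs c1 mg g0.
have key (f : TR * TR -> \bar R) : measurable_fun setT f -> (forall z, 0 <= f z)%E ->
  (\int[N01]_x \int[N01]_y f (x, y) = \int[mu]_x \int[mu]_y (f (x, y) * (normal_pdf 0 1 x * normal_pdf 0 1 y)%:E))%E.
  move=> mf f0.
  rewrite ge0_integral_normal_prob; last 2 first.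
  - exact: (@measurable_fun_fubini_tonelli_F _ _ TR TR R N01 f mf f0).
  - by move=> x; apply: integral_ge0.
  apply: eq_integral => x _.
  rewrite ge0_integral_normal_prob//; last first.
    exact: (@measurable_pair2 _ TR f (cst x) idfun _ _ measurable_idTR).
  rewrite -ge0_integralZr//=.
  - by apply: eq_integral => y _; rewrite -muleA -EFinM mulrC.
  - apply: emeasurable_funM; first exact: (@measurable_pair2 _ TR f (cst x) idfun _ _ measurable_idTR).
    by apply/measurable_EFinP; exact: measurable_normal_pdf.
  - by move=> y _; rewrite mule_ge0// lee_fin normal_pdf_ge0.
  - by rewrite lee_fin normal_pdf_ge0.
have mrot : measurable_fun setT (fun z : TR * TR => g (c * (z.1:R) - s * (z.2:R), s * (z.1 : R) + c * (z.2 : R))).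
  apply: (@measurable_pair2 _ (TR * TR)%type g (fun z : TR * TR => c * (z.1:R) - s * (z.2:R)) (fun z : TR * TR => s * (z.1 : R) + c * (z.2 : R)) mg _ (measurable_lin2 _ _)).
  rewrite (_ : (fun _ => _) = (fun z : TR * TR => c * (z.1:R) + (- s) * (z.2:R))); first exact: measurable_lin2.
  by apply/funext => z; rewrite mulNr.
have /= -> := key _ mrot (fun z => g0 _).
rewrite (key _ mg g0).
pose h (z : TR * TR) := (g z * (normal_pdf 0 1 (z.1 : R) * normal_pdf 0 1 (z.2 : R))%:E)%E.
have mh : measurable_fun setT h.
  apply: emeasurable_funM => //; apply/measurable_EFinP; apply: measurable_funM.
    by apply: (measurableT_comp (measurable_normal_pdf 0 1)); exact: measurable_fst2.
  by apply: (measurableT_comp (measurable_normal_pdf 0 1)); exact: measurable_snd2.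
have h0 z : (0 <= h z)%E by rewrite mule_ge0// lee_fin mulr_ge0// normal_pdf_ge0.
rewrite -(ge0_lebesgue_rotation cs c1 mh h0).
apply: eq_integral => x _; apply: eq_integral => y _; rewrite /h /=; congr (_ * _%:E)%E.
rewrite !normal_pdf01 mulrACA [RHS]mulrACA -!expRD; congr (_ * expR _).
rewrite -!opprD -!mulrDl; congr (- (_ / _)).
have -> : (c * x - s * y) ^+ 2 + (s * x + c * y) ^+ 2 = (c ^+ 2 + s ^+ 2) * (x ^+ 2 + y ^+ 2) by ring.
by rewrite cs mul1r.
Qed.

Lemma ge0_normal_oppr (f : R -> \bar R) :
  measurable_fun [set: R] f -> (forall x, 0 <= f x)%E ->
  (\int[N01]_x f (- x)%R = \int[N01]_x f x)%E.
Proof.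
move=> mf f0.
rewrite [RHS]ge0_integral_normal_prob// ge0_integral_normal_prob//; last first.
  exact: (measurableT_comp mf (@oppr_measurable R setT)).
rewrite -[RHS]ge0_integral_oppr.
- by apply: eq_integral => x _; rewrite !normal_pdf01 sqrrN.
- by apply: emeasurable_funM => //; apply/measurable_EFinP; exact: measurable_normal_pdf.
- by move=> x; rewrite mule_ge0// lee_fin normal_pdf_ge0.
Qed.

End NormalLine.

(** * Standard normal vectors and Gram matrices *)

Section NormalVector.
Variable R : realType.
Local Notation TR := (measurableTypeR R).
Local Notation N01 := (@normal_prob R 0 1).

(** Multiplication by [1%:M] only turns a tuple into a column vector, the form in which matrices
    act. *)
Definition std_normal_cv n : probability 'cV[R]_n R :=
  distribution (std_normal R n) (mul_tuple 1%:M).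

Local Notation nu := std_normal_cv.

Lemma measurable_mulmx m n (B : 'M[R]_(m, n)) :
  measurable_fun [set: 'cV[R]_n] (fun z : 'cV[R]_n => B *m z).
Proof.
apply: measurable_fun_mx => i j.
rewrite (_ : (fun _ => _) = fun z : 'cV[R]_n => \sum_l B i l * z l j); last first.
  by apply/funext => z; rewrite mxE.
apply: measurable_sum => l; apply: measurable_funM; first exact: measurable_cst.
exact: measurable_entry.
Qed.

Lemma gaussianE n (S : 'M[R]_n) (E : set 'cV[R]_n) :
  gaussian S E = nu n [set z | E (root_mx S *m z)].
Proof.
rewrite /gaussian /nu /distribution /pushforward/=; congr (std_normal R n _).
by apply/seteqP; split => z /=; rewrite /mul_tuple mul1mx.
Qed.

Definition cons_cv n (x : R) (y : 'cV[R]_n) : 'cV[R]_n.+1 :=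
  @col_mx R 1 n 1 x%:M y.

Lemma cons_cv0 n x (y : 'cV[R]_n) j : cons_cv x y ord0 j = x.
Proof.
rewrite (_ : ord0 = lshift n (ord0 : 'I_1)); last exact/val_inj.
by apply: (etrans (@col_mxEu R 1 n 1 _ _ _ _)); rewrite !ord1 mxE eqxx mulr1n.
Qed.

Lemma cons_cvS n x (y : 'cV[R]_n) i j : cons_cv x y (lift ord0 i) j = y i j.
Proof.
rewrite (_ : lift ord0 i = rshift 1 i); last exact/val_inj.
exact: (@col_mxEd R 1 n 1).
Qed.

Lemma measurable_cons_cv n :
  measurable_fun [set: TR * 'cV[R]_n]
    (fun z : TR * 'cV[R]_n => cons_cv (z.1 : R) z.2).
Proof.
apply: measurable_fun_mx => i j; have [k ->|->] := unliftP ord0 i.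
  rewrite (_ : (fun _ => _) = (fun y : 'cV[R]_n => y k j) \o snd); last first.
    by apply/funext => z /=; rewrite cons_cvS.
  apply: measurableT_comp; first exact: measurable_entry.
  exact: measurable_snd.
rewrite (_ : (fun _ => _) = fun z : TR * 'cV[R]_n => z.1 : R); last first.
  by apply/funext => z /=; rewrite cons_cv0.
by move=> mD B mB; exact: (@measurable_fst _ _ TR _).
Qed.

(** Fubini for the first coordinate; inductions on the dimension go through this formula. *)
Lemma ge0_integral_nuS n (f : 'cV[R]_n.+1 -> \bar R) :
  measurable_fun setT f -> (forall z, 0 <= f z)%E ->
  (\int[nu n.+1]_z f z =
   \int[N01]_x \int[nu n]_y f (cons_cv x y))%E.
Proof.
move=> mf f0.
have m1 k := @measurable_mul_tuple R k k 1%:M.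
rewrite (@ge0_integral_pushforward _ _ _ _ R _ (m1 n.+1) (std_normal R n.+1) setT f measurableT mf (fun z _ => f0 z)).
rewrite preimage_setT.
have mf1 : measurable_fun setT (f \o mul_tuple 1%:M) by apply: measurableT_comp.
rewrite (@ge0_integral_pushforward _ _ _ _ R _ (@measurable_tcons R n) (N01 \x std_normal R n)%E setT _ measurableT mf1 (fun z _ => f0 _)).
rewrite preimage_setT.
have mf2 : measurable_fun setT ((f \o mul_tuple 1%:M) \o @tcons R n).
  by apply: measurableT_comp => //; exact: measurable_tcons.
rewrite (fubini_tonelli1 _ mf2 (fun z => f0 _)).
apply: eq_integral => x _; rewrite /fubini_F/=.
have mf3 : measurable_fun setT (fun y : 'cV[R]_n => f (cons_cv x y)).
  have H := @measurableT_comp _ _ _ _ _ _ _ _ _ mf (@measurable_cons_cv n).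
  have := measurable_fun_pair2 x H.
  by [].
rewrite (@ge0_integral_pushforward _ _ _ _ R _ (m1 n) (std_normal R n) setT _ measurableT mf3 (fun z _ => f0 _)).
rewrite preimage_setT; apply: eq_integral => y _ /=; congr f.
rewrite /mul_tuple !mul1mx; apply/matrixP => i j.
rewrite mxE; have [k ->|->] := unliftP ord0 i; last by rewrite cons_cv0.
by rewrite cons_cvS mxE /tcons tnthS.
Qed.

Lemma cons_cvP n (z : 'cV[R]_n.+1) : {x & {y | z = cons_cv x y}}.
Proof.
exists (z ord0 0), (\col_i z (lift ord0 i) 0); apply/matrixP => i j.
have [k ->|->] := unliftP ord0 i; last by rewrite cons_cv0 ord1.
by rewrite cons_cvS mxE ord1.
Qed.

Lemma scale_cons n a x (y : 'cV[R]_n) : a *: cons_cv x y = cons_cv (a * x) (a *: y).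
Proof.
apply/matrixP => i j; rewrite mxE; have [k ->|->] := unliftP ord0 i.
  by rewrite !cons_cvS mxE.
by rewrite !cons_cv0.
Qed.

Lemma add_cons n x (y : 'cV[R]_n) x' y' :
  cons_cv x y + cons_cv x' y' = cons_cv (x + x') (y + y').
Proof.
apply/matrixP => i j; rewrite mxE; have [k ->|->] := unliftP ord0 i.
  by rewrite !cons_cvS mxE.
by rewrite !cons_cv0.
Qed.

Lemma cons_cv00 n : cons_cv 0 0 = 0 :> 'cV[R]_n.+1.
Proof.
apply/matrixP => i j; rewrite [RHS]mxE; have [k ->|->] := unliftP ord0 i.
  by rewrite !cons_cvS mxE.
by rewrite !cons_cv0.
Qed.

Lemma mul_block_cons m n (a : 'cV[R]_m) (B : 'M[R]_(m, n)) x y :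
  @row_mx R m 1 n a B *m cons_cv x y = x *: a + B *m y.
Proof. by rewrite /cons_cv mul_row_col mul_mx_scalar. Qed.

Lemma mul_cons_block n p (a : R) (u : 'rV[R]_n) (v : 'cV[R]_p) (B : 'M[R]_(p, n)) x y :
  @block_mx R 1 p 1 n a%:M u v B *m cons_cv x y =
  cons_cv (a * x + (u *m y) 0 0) (x *: v + B *m y).
Proof.
rewrite /cons_cv mul_block_col mul_mx_scalar; congr col_mx.
  by apply/matrixP => i j; rewrite !ord1 !mxE !eqxx !mulr1n mulrC.
by rewrite mul_mx_scalar.
Qed.

Lemma dot_cons n x (y : 'cV[R]_n) x' y' :
  (cons_cv x y)^T *m cons_cv x' y' = (x * x')%:M + y^T *m y'.
Proof. by rewrite /cons_cv (@tr_col_mx _ 1 n 1) (@mul_row_col _ 1 1 n 1) tr_scalar_mx scalar_mxM. Qed.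

Opaque cons_cv.

(** Invariance is phrased with integrals of nonnegative functions, since this form passes directly
    through the iterated integrals of [ge0_integral_nuS]. *)
Definition nu_preserving n (G : 'M[R]_n) := forall f : 'cV[R]_n -> \bar R,
  measurable_fun setT f -> (forall z, 0 <= f z)%E ->
  (\int[nu n]_z f (G *m z) = \int[nu n]_z f z)%E.

Lemma measurable_fun_mulmx m n (B : 'M[R]_(m, n)) (f : 'cV[R]_m -> \bar R) :
  measurable_fun setT f -> measurable_fun setT (fun z => f (B *m z)).
Proof. by move=> mf; apply: measurableT_comp => //; exact: measurable_mulmx. Qed.

Lemma measurable_fun_cons n (f : 'cV[R]_n.+1 -> \bar R) x :
  measurable_fun setT f -> measurable_fun setT (fun y => f (cons_cv x y)).
Proof.
move=> mf.
have H := @measurableT_comp _ _ _ _ _ _ _ _ _ mf (@measurable_cons_cv n).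
by have := measurable_fun_pair2 (x : TR) H.
Qed.

Lemma nu_preserving1 n : @nu_preserving n 1%:M.
Proof. by move=> f mf f0; apply: eq_integral => z _; rewrite mul1mx. Qed.

Lemma nu_preservingM n (G H : 'M[R]_n) :
  nu_preserving G -> nu_preserving H -> nu_preserving (G *m H).
Proof.
move=> pG pH f mf f0; rewrite -[RHS]pG// -[RHS](pH (fun z => f (G *m z)))//; last exact: measurable_fun_mulmx.
by apply: eq_integral => z _; rewrite mulmxA.
Qed.

Lemma nu_preservingV n (G K : 'M[R]_n) :
  K *m G = 1%:M -> nu_preserving G -> nu_preserving K.
Proof.
move=> KG pG f mf f0; rewrite -[LHS]pG//; last exact: measurable_fun_mulmx.
by apply: eq_integral => z _; rewrite mulmxA KG mul1mx.
Qed.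

Lemma nu_preserving_lift n (G : 'M[R]_n) :
  nu_preserving G -> nu_preserving (@block_mx R 1 n 1 n 1%:M 0 0 G : 'M[R]_n.+1).
Proof.
move=> pG f mf f0; rewrite !ge0_integral_nuS//; last exact: measurable_fun_mulmx.
apply: eq_integral => x _; rewrite -[RHS]pG//; last exact: measurable_fun_cons.
apply: eq_integral => y _; congr f.
by rewrite mul_cons_block mul0mx mxE mul1r addr0 scaler0 add0r.
Qed.

Lemma nu_preserving_sign n :
  nu_preserving (@block_mx R 1 n 1 n (-1)%:M 0 0 1%:M : 'M[R]_n.+1).
Proof.
move=> f mf f0; rewrite !ge0_integral_nuS//; last exact: measurable_fun_mulmx.
pose g (x : R) := (\int[nu n]_y f (cons_cv x y))%E.
have mg : measurable_fun setT g.
  have H := @measurableT_comp _ _ _ _ _ _ _ _ _ mf (@measurable_cons_cv n).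
  exact: (@measurable_fun_fubini_tonelli_F _ _ TR _ R (nu n) _ H (fun z => f0 _)).
rewrite -(@ge0_normal_oppr _ g mg); last by move=> x; apply: integral_ge0.
apply: eq_integral => x _; apply: eq_integral => y _; congr f.
by rewrite mul_cons_block mul0mx mxE mulN1r addr0 scaler0 add0r mul1mx.
Qed.

Definition rot12 n (c s : R) : 'M[R]_n.+2 :=
  @block_mx R 1 n.+1 1 n.+1 c%:M (@row_mx R 1 1 n (- s)%:M 0)
    (cons_cv s 0) (@block_mx R 1 n 1 n c%:M 0 0 1%:M).

Lemma mul_rot12 n c s x y (z : 'cV[R]_n) :
  rot12 n c s *m cons_cv x (cons_cv y z) =
  cons_cv (c * x - s * y) (cons_cv (s * x + c * y) z).
Proof.
rewrite /rot12 mul_cons_block mul_block_cons mul0mx addr0; congr cons_cv.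
  by rewrite !mxE eqxx mulr1n mulrN [y * s]mulrC.
rewrite mul_cons_block mul0mx mxE addr0 scaler0 add0r mul1mx.
by rewrite scale_cons add_cons scaler0 add0r mulrC.
Qed.

Lemma orthP n (G : 'M[R]_n) :
  (forall z z' : 'cV[R]_n, (G *m z)^T *m (G *m z') = z^T *m z') -> G^T *m G = 1%:M.
Proof.
move=> H; apply/matrixP => i j.
have := H (delta_mx i 0) (delta_mx j 0).
rewrite trmx_mul -mulmxA (mulmxA G^T) trmx_delta -colE -rowE.
rewrite mul_delta_mx_cond => /matrixP/(_ 0 0); rewrite [in X in X -> _]mxE [in X in X = _]mxE => ->.
by rewrite mulmxnE !mxE !eqxx.
Qed.

Lemma eq_mulmx_cv m n (G H : 'M[R]_(m, n)) :
  (forall z : 'cV[R]_n, G *m z = H *m z) -> G = H.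
Proof.
by move=> GH; apply/matrixP => i j; have := GH (delta_mx j 0); rewrite -!colE => /matrixP/(_ i 0); rewrite !mxE.
Qed.

Lemma orth_rot12 n c s : c ^+ 2 + s ^+ 2 = 1 ->
  (rot12 n c s)^T *m rot12 n c s = 1%:M.
Proof.
move=> cs; apply: orthP => z z'.
have [x [u ->]] := cons_cvP z; have [y [w ->]] := cons_cvP u.
have [x' [u' ->]] := cons_cvP z'; have [y' [w' ->]] := cons_cvP u'.
rewrite !mul_rot12 !dot_cons !addrA -!raddfD/=; congr (_%:M + _).
have -> : (c * x - s * y) * (c * x' - s * y') + (s * x + c * y) * (s * x' + c * y')
   = (c ^+ 2 + s ^+ 2) * (x * x' + y * y') by ring.
by rewrite cs mul1r.
Qed.

Lemma mul_lift n (G : 'M[R]_n) x y :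
  @block_mx R 1 n 1 n 1%:M 0 0 G *m cons_cv x y = cons_cv x (G *m y).
Proof. by rewrite mul_cons_block mul0mx mxE mul1r addr0 scaler0 add0r. Qed.

Lemma orth_lift n (G : 'M[R]_n) : G^T *m G = 1%:M ->
  (@block_mx R 1 n 1 n 1%:M 0 0 G : 'M[R]_n.+1)^T *m (@block_mx R 1 n 1 n 1%:M 0 0 G) = 1%:M.
Proof.
move=> GG; apply: orthP => z z'.
have [x [y ->]] := cons_cvP z; have [x' [y' ->]] := cons_cvP z'.
by rewrite !mul_lift !dot_cons trmx_mul -mulmxA (mulmxA G^T) GG mul1mx.
Qed.

Lemma nu_preserving_rot12 n c s : c ^+ 2 + s ^+ 2 = 1 -> c != -1 ->
  nu_preserving (rot12 n c s).
Proof.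
move=> cs c1 f mf f0; rewrite !ge0_integral_nuS//; last exact: measurable_fun_mulmx.
pose g (z : TR * TR) := (\int[nu n]_y f (cons_cv z.1 (cons_cv z.2 y)))%E.
have mg : measurable_fun setT g.
  pose h (w : (TR * TR) * 'cV[R]_n) := f (cons_cv w.1.1 (cons_cv w.1.2 w.2)).
  have mh : measurable_fun setT h.
    apply: measurableT_comp => //; apply: measurable_fun_mx => i j.
    have mf1 := @measurable_fst _ _ (TR * TR)%type 'cV[R]_n.
    have mf2 := @measurable_snd _ _ (TR * TR)%type 'cV[R]_n.
    have [k ->|->] := unliftP ord0 i; last first.
      under eq_fun do rewrite cons_cv0.
      exact: (measurableT_comp (@measurable_fst2 R) mf1).
    under eq_fun do rewrite cons_cvS.
    have [l ->|->] := unliftP ord0 k; last first.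
      under eq_fun do rewrite cons_cv0.
      exact: (measurableT_comp (@measurable_snd2 R) mf1).
    under eq_fun do rewrite cons_cvS.
    exact: (measurableT_comp (@measurable_entry R n 1 l j) mf2).
  exact: (@measurable_fun_fubini_tonelli_F _ _ (TR * TR)%type _ R (nu n) _ mh (fun z => f0 _)).
have g0 z : (0 <= g z)%E by apply: integral_ge0.
have key (F : 'cV[R]_n.+2 -> \bar R) : measurable_fun setT F -> (forall z, 0 <= F z)%E ->
  (\int[N01]_x \int[nu n.+1]_y F (cons_cv x y) = \int[N01]_x \int[N01]_y \int[nu n]_z F (cons_cv x (cons_cv y z)))%E.
  move=> mF F0; apply: eq_integral => x _; rewrite ge0_integral_nuS//.
  exact: measurable_fun_cons.
apply: (etrans (key (fun z => f (rot12 n c s *m z)) (measurable_fun_mulmx _ mf) (fun z => f0 _))).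
apply/esym/(etrans (key f mf f0)).
apply: (etrans (esym (ge0_normal_rotation cs c1 mg g0))); apply/esym.
apply: eq_integral => x _; apply: eq_integral => y _; apply: eq_integral => z _.
by rewrite mul_rot12.
Qed.

(** By induction the tail of [v] is moved to its own first axis, with value [r]; one rotation of the
    first two coordinates then removes [r]. If [r] is nonzero, so is the sine of that rotation,
    which keeps its cosine away from [-1]; for [r = 0] nothing remains to be rotated. *)
Lemma rotate_to_axis n (v : 'cV[R]_n.+1) : exists G : 'M[R]_n.+1,
  [/\ G^T *m G = 1%:M, nu_preserving G & exists r, G *m v = cons_cv r 0].
Proof.
elim: n v => [|n IH] v.
  exists 1%:M; rewrite trmx1 mulmx1; split => //; first exact: nu_preserving1.
  have [x [y ->]] := cons_cvP v; exists x; rewrite mul1mx; congr cons_cv.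
  by apply/matrixP => -[].
have [x [y ->]] := cons_cvP v; have [G' [GG' pG' [r Gr]]] := IH y.
have [r0|r0] := eqVneq r 0.
  exists (@block_mx R 1 n.+1 1 n.+1 1%:M 0 0 G'); split.
  - exact: orth_lift.
  - exact: nu_preserving_lift.
  exists x; rewrite mul_lift Gr r0; congr cons_cv.
  by rewrite cons_cv00.
pose q := Num.sqrt (x ^+ 2 + r ^+ 2).
have q2 : q ^+ 2 = x ^+ 2 + r ^+ 2 by rewrite sqr_sqrtr// addr_ge0// sqr_ge0.
have r20 : 0 < r ^+ 2 by rewrite lt_def sqr_ge0 sqrf_eq0 r0.
have q0 : q != 0.
  by rewrite -sqrf_eq0 q2 gt_eqF// ltr_wpDl// sqr_ge0.
have cs : (x / q) ^+ 2 + (- r / q) ^+ 2 = 1.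
  by rewrite !exprMn sqrrN -mulrDl -q2 exprVn divff// sqrf_eq0.
have c1 : x / q != -1.
  apply/eqP => e; move: cs; rewrite e sqrrN expr1n => /eqP.
  by rewrite -subr_eq0 addrC addKr sqrf_eq0 mulf_eq0 invr_eq0 (negbTE q0) orbF oppr_eq0 (negbTE r0).
exists (rot12 n (x / q) (- r / q) *m @block_mx R 1 n.+1 1 n.+1 1%:M 0 0 G'); split.
- by rewrite trmx_mul -mulmxA (mulmxA (rot12 _ _ _)^T) orth_rot12// mul1mx orth_lift.
- by apply: nu_preservingM; [exact: nu_preserving_rot12|exact: nu_preserving_lift].
exists (x / q * x - - r / q * r); rewrite -mulmxA mul_lift Gr mul_rot12; congr cons_cv.
rewrite (_ : - r / q * x + x / q * r = 0); last by field.
by rewrite cons_cv00.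
Qed.

(** If [G] takes [v] to the first axis, the reflection along [v] is the conjugate by [G] of the sign
    change of the first coordinate, and N(0, 1) is symmetric. *)
Lemma nu_preserving_householder n (v : 'cV[R]_n) (q : R) :
  q != 0 -> (v^T *m v) 0 0 = q ->
  nu_preserving (1%:M - (2 / q) *: (v *m v^T)).
Proof.
case: n v => [|n] v q0 vq.
  by move: q0; rewrite -vq mxE big_ord0 eqxx.
have [G [GG pG [r Gr]]] := rotate_to_axis v.
have GG' : G *m G^T = 1%:M by apply: mulmx1C.
have qr : q = r ^+ 2.
  have : (G *m v)^T *m (G *m v) = (r ^+ 2)%:M by rewrite Gr dot_cons mulmx0 addr0.
  rewrite trmx_mul -mulmxA (mulmxA G^T) GG mul1mx => /matrixP/(_ 0 0).
  by rewrite vq mxE eqxx.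
pose Dg : 'M[R]_n.+1 := @block_mx R 1 n 1 n (-1)%:M 0 0 1%:M.
have vE : v = G^T *m cons_cv r 0 by rewrite -Gr mulmxA GG mul1mx.
have -> : 1%:M - (2 / q) *: (v *m v^T) = G^T *m (Dg *m G).
  have -> : Dg = 1%:M - (2 / q) *: (cons_cv r 0 *m (cons_cv r 0)^T).
    apply: eq_mulmx_cv => z; have [x [y ->]] := cons_cvP z.
    rewrite mul_cons_block mul0mx mxE mulN1r addr0 scaler0 add0r mul1mx.
    rewrite mulmxBl mul1mx -scalemxAl -mulmxA dot_cons trmx0 mul0mx addr0.
    rewrite mul_mx_scalar !scale_cons !scaler0 -[- cons_cv _ _]scaleN1r scale_cons add_cons scaler0 addr0.
    congr cons_cv; rewrite qr; field; by move: q0; rewrite qr sqrf_eq0.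
  rewrite mulmxBl mulmxBr mul1mx GG; congr (_ - _).
  by rewrite -scalemxAl -scalemxAr [in LHS]vE trmx_mul trmxK !mulmxA.
apply: nu_preservingM; first exact: nu_preservingV pG.
by apply: nu_preservingM => //; exact: nu_preserving_sign.
Qed.

(* D is reached from B by reflections, one for each row, that fix the rows already
   matched. *)
Lemma gram_eq_orbit m n (B D : 'M[R]_(m, n)) : B *m B^T = D *m D^T ->
  exists2 U, nu_preserving U & D = B *m U.
Proof.
move=> BD.
have rows i : (i <= m)%N ->
    exists U, [/\ nu_preserving U, (B *m U) *m (B *m U)^T = D *m D^T
    & forall j : 'I_m, (j < i)%N -> row j (B *m U) = row j D].
  elim: i => [_|i IH im].
    by exists 1%:M; rewrite mulmx1; split => //; exact: nu_preserving1.
  have [U [pU gU rU]] := IH (ltnW im).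
  pose oi := Ordinal im; pose C := B *m U.
  (* The reflection along [v] sends row [oi] of [C] to that of [D], because the two rows have equal
     norms. It fixes each row matched earlier, whose inner products with these two rows agree. *)
  pose v := (row oi C - row oi D)^T.
  have dotE (M N : 'M[R]_(m, n)) a b : (row a M *m (row b N)^T) 0 0 = (M *m N^T) a b.
    by rewrite !mxE; apply: eq_bigr => l _; rewrite !mxE.
  have dC a b : (row a C *m (row b C)^T) 0 0 = (row a D *m (row b D)^T) 0 0.
    by rewrite !dotE gU.
  have dS (M N : 'M[R]_(m, n)) a b : (row a M *m (row b N)^T) 0 0 = (row b N *m (row a M)^T) 0 0.
    by rewrite -[row b N in RHS]trmxK -trmx_mul [RHS]mxE.
  have subE (M N : 'M[R]_1) : (M - N) 0 0 = M 0 0 - N 0 0 by rewrite !mxE.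
  have [v0|v0] := eqVneq v 0.
    exists U; split => // j; rewrite ltnS leq_eqVlt => /orP[/eqP ji|]; last exact: rU.
    have -> : j = oi by apply/val_inj.
    by apply/eqP; rewrite -subr_eq0 -[_ - _]trmxK -/v v0 trmx0.
  pose q := (v^T *m v) 0 0.
  have q0 : q != 0.
    apply: contra v0 => /eqP; rewrite /q mxE => /eqP.
    rewrite psumr_eq0 => [/allP h|j _]; last by rewrite mxE -expr2 sqr_ge0.
    apply/eqP/matrixP => a b; rewrite ord1 [RHS]mxE; apply/eqP.
    by have := h a (mem_index_enum _); rewrite mxE -expr2 sqrf_eq0.
  pose H := 1%:M - (2 / q) *: (v *m v^T).
  have HT : H^T = H by rewrite /H linearB/= trmx1 linearZ/= trmx_mul trmxK.
  have vvq : v^T *m v = q%:M by rewrite [LHS]mx11_scalar.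
  have HH : H *m H = 1%:M.
    have WW : v *m v^T *m (v *m v^T) = q *: (v *m v^T).
      by rewrite mulmxA -(mulmxA v) vvq mul_mx_scalar -scalemxAl.
    have WH : v *m v^T *m H = - (v *m v^T).
      rewrite /H mulmxBr mulmx1 -scalemxAr WW scalerA divfK//.
      by rewrite scaler_nat mulr2n opprD addrA subrr sub0r.
    by rewrite {1}/H mulmxBl mul1mx -scalemxAl WH scalerN opprK /H subrK.
  exists (U *m H); split.
  - by apply: nu_preservingM => //; exact: nu_preserving_householder.
  - by rewrite mulmxA trmx_mul HT mulmxA -(mulmxA (B *m U) H H) HH mulmx1.
  move=> j; rewrite mulmxA -/C ltnS leq_eqVlt row_mul /H mulmxBr mulmx1 -scalemxAr mulmxA => ji.
  have -> : row j C *m v = ((row j C *m (row oi C)^T) 0 0 - (row j C *m (row oi D)^T) 0 0)%:M.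
    by rewrite [LHS]mx11_scalar /v linearB/= mulmxBr subE.
  rewrite mul_scalar_mx scalerA.
  case/orP: ji => [/eqP ji|ji].
    have -> : j = oi by apply/val_inj.
    set a := _ 0 0; set b := _ 0 0.
    have qE : q = 2 * (a - b).
      rewrite /q /v trmxK linearB/= mulmxBr !mulmxBl !subE -dC (dS D C) -/a -/b.
      ring.
    have -> : 2 / q * (a - b) = 1.
      rewrite -mulrA [_^-1 * _]mulrC mulrA -qE divff//.
    by rewrite scale1r trmxK opprB addrC subrK.
  have rj := rU _ ji; rewrite -/C in rj.
  by rewrite dC -rj subrr mulr0 scale0r subr0 rj.
have [U [pU _ UD]] := rows m (leqnn m).
by exists U => //; apply/row_matrixP => j; rewrite UD.
Qed.

(** Zero columns change neither the Gram matrix nor the law, as the coordinates that they multiply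
    integrate out. This brings two matrices of different widths to a common one. *)
Lemma pad_columns m n N (B : 'M[R]_(m, n)) : (n <= N)%N ->
  exists B' : 'M[R]_(m, N), B' *m B'^T = B *m B^T /\
    forall f : 'cV[R]_m -> \bar R, measurable_fun setT f -> (forall z, 0 <= f z)%E ->
      (\int[nu N]_z f (B' *m z) = \int[nu n]_z f (B *m z))%E.
Proof.
move=> /subnK <-; elim: (N - n)%N => [|k [B' [BB fB]]]; first by exists B.
exists (@row_mx R m 1 (k + n) 0 B'); split.
  rewrite (@tr_row_mx _ m 1 (k + n)) (@mul_row_col _ m 1 (k + n) m) mul0mx add0r //.
move=> f mf f0; rewrite -fB// ge0_integral_nuS//; last exact: measurable_fun_mulmx.
under eq_integral do under eq_integral do rewrite mul_block_cons scaler0 add0r.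
have N1 : normal_prob 0 1 [set: TR] = 1%E by exact: probability_setT.
by rewrite integral_cst//= N1 mule1.
Qed.

Lemma ge0_integral_nu_gram m n1 n2 (B : 'M[R]_(m, n1)) (D : 'M[R]_(m, n2)) f :
  B *m B^T = D *m D^T -> measurable_fun setT f -> (forall z, 0 <= f z)%E ->
  (\int[nu n1]_z f (B *m z) = \int[nu n2]_z f (D *m z))%E.
Proof.
move=> BD mf f0.
have [B' [BB' <-//]] := pad_columns B (leq_maxl n1 n2).
have [D' [DD' <-//]] := pad_columns D (leq_maxr n1 n2).
have [U pU ->] : exists2 U, nu_preserving U & D' = B' *m U.
  by apply: gram_eq_orbit; rewrite BB' BD.
under [RHS]eq_integral do rewrite -mulmxA.
by apply/esym/(pU (fun z => f (B' *m z))) => //; exact: measurable_fun_mulmx.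
Qed.

Lemma measurable_preimage_mulmx m n (B : 'M[R]_(m, n)) (E : set 'cV[R]_m) :
  measurable E -> measurable [set z : 'cV[R]_n | E (B *m z)].
Proof.
by move=> mE; have := @measurable_mulmx m n B measurableT E mE; rewrite setTI.
Qed.

Lemma nu_gram m n1 n2 (B : 'M[R]_(m, n1)) (D : 'M[R]_(m, n2)) (E : set 'cV[R]_m) :
  B *m B^T = D *m D^T -> measurable E ->
  nu n1 [set z | E (B *m z)] = nu n2 [set z | E (D *m z)].
Proof.
move=> BD mE.
have key n (C : 'M[R]_(m, n)) : nu n [set z | E (C *m z)] = (\int[nu n]_z (\1_E (C *m z))%:E)%E.
  by rewrite -[X in nu n X]setIT -integral_indic//; exact: measurable_preimage_mulmx.
rewrite !key; apply: (ge0_integral_nu_gram BD (f := fun z => (\1_E z)%:E)).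
  by apply/measurable_EFinP; exact: measurable_indic.
by move=> z; rewrite lee_fin.
Qed.

(** Needed since [root_mx] falls back to [0] when no root exists. With at most [k] columns, padding
    by zeros makes [D] square. With more, [D] has a nonzero kernel vector; rotating it to the first
    axis makes the first column vanish, and that column is dropped without changing the Gram
    matrix. *)
Lemma square_root_exists k p (D : 'M[R]_(k, p)) :
  exists B : 'M[R]_k, B *m B^T = D *m D^T.
Proof.
elim: p D => [|p IH] D.
  by exists 0; rewrite mul0mx (_ : D = 0) ?mul0mx//; apply/matrixP => ? [].
have [pk|kp] := leqP p.+1 k.
  by have [B' [BB' _]] := pad_columns D pk; exists B'.
have [v v0 Dv] : exists2 v : 'cV[R]_p.+1, v != 0 & D *m v = 0.
  have : kermx D^T != 0.
    rewrite -mxrank_eq0 mxrank_ker mxrank_tr subn_eq0 -ltnNge.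
    by apply: leq_trans kp; rewrite ltnS rank_leq_row.
  case/rowV0Pn => u /sub_kermxP uD u0; exists u^T; first by rewrite -trmx0 (inj_eq trmx_inj).
  by rewrite -[D]trmxK -trmx_mul uD trmx0.
have [G [GG _ [r Gr]]] := rotate_to_axis v.
have r0 : r != 0.
  apply: contra v0 => /eqP r0; rewrite r0 cons_cv00 in Gr.
  by rewrite -[v]mul1mx -GG -mulmxA Gr mulmx0.
pose M := D *m G^T.
have ME : M *m M^T = D *m D^T by rewrite /M trmx_mul trmxK mulmxA -(mulmxA D) GG mulmx1.
have M0 : M *m cons_cv r 0 = 0 by rewrite /M -Gr -mulmxA (mulmxA G^T) GG mul1mx.
pose M1 : 'cV[R]_k := @lsubmx R k 1 p M; pose M2 := @rsubmx R k 1 p M.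
have MM : M = @row_mx R k 1 p M1 M2 by rewrite [RHS]hsubmxK.
have M10 : M1 = 0.
  apply/eqP; move: M0; rewrite MM mul_block_cons mulmx0 addr0 => /eqP.
  by rewrite scaler_eq0 (negbTE r0).
have [B BB] := IH M2; exists B; rewrite BB -ME MM M10.
by rewrite (@tr_row_mx _ k 1 p) (@mul_row_col _ k 1 p k) mul0mx add0r.
Qed.

Lemma root_mxP n p (D : 'M[R]_(n, p)) :
  root_mx (D *m D^T) *m (root_mx (D *m D^T))^T = D *m D^T.
Proof.
have [B BD] := square_root_exists D.
exact: (@xgetPex _ 0 [set B : 'M[R]_n | B *m B^T = D *m D^T] (ex_intro _ B BD)).
Qed.

Lemma gaussian_gram n p (S : 'M[R]_n) (D : 'M[R]_(n, p)) (E : set 'cV[R]_n) :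
  S = D *m D^T -> measurable E -> gaussian S E = nu p [set z | E (D *m z)].
Proof. by move=> -> mE; rewrite gaussianE; apply: nu_gram => //; exact: root_mxP. Qed.

End NormalVector.

(** * Independence and concentration *)

Section NormalVectorEvents.
Variable R : realType.
Local Notation TR := (measurableTypeR R).
Local Notation N01 := (@normal_prob R 0 1).
Local Notation nu := (@std_normal_cv R).

Lemma measurable_coord n (i : 'I_n) (J : set R) : measurable J ->
  measurable [set z : 'cV[R]_n | J (z i 0)].
Proof. by move=> mJ; have := @measurable_entry R n 1 i 0 measurableT J mJ; rewrite setTI. Qed.

Lemma measurable_cons_section n (E : set 'cV[R]_n.+1) x : measurable E ->
  measurable [set y | E (cons_cv x y)].
Proof.
move=> mE; have mc : measurable_fun [set: 'cV[R]_n] (fun y => cons_cv x y).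
  apply: measurable_fun_mx => i j; have [k ->|->] := unliftP ord0 i.
    under eq_fun do rewrite cons_cvS; exact: measurable_entry.
  by under eq_fun do rewrite cons_cv0; exact: measurable_cst.
by have := mc measurableT E mE; rewrite setTI.
Qed.

Lemma nuS n (E : set 'cV[R]_n.+1) : measurable E ->
  nu n.+1 E = (\int[N01]_x nu n [set y | E (cons_cv x y)])%E.
Proof.
move=> mE; rewrite -[X in nu _ X]setIT -integral_indic//.
rewrite (@ge0_integral_nuS R n (fun z => (\1_E z : R)%:E)).
- apply: eq_integral => x _.
  rewrite -[X in nu _ X]setIT -integral_indic//; exact: measurable_cons_section.
- by apply/measurable_EFinP; exact: measurable_indic.
- by move=> z; rewrite lee_fin.
Qed.

Lemma measurable_nu_section n (E : set 'cV[R]_n.+1) : measurable E ->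
  measurable_fun [set: R] (fun x => nu n [set y | E (cons_cv x y)]).
Proof.
move=> mE.
have mf : measurable_fun [set: 'cV[R]_n.+1] (fun z => (\1_E z : R)%:E).
  by apply/measurable_EFinP; exact: measurable_indic.
have H := @measurableT_comp _ _ _ _ _ _ _ _ _ mf (@measurable_cons_cv R n).
have := @measurable_fun_fubini_tonelli_F _ _ TR _ R (nu n) _ H (fun z => _).
move=> K; rewrite (_ : (fun x => _) = fubini_F (nu n) ((fun z => (\1_E z : R)%:E) \o
  (fun z : TR * 'cV[R]_n => cons_cv (z.1 : R) z.2))).
  by apply: K => z; rewrite lee_fin.
apply/funext => x; rewrite /fubini_F /=.
by rewrite -[X in nu _ X]setIT -integral_indic//; exact: measurable_cons_section.
Qed.

(** A pointwise substitute for measurability of [E] with respect to the other coordinates. *)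
Definition free_coord n (i : 'I_n) (E : set 'cV[R]_n) :=
  forall w w' : 'cV[R]_n, (forall j, j != i -> w j 0 = w' j 0) -> E w -> E w'.

(** For [i = 0] the section of [E] at [x] is the same for all [x], and the integral over [x]
    factors; for a later [i] the induction hypothesis applies to each section. *)
Lemma nu_indep_coord n (i : 'I_n) (E : set 'cV[R]_n) (J : set R) :
  measurable E -> free_coord i E -> measurable J ->
  nu n (E `&` [set w | J (w i 0)]) = (nu n E * N01 J)%E.
Proof.
elim: n i E => [[]//|n IH] i E mE fE mJ.
have mEJ : measurable (E `&` [set w | J (w i 0)]).
  by apply: measurableI => //; exact: measurable_coord.
rewrite !nuS//.
have [k ik|i0] := unliftP ord0 i.
  rewrite -ge0_integralZr//=; last exact: measurable_nu_section.
  apply: eq_integral => x _; rewrite -(IH k)//.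
  - by congr (nu n _); apply/seteqP; split => y /=; rewrite ik cons_cvS.
  - exact: measurable_cons_section.
  - move=> w w' ww' /=; apply: fE => j; have [l ->|->] := unliftP ord0 j; last by rewrite !cons_cv0.
    by rewrite ik !cons_cvS (inj_eq lift_inj); exact: ww'.
pose E0 := [set y : 'cV[R]_n | E (cons_cv 0 y)].
have EE x : [set y | E (cons_cv x y)] = E0.
  by apply/seteqP; split => y /=; apply: fE => j; rewrite i0;
    have [l ->|->] := unliftP ord0 j; rewrite ?eqxx// !cons_cvS.
transitivity (\int[N01]_x (nu n E0 * (\1_J x)%:E))%E.
  apply: eq_integral => x _; rewrite indicE.
  have [xJ|xJ] := boolP (x \in J).
    rewrite mule1; congr (nu n _); rewrite -(EE x); apply/seteqP; split => y /=.
      by case.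
    by rewrite i0 cons_cv0; split => //; exact/set_mem.
  rewrite mule0 (_ : [set y | _] = set0) ?measure0//; apply/seteqP; split => y //=.
  by rewrite i0 cons_cv0 => -[_ /mem_set]; rewrite (negbTE xJ).
rewrite ge0_integralZl//.
  rewrite integral_indic// setIT; congr (_ * _)%E.
  under eq_integral do rewrite EE.
  have N1 : N01 [set: TR] = 1%E by exact: probability_setT.
  by rewrite integral_cst//= N1 mule1.
by apply/measurable_EFinP; exact: measurable_indic.
Qed.

Lemma nu_coord n (i : 'I_n) (J : set R) : measurable J ->
  nu n [set w | J (w i 0)] = N01 J.
Proof.
move=> mJ; rewrite -[LHS]/(nu n [set w | J (w i 0)]) -[X in nu n X]setTI nu_indep_coord//.
by rewrite probability_setT mul1e.
Qed.

Lemma measurable_coords n (t : seq 'I_n) (J : 'I_n -> set R) :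
  (forall i, measurable (J i)) ->
  measurable [set w : 'cV[R]_n | forall i, i \in t -> J i (w i 0)].
Proof.
move=> mJ; elim: t => [|j t IHt].
  by rewrite [X in measurable X](_ : _ = setT)//; apply/seteqP; split.
have -> : [set w : 'cV[R]_n | forall i, i \in j :: t -> J i (w i 0)] =
    [set w | J j (w j 0)] `&` [set w | forall i, i \in t -> J i (w i 0)].
  apply/seteqP; split => w /=.
    by move=> h; split => [|l lt]; apply: h; rewrite inE ?eqxx// lt orbT.
  by move=> [h1 h2] l; rewrite inE => /orP[/eqP ->|/h2].
by apply: measurableI => //; exact: measurable_coord.
Qed.

Lemma nu_indep_coords n (s : seq 'I_n) (E : set 'cV[R]_n) (J : 'I_n -> set R) :
  uniq s -> measurable E -> (forall i, i \in s -> free_coord i E) ->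
  (forall i, measurable (J i)) ->
  fine (nu n (E `&` [set w | forall i, i \in s -> J i (w i 0)])) =
  fine (nu n E) * \prod_(i <- s) fine (N01 (J i)).
Proof.
move=> us mE + mJ; elim: s us => [|i s IH].
  move=> _ _; rewrite big_nil mulr1; congr (fine (nu n _)).
  by apply/seteqP; split => w //= -[].
rewrite cons_uniq => /andP[nis us] fE; rewrite big_cons mulrCA -IH//; last first.
  by move=> j js; apply: fE; rewrite inE js orbT.
have mF := measurable_coords s mJ.
rewrite mulrC -fineM; last 2 first.
- by apply: fin_num_measure; exact: measurableI.
- by apply: (@fin_num_measure _ TR R (normal_prob 0 1)); exact: mJ.
rewrite -(nu_indep_coord (i := i)) ?fE ?inE ?eqxx//.
- congr (fine (nu n _)); apply/seteqP; split => w /=.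
    move=> [Ew h]; split; last by apply: h; rewrite inE eqxx.
    by split => // l ls; apply: h; rewrite inE ls orbT.
  by move=> [[Ew h] h2]; split => // l; rewrite inE => /orP[/eqP ->|/h].
- exact: measurableI.
- move=> w w' ww' /= [Ew h]; split; first by apply: (fE i _ w w') => //; rewrite inE eqxx.
  move=> l ls; rewrite -ww'; first exact: h.
  by apply: contraNneq nis => <-.
Qed.

Definition sqnorm n (z : 'cV[R]_n) : R := (z^T *m z) 0 0.

Lemma sqnormE n (z : 'cV[R]_n) : sqnorm z = \sum_i z i 0 ^+ 2.
Proof. by rewrite /sqnorm mxE; apply: eq_bigr => i _; rewrite mxE expr2. Qed.

Lemma sqnorm_cons n x (y : 'cV[R]_n) : sqnorm (cons_cv x y) = x ^+ 2 + sqnorm y.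
Proof. by rewrite /sqnorm dot_cons mxE [X in X + _]mxE eqxx mulr1n expr2. Qed.

Lemma measurable_sqnorm n : measurable_fun [set: 'cV[R]_n] (@sqnorm n).
Proof.
rewrite (_ : @sqnorm n = fun z => \sum_i z i 0 ^+ 2); last by apply/funext => z; exact: sqnormE.
apply: measurable_sum => i; apply: measurable_funX; exact: measurable_entry.
Qed.

(** The relation between [s] and [l] says that the N(0, 1) density times [expR (l * x ^+ 2)] is [s]
    times the density of N(0, s^2). This is the moment generating function of a chi-square
    variable. *)
Lemma integral_expR_sqr (l s : R) : 0 < s -> s ^- 2 = 1 - 2 * l ->
  (\int[N01]_x (expR (l * x ^+ 2))%:E = s%:E)%E.
Proof.
move=> s0 sl.
have me : measurable_fun [set: R] (fun x : R => (expR (l * x ^+ 2))%:E).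
  apply/measurable_EFinP; apply: measurableT_comp => //.
  by apply: measurable_funM => //; exact: measurable_funX.
rewrite (ge0_integral_normal_prob 0 1 me); last by move=> x; rewrite lee_fin expR_ge0.
have ps : normal_peak 1 = s * normal_peak s.
  rewrite /normal_peak expr1n mul1r -mulrnAr sqrtrM ?sqr_ge0//.
  by rewrite sqrtr_sqr gtr0_norm// invfM mulrA divff ?mul1r// gt_eqF.
transitivity (\int[lebesgue_measure]_x (s%:E * (normal_pdf 0 s x)%:E))%E.
  apply: eq_integral => x _; rewrite -!EFinM; congr EFin.
  rewrite normal_pdf01 normal_pdfE ?gt_eqF// ps /normal_fun mulrCA -mulrA; congr (_ * _).
  congr (_ * _); rewrite -expRD; congr expR.
  by rewrite subr0 -[s ^+ 2 *+ 2]mulr_natr invfM sl; field.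
rewrite ge0_integralZl//.
- by rewrite integral_normal_pdf mule1.
- by apply/measurable_EFinP; exact: measurable_normal_pdf.
- by move=> x _; rewrite lee_fin normal_pdf_ge0.
- by rewrite lee_fin ltW.
Qed.

Lemma integral_expR_sqnorm n (l s : R) : 0 < s -> s ^- 2 = 1 - 2 * l ->
  (\int[nu n]_z (expR (l * sqnorm z))%:E = (s ^+ n)%:E)%E.
Proof.
move=> s0 sl; elim: n => [|n IH].
  under eq_integral do rewrite sqnormE big_ord0 mulr0 expR0.
  by rewrite integral_cst//= probability_setT mule1.
have mf k : measurable_fun [set: 'cV[R]_k] (fun z => (expR (l * sqnorm z))%:E).
  apply/measurable_EFinP; apply: measurableT_comp => //.
  by apply: measurable_funM => //; exact: measurable_sqnorm.
rewrite (ge0_integral_nuS (mf _)); last by move=> z; rewrite lee_fin expR_ge0.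
transitivity (\int[N01]_x ((expR (l * x ^+ 2))%:E * (s ^+ n)%:E))%E.
  apply: eq_integral => x _; rewrite -IH -ge0_integralZl//.
  - apply: eq_integral => y _; rewrite sqnorm_cons mulrDr expRD EFinM //.
  - exact: mf.
rewrite ge0_integralZr//.
- by rewrite (integral_expR_sqr s0 sl) -EFinM exprS.
- apply/measurable_EFinP; apply: measurableT_comp => //.
  by apply: measurable_funM => //; exact: measurable_funX.
- by rewrite lee_fin exprn_ge0// ltW.
Qed.

(** Markov's inequality for [expR (l * sqnorm z)]. The sign of [l] is free: positive values serve
    the upper tail, negative ones the lower tail. *)
Lemma chernoff_sqnorm n (l s a : R) : 0 < s -> s ^- 2 = 1 - 2 * l ->
  (nu n [set z | (a * n%:R <= l * sqnorm z)%R] <= ((expR (- a) * s) ^+ n)%:E)%E.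
Proof.
move=> s0 sl; set E := [set z | _].
have mf : measurable_fun [set: 'cV[R]_n] (fun z => l * sqnorm z).
  by apply: measurable_funM => //; exact: measurable_sqnorm.
have mE : measurable E.
  have := mf measurableT `[a * n%:R, +oo[%classic (measurable_itv _); rewrite setTI.
  by congr measurable; apply/seteqP; split => z /=; rewrite in_itv/= andbT.
rewrite exprMn EFinM -(integral_expR_sqnorm n s0 sl).
rewrite -[X in nu n X]setIT -integral_indic//.
rewrite -ge0_integralZl//.
- apply: ge0_le_integral => //.
  + by apply/measurable_EFinP; exact: measurable_indic.
  + apply: emeasurable_funM => //; apply/measurable_EFinP.
    by apply: measurableT_comp.
  + move=> z _; rewrite -EFinM lee_fin indicE.
    have [/set_mem/= zE|_] := boolP (z \in E); last by rewrite mulr_ge0 ?expR_ge0// exprn_ge0// expR_ge0.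
    by rewrite -expRM_natl -expRD -[leLHS]expR0 ler_expR mulrN addrC subr_ge0 mulrC.
- by apply/measurable_EFinP; apply: measurableT_comp.
Qed.

Lemma sqnorm_concentration (e : R) : 0 < e -> exists2 r : R, 0 <= r < 1 &
  forall n, (nu n [set z | ((1 + e) * n%:R <= sqnorm z)%R] <= (r ^+ n)%:E)%E /\
            (nu n [set z | (sqnorm z <= (1 - e) * n%:R)%R] <= (r ^+ n)%:E)%E.
Proof.
move=> e0.
(* By [1 + x <= expR x], the upper rate is below 1 as soon as [(1 + 2 * a1) * (1 - 2 * l) = 1 + 2 *
   l * (e - 2 * l * (1 + e))] exceeds 1, and likewise for the lower one. The bounds [8 * l <= e] and
   [8 * l <= 1] ensure this. *)
pose l := Num.min e 1 / 8.
have l0 : 0 < l by rewrite divr_gt0// lt_min e0 ltr01.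
have le : 8 * l <= e by rewrite /l mulrCA divff// mulr1 ge_min lexx.
have l1 : 8 * l <= 1 by rewrite /l mulrCA divff// mulr1 ge_min lexx orbT.
have sq (x : R) : 0 < x -> 0 < (Num.sqrt x)^-1 /\ (Num.sqrt x)^-1 ^- 2 = x.
  by move=> x0; rewrite invr_gt0 sqrtr_gt0 x0 exprVn invrK sqr_sqrtr// ltW.
have lt1 (a x : R) : 0 < x -> 1 < expR (2 * a) * x -> 0 <= expR (- a) / Num.sqrt x < 1.
  move=> x0 h; rewrite divr_ge0 ?expR_ge0 ?sqrtr_ge0//=.
  rewrite ltr_pdivrMr ?sqrtr_gt0// mul1r -ltr_sqr ?nnegrE ?expR_ge0 ?sqrtr_ge0//.
  rewrite sqr_sqrtr ?ltW// -expRM_natl mulrN expRN.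
  by rewrite -[X in X < _]mul1r ltr_pdivrMr ?expR_gt0// mulrC.
have p1 : 0 < 1 - 2 * l by lra.
have p2 : 0 < 1 - 2 * (- l) by lra.
have [s1 s1l] := sq _ p1.
have [s2 s2l] := sq _ p2.
pose a1 := l * (1 + e); pose a2 := - l * (1 - e).
have le' : 8 * l * e <= e by rewrite ler_piMl// ltW.
have /andP[r10 r11] : 0 <= expR (- a1) / Num.sqrt (1 - 2 * l) < 1.
  apply: lt1 => //; apply: (@lt_le_trans _ _ ((1 + 2 * a1) * (1 - 2 * l))); last first.
    by rewrite ler_pM2r// expR_ge1Dx.
  have h : 0 < l * (e - 2 * l * (1 + e)) by rewrite mulr_gt0//; lra.
  rewrite /a1; lra.
have /andP[r20 r21] : 0 <= expR (- a2) / Num.sqrt (1 - 2 * - l) < 1.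
  apply: lt1 => //; apply: (@lt_le_trans _ _ ((1 + 2 * a2) * (1 - 2 * - l))); last first.
    by rewrite ler_pM2r// expR_ge1Dx.
  have h : 0 < l * (e - 2 * l * (1 - e)).
    rewrite mulr_gt0//; have : 0 < l * e by rewrite mulr_gt0.
    lra.
  rewrite /a2; lra.
exists (Num.max (expR (- a1) / Num.sqrt (1 - 2 * l)) (expR (- a2) / Num.sqrt (1 - 2 * (- l)))).
  by rewrite le_max r10/= gt_max r11.
move=> n; split.
  apply: (@le_trans _ _ ((expR (- a1) / Num.sqrt (1 - 2 * l)) ^+ n)%:E).
    have := @chernoff_sqnorm n l _ a1 s1 s1l; apply: le_trans.
    rewrite le_eqVlt; apply/orP; left; apply/eqP; congr (nu n _).
    by apply/seteqP; split => z /=; rewrite /a1 -mulrA ler_pM2l.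
  by rewrite lee_fin lerXn2r ?nnegrE ?le_max ?r10 ?lexx.
apply: (@le_trans _ _ ((expR (- a2) / Num.sqrt (1 - 2 * (- l))) ^+ n)%:E).
  have := @chernoff_sqnorm n (- l) _ a2 s2 s2l; apply: le_trans.
  rewrite le_eqVlt; apply/orP; left; apply/eqP; congr (nu n _).
  by apply/seteqP; split => z /=; rewrite /a2 -mulrA !mulNr lerN2 ler_pM2l.
by rewrite lee_fin lerXn2r ?nnegrE ?le_max ?r20 ?lexx ?orbT.
Qed.

Lemma normal_prob_set1 (x : R) : N01 [set x] = 0%E.
Proof.
have /null_content_dominatesP h := @normal_prob_dominates R 0 1.
by apply: h; [exact: measurable_set1|exact: lebesgue_measure_set1].
Qed.

Lemma measurable_ge_norm (a b : R) : measurable [set x : R | b <= `|x + a|].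
Proof.
have mf : measurable_fun [set: R] (fun x : R => `|x + a|).
  by apply: measurableT_comp => //; apply: measurable_funD => //; exact: measurable_cst.
have := mf measurableT `[b, +oo[%classic (measurable_itv _); rewrite setTI.
by congr measurable; apply/seteqP; split => z /=; rewrite in_itv/= andbT.
Qed.

Lemma measurable_lt_norm (a b : R) : measurable [set x : R | `|x + a| < b].
Proof.
have := measurableC (measurable_ge_norm a b); congr measurable.
by apply/seteqP; split => z /=; rewrite real_ltNge ?num_real// => /negP.
Qed.

Lemma nu_norm_eq0 n (i : 'I_n) (a b : R) : nu n [set w | `|w i 0 + a| = b] = 0%E.
Proof.
have sub : [set x : R | `|x + a| = b] `<=` [set b - a] `|` [set - b - a].
  move=> x /= <-; have [x0|x0] := ger0P (x + a); [left|right] => /=; ring.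
have m1 (x : R) : measurable [set x] by exact: measurable_set1.
have mJ : measurable [set x : R | `|x + a| = b].
  have -> : [set x : R | `|x + a| = b] = [set x : R | b <= `|x + a|] `&` ~` [set x | b < `|x + a| ].
    apply/seteqP; split => x /=.
      by move=> ->; rewrite lexx ltxx.
    by move=> [h /negP]; rewrite -leNgt => h2; apply/eqP; rewrite eq_le h h2.
  apply: measurableI; first exact: measurable_ge_norm.
  apply: measurableC.
  have -> : [set x | b < `|x + a| ] = [set x : R | b < `|x + a|] by [].
  have mf : measurable_fun [set: R] (fun x : R => `|x + a|).
    by apply: measurableT_comp => //; apply: measurable_funD => //; exact: measurable_cst.
  have := mf measurableT `]b, +oo[%classic (measurable_itv _); rewrite setTI.
  by congr measurable; apply/seteqP; split => z /=; rewrite in_itv/= andbT.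
transitivity (N01 [set x : R | `|x + a| = b]); first exact: nu_coord.
apply/eqP; rewrite eq_le measure_ge0 andbT.
apply: (@le_trans _ _ (N01 ([set b - a] `|` [set - b - a]))).
  by apply: le_measure => //; rewrite inE//; exact: measurableU.
apply: (le_trans (measureU2 _ _ _)) => //.
by rewrite /= !normal_prob_set1 adde0.
Qed.

End NormalVectorEvents.

(** * Real-valued probabilities and pointwise convergence of events *)

Section Pr.
Context d (T : measurableType d) (R : realType) (mu : probability T R).

Definition pr (E : set T) : R := fine (mu E).

Lemma prE E : measurable E -> (pr E)%:E = mu E.
Proof. by move=> mE; rewrite fineK// fin_num_measure. Qed.

Lemma pr_ge0 E : 0 <= pr E.
Proof. by rewrite fine_ge0. Qed.

Lemma pr_le A B : measurable A -> measurable B -> A `<=` B -> pr A <= pr B.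
Proof. by move=> mA mB AB; rewrite -lee_fin !prE//; apply: le_measure; rewrite ?inE. Qed.

Lemma pr_le1 E : measurable E -> pr E <= 1.
Proof. by move=> mE; rewrite -lee_fin prE// probability_le1. Qed.

Lemma pr_setT : pr setT = 1.
Proof. by rewrite /pr probability_setT. Qed.

Lemma pr_leU A B C : measurable A -> measurable B -> measurable C ->
  A `<=` B `|` C -> pr A <= pr B + pr C.
Proof.
move=> mA mB mC ABC; rewrite -lee_fin EFinD !prE//.
apply: (le_trans _ (measureU2 _ mB mC)).
by apply: le_measure; rewrite ?inE//; exact: measurableU.
Qed.

(** Dominated convergence for indicators: the tail unions [F m] decrease to a subset of the null set
    [Z], and [D m] is contained in [F m]. *)
Lemma pr_cvg0 (D : nat -> set T) (Z : set T) : (forall m, measurable (D m)) ->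
  measurable Z -> mu Z = 0%E ->
  (forall w, ~ Z w -> \forall m \near \oo, ~ D m w) -> pr (D m) @[m --> \oo] --> (0 : R).
Proof.
move=> mD mZ Z0 evD.
pose F m := \bigcup_(j in [set j | (m <= j)%N]) D j.
have mF m : measurable (F m) by apply: bigcup_measurable.
have niF : nonincreasing_seq F.
  by move=> m n mn; apply/subsetPset => w [j /= nj Djw]; exists j => //=; exact: leq_trans nj.
have capF : \bigcap_n F n `<=` Z.
  move=> w Fw; apply: contrapT => nZ; have [N _ h] := evD w nZ.
  by have [j /= Nj Dj] := Fw N I; exact: (h j).
have mcap : measurable (\bigcap_n F n) by exact: bigcapT_measurable.
have F0 : (mu (F 0%N) < +oo)%E by rewrite -ge0_fin_numE// fin_num_measure.
have cap0 : mu (\bigcap_n F n) = 0%E.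
  by apply/eqP; rewrite eq_le measure_ge0 andbT -Z0; apply: le_measure; rewrite ?inE.
have /fine_cvg h : mu \o F @ \oo --> (0%:E : \bar R).
  by rewrite -[0%:E]cap0; exact: nonincreasing_cvg_mu.
apply: (@squeeze_cvgr _ _ _ _ (cst 0) (fun m => pr (F m))); last exact: h.
  apply: nearW => m; rewrite pr_ge0/=; apply: pr_le => // w Dw.
  by exists m => /=.
exact: cvg_cst.
Qed.

End Pr.

(** * Limits of selection events *)

Section LimitCore.
Variables (R : realType) (P k : nat).
Local Notation nu := (@std_normal_cv R).
Variable c : nat -> R.

(* [chk] tells whether the lower bound on the statistic of index p survives in the
   limit; [e] widens the selection region, to absorb the error in the variance. *)
Definition region (p : nat) (chk : bool) (V : 'cV[R]_P -> 'cV[R]_k)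
    (mu : 'I_P -> R) (e : R) (t : 'cV[R]_k) : set 'cV[R]_P :=
  [set w | [/\ forall i, V w i 0 <= t i 0 + e,
    forall q : 'I_P, q.+1 = p -> chk -> c p * (1 - e) <= `|w q 0 + mu q|
  & forall q : 'I_P, (p < q.+1)%N -> `|w q 0 + mu q| < c q.+1 * (1 + e)]].

(** Coordinate [q : 'I_P] carries the statistic of index [q.+1]; for [p = 0] the lower bound is
    therefore vacuous. The quotient by [r z] is kept as in the statistics, with the convention that
    a quotient by [0] is [0]. *)
Definition sel_event n (p : nat) (V : 'cV[R]_P -> 'cV[R]_k)
    (mu : 'I_P -> R) (C : 'M[R]_(P, n)) (r : 'cV[R]_n -> R) (t : 'cV[R]_k)
    : set 'cV[R]_n :=
  [set z | [/\ forall i, V (C *m z) i 0 <= t i 0,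
    forall q : 'I_P, q.+1 = p -> c p <= `|((C *m z) q 0 + mu q) / r z|
  & forall q : 'I_P, (p < q.+1)%N -> `|((C *m z) q 0 + mu q) / r z| < c q.+1]].

Lemma measurable_forall_fin d (T : measurableType d) (I : finType) (F : I -> set T) :
  (forall i, measurable (F i)) -> measurable [set x | forall i, F i x].
Proof.
move=> mF.
suff H (s : seq I) : measurable [set x | forall i, i \in s -> F i x].
  have := H (enum I); congr measurable; apply/seteqP; split => x /= h i; last by [].
  by apply: h; rewrite mem_enum.
elim: s => [|j s IH].
  have -> : [set x | forall i, i \in [::] -> F i x] = setT by apply/seteqP; split.
  exact: measurableT.
have -> : [set x | forall i, i \in j :: s -> F i x] = F j `&` [set x | forall i, i \in s -> F i x].
  apply/seteqP; split => x /=.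
    by move=> h; split => [|i si]; apply: h; rewrite inE ?eqxx// si orbT.
  by move=> [h1 h2] i; rewrite inE => /orP[/eqP ->|/h2].
by apply: measurableI.
Qed.

Lemma measurable_imply d (T : measurableType d) (Q : Prop) (E : set T) :
  (Q -> measurable E) -> measurable [set x | Q -> E x].
Proof.
move=> mE; have [q|q] := pselect Q.
  have -> : [set x | Q -> E x] = E by apply/seteqP; split => x /= => [/(_ q)|? _].
  exact: mE.
have -> : [set x | Q -> E x] = setT by apply/seteqP; split => x //= _ /q.
exact: measurableT.
Qed.

Lemma measurable_le_fun d (T : measurableType d) (f g : T -> R) :
  measurable_fun setT f -> measurable_fun setT g -> measurable [set x | f x <= g x].
Proof.
move=> mf mg; have mgf : measurable_fun setT (fun x => g x - f x) by apply: measurable_funB.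
have := mgf measurableT `[0, +oo[%classic (measurable_itv _); rewrite setTI.
by congr measurable; apply/seteqP; split => z /=; rewrite in_itv/= andbT subr_ge0.
Qed.

Lemma measurable_lt_fun d (T : measurableType d) (f g : T -> R) :
  measurable_fun setT f -> measurable_fun setT g -> measurable [set x | f x < g x].
Proof.
move=> mf mg; have := measurableC (measurable_le_fun mg mf); congr measurable.
by apply/seteqP; split => z /=; rewrite real_ltNge ?num_real// => /negP.
Qed.

Lemma measurable_le_norm_div d (T : measurableType d) (b : R) (f g : T -> R) :
  measurable_fun setT f -> measurable_fun setT g ->
  measurable [set x | b <= `|f x / g x|].
Proof.
move=> mf mg.
have m0 : measurable [set x | g x = 0].
  have := mg measurableT [set 0] (measurable_set1 0); rewrite setTI.
  by congr measurable.
have mb : measurable [set x : T | b <= 0].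
  have [b0|b0] := boolP (b <= 0).
    by have -> : [set x : T | true] = setT by apply/seteqP; split.
  by have -> : [set x : T | false] = set0 by apply/seteqP; split.
have mn h : measurable_fun [set: T] h -> measurable_fun setT (fun x => `|h x : R|).
  by move=> mh; apply: measurableT_comp.
have ml : measurable [set x | b * `|g x| <= `|f x|].
  apply: measurable_le_fun; last exact: mn.
  by apply: measurable_funM; [exact: measurable_cst|exact: mn].
(* Where [g] vanishes the quotient is [0]; elsewhere the inequality is multiplied by the absolute
   value of [g x], which removes the division. *)
have -> : [set x | b <= `|f x / g x|] =
    ([set x | g x = 0] `&` [set x : T | b <= 0]) `|`
    (~` [set x | g x = 0] `&` [set x | b * `|g x| <= `|f x|]).
  apply/seteqP; split => x /=; have [g0|g0] := eqVneq (g x) 0.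
  - by rewrite g0 invr0 mulr0 normr0 => ?; left.
  - rewrite normrM normfV ler_pdivlMr ?normr_gt0// => ?; right; split => //.
    exact/eqP.
  - by rewrite g0 invr0 mulr0 normr0 => -[[]|[]].
  - by rewrite normrM normfV ler_pdivlMr ?normr_gt0// => -[[/eqP]|[]//]; rewrite (negbTE g0).
by apply: measurableU; apply: measurableI => //; exact: measurableC.
Qed.

Lemma measurable_entry_comp d (T : measurableType d) m n (f : T -> 'M[R]_(m, n)) i j :
  measurable_fun setT f -> measurable_fun setT (fun x => f x i j).
Proof. by move=> mf; exact: (measurableT_comp (@measurable_entry R m n i j) mf). Qed.

Lemma measurable_region p chk V mu e t : measurable_fun setT V ->
  measurable (region p chk V mu e t).
Proof.
move=> mV.
have -> : region p chk V mu e t =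
  [set w | forall i, V w i 0 <= t i 0 + e] `&`
  ([set w | forall q : 'I_P, q.+1 = p -> chk -> c p * (1 - e) <= `|w q 0 + mu q|] `&`
   [set w | forall q : 'I_P, (p < q.+1)%N -> `|w q 0 + mu q| < c q.+1 * (1 + e)]).
  by apply/seteqP; split => w /= => [[]|[? []]].
have mn (q : 'I_P) : measurable_fun setT (fun w : 'cV[R]_P => `|w q 0 + mu q|).
  apply: measurableT_comp => //; apply: measurable_funD; first exact: measurable_entry.
  exact: measurable_cst.
apply: measurableI; last apply: measurableI.
- apply: measurable_forall_fin => i; apply: measurable_le_fun; last exact: measurable_cst.
  exact: measurable_entry_comp.
- apply: measurable_forall_fin => q; do 2 apply: measurable_imply => _.
  by apply: measurable_le_fun => //; exact: measurable_cst.
- apply: measurable_forall_fin => q; apply: measurable_imply => _.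
  by apply: measurable_lt_fun => //; exact: measurable_cst.
Qed.

Lemma measurable_sel_event n p V mu (C : 'M[R]_(P, n)) r t :
  measurable_fun setT V -> measurable_fun setT r ->
  measurable (sel_event p V mu C r t).
Proof.
move=> mV mr.
have -> : sel_event p V mu C r t =
  [set z | forall i, V (C *m z) i 0 <= t i 0] `&`
  ([set z | forall q : 'I_P, q.+1 = p -> c p <= `|((C *m z) q 0 + mu q) / r z|] `&`
   [set z | forall q : 'I_P, (p < q.+1)%N -> `|((C *m z) q 0 + mu q) / r z| < c q.+1]).
  by apply/seteqP; split => w /= => [[]|[? []]].
have mC := @measurable_mulmx R P n C.
have mn (q : 'I_P) : measurable_fun setT (fun z : 'cV[R]_n => (C *m z) q 0 + mu q).
  apply: measurable_funD; first exact: measurable_entry_comp.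
  exact: measurable_cst.
apply: measurableI; last apply: measurableI.
- apply: measurable_forall_fin => i; apply: measurable_le_fun; last exact: measurable_cst.
  by apply: measurable_entry_comp; apply: (measurableT_comp mV mC).
- apply: measurable_forall_fin => q; apply: measurable_imply => _.
  exact: measurable_le_norm_div.
- apply: measurable_forall_fin => q; apply: measurable_imply => _.
  have := measurableC (measurable_le_norm_div (c q.+1) (mn q) mr); congr measurable.
  by apply/seteqP; split => z /=; rewrite real_ltNge ?num_real// => /negP.
Qed.

Lemma eventually_gt (u : nat -> R) (l z : R) : u m @[m --> \oo] --> l -> z < l ->
  \forall m \near \oo, z < u m.
Proof. by move=> ul zl; exact: (cvgr_gt l ul z zl). Qed.

Lemma eventually_lt (u : nat -> R) (l z : R) : u m @[m --> \oo] --> l -> l < z ->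
  \forall m \near \oo, u m < z.
Proof. by move=> ul zl; exact: (cvgr_lt l ul z zl). Qed.

Section Core.
Variables (p : nat) (chk : bool).
Variables (V_ : nat -> 'cV[R]_P -> 'cV[R]_k) (V : 'cV[R]_P -> 'cV[R]_k).
Variables (mu_ : nat -> 'I_P -> R) (mu : 'I_P -> R).
Hypothesis c_gt0 : forall q : 'I_P, (p < q.+1)%N -> 0 < c q.+1.
Hypothesis cp_ge0 : 0 <= c p.
Hypothesis cp_gt0 : chk -> 0 < c p.
Hypothesis mV_ : forall m, measurable_fun setT (V_ m).
Hypothesis mV : measurable_fun setT V.
Hypothesis V_cvg : forall w i, V_ m w i 0 @[m --> \oo] --> V w i 0.
Hypothesis mu_cvg : forall q : 'I_P, (p < q.+1)%N -> mu_ m q @[m --> \oo] --> mu q.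
Hypothesis mu_chk : forall q : 'I_P, q.+1 = p -> chk -> mu_ m q @[m --> \oo] --> mu q.
(** The two ways in which the lower bound can disappear: a zero critical value, as at the minimal
    order [O], or a mean that diverges. *)
Hypothesis mu_nchk : forall q : 'I_P, q.+1 = p -> ~~ chk ->
  c p = 0 \/ forall M : R, \forall m \near \oo, M <= `|mu_ m q|.

Local Notation regionm m := (region p true (V_ m) (mu_ m)).
Local Notation reg := (region p chk V mu).

Let norm_cvg (w : 'cV[R]_P) q : mu_ m q @[m --> \oo] --> mu q ->
  `|w q 0 + mu_ m q| @[m --> \oo] --> `|w q 0 + mu q|.
Proof.
move=> h; apply: (@cvg_norm _ R^o); apply: (@cvgD _ R^o) => //; exact: cvg_cst.
Qed.

(** A point outside the wider limit region violates one of its finitely many inequalities. The gap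
    between [e] and [e'] makes it violate the narrower one strictly, and this persists for all large
    [m]. *)
Lemma region_eventually_sub e e' t w : e < e' ->
  \forall m \near \oo, ~ (regionm m e t `\` reg e' t) w.
Proof.
move=> ee'; have [wS|] := pselect (reg e' t w); first by apply: nearW => m [].
move=> nS.
have [h1|/existsNP[i /negP]] := pselect (forall i, V w i 0 <= t i 0 + e'); last first.
  rewrite -ltNge => h; have h0 : t i 0 + e < V w i 0 by apply: lt_trans h; rewrite ltrD2l.
  by apply: filterS (eventually_gt (@V_cvg w i) h0) => m hm [[/(_ i)]]; rewrite leNgt hm.
have [h2|/existsNP[q /not_implyP[qp /not_implyP[hchk /negP]]]] :=
  pselect (forall q : 'I_P, q.+1 = p -> chk -> c p * (1 - e') <= `|w q 0 + mu q|); last first.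
  rewrite -ltNge => h; have h0 : `|w q 0 + mu q| < c p * (1 - e).
    by apply: (lt_trans h); rewrite ltr_pM2l ?cp_gt0// ltrD2l ltrN2.
  apply: filterS (eventually_lt (norm_cvg (mu_chk qp hchk)) h0) => m hm [[_ /(_ q qp isT)]].
  by rewrite leNgt hm.
have [h3|/existsNP[q /not_implyP[qp /negP]]] :=
  pselect (forall q : 'I_P, (p < q.+1)%N -> `|w q 0 + mu q| < c q.+1 * (1 + e')); last first.
  rewrite -leNgt => h; have h0 : c q.+1 * (1 + e) < `|w q 0 + mu q|.
    by apply: lt_le_trans h; rewrite ltr_pM2l ?c_gt0// ltrD2l.
  apply: filterS (eventually_gt (norm_cvg (mu_cvg qp)) h0) => m hm [[_ _ /(_ q qp)]].
  by rewrite ltNge (ltW hm).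
by exfalso; apply: nS; split.
Qed.

Lemma region_eventually_sup e e' t w : e < e' ->
  \forall m \near \oo, ~ (reg e t `\` regionm m e' t) w.
Proof.
move=> ee'; have [[h1 h2 h3]|nS] := pselect (reg e t w); last by apply: nearW => m [].
have n1 : \forall m \near \oo, forall i, V_ m w i 0 <= t i 0 + e'.
  apply: filter_forall => i; have h0 : V w i 0 < t i 0 + e'.
    by apply: (le_lt_trans (h1 i)); rewrite ltrD2l.
  by apply: filterS (eventually_lt (@V_cvg w i) h0) => m /ltW.
have n2 : \forall m \near \oo, forall q : 'I_P, q.+1 = p -> true ->
    c p * (1 - e') <= `|w q 0 + mu_ m q|.
  apply: filter_forall => q.
  have [qp|qp] := pselect (q.+1 = p); last by apply: nearW => m /qp.
  have [hchk|hchk] := boolP chk.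
    have h0 : c p * (1 - e') < `|w q 0 + mu q|.
      by apply: lt_le_trans (h2 q qp hchk); rewrite ltr_pM2l ?cp_gt0// ltrD2l ltrN2.
    by apply: filterS (eventually_gt (norm_cvg (mu_chk qp hchk)) h0) => m /ltW.
  (* The limit region says nothing here about the lower bound, which has to hold for every large
     [m]: either its right side is what diverges, or its left side is [0]. *)
  have [c0|hM] := mu_nchk qp hchk.
    by apply: nearW => m _ _; rewrite c0 mul0r.
  apply: filterS (hM (c p * (1 - e') + `|w q 0|)) => m hm _ _.
  rewrite -(lerD2r `|w q 0|) (le_trans hm)//.
  have := ler_normB (w q 0 + mu_ m q) (w q 0).
  by rewrite addrAC subrr add0r.
have n3 : \forall m \near \oo, forall q : 'I_P, (p < q.+1)%N ->
    `|w q 0 + mu_ m q| < c q.+1 * (1 + e').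
  apply: filter_forall => q.
  have [qp|qp] := pselect ((p < q.+1)%N); last by apply: nearW => m /qp.
  have h0 : `|w q 0 + mu q| < c q.+1 * (1 + e').
    by apply: (lt_trans (h3 q qp)); rewrite ltr_pM2l ?c_gt0// ltrD2l.
  by apply: filterS (eventually_lt (norm_cvg (mu_cvg qp)) h0) => m.
by apply: filterS3 n1 n2 n3 => m ? ? ? [_]; apply.
Qed.

(** Starting at [1 / 2] keeps all values below 1, so that a ratio within [eps_ j] of 1 is
    positive. *)
Definition eps_ (j : nat) : R := j.+2%:R^-1.

Lemma eps_gt0 j : 0 < eps_ j. Proof. by rewrite invr_gt0. Qed.

Lemma eps_cvg0 : eps_ j @[j --> \oo] --> (0 : R).
Proof. by have := @cvg_harmonic R; rewrite -cvg_shiftS. Qed.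

Lemma eps_lt1 j : eps_ j < 1.
Proof. by rewrite invf_lt1// ltr1n. Qed.

Definition boundary : set 'cV[R]_P :=
  [set w | exists q : 'I_P, `|w q 0 + mu q| = c q.+1].

Let eps_lt (x : R) : 0 < x -> \forall j \near \oo, eps_ j < x.
Proof. exact: eventually_lt eps_cvg0. Qed.

(** The constraints on the fit and the lower bound are closed conditions, stable under shrinking
    from outside. Only the strict upper bounds can gain points in the limit, and these lie in
    [boundary]. *)
Lemma region_shrink_sub t w : ~ boundary w ->
  \forall j \near \oo, ~ (reg (2 * eps_ j) (t + const_mx (eps_ j)) `\` reg 0 t) w.
Proof.
move=> nb; have [wS|] := pselect (reg 0 t w); first by apply: nearW => m [].
move=> nS.
have [h1|/existsNP[i /negP]] := pselect (forall i, V w i 0 <= t i 0 + 0); last first.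
  rewrite -ltNge addr0 => h.
  (* The total slack is [3 * eps_ j]: one part from the shift of [t], two from the region. *)
  have h0 : 0 < (V w i 0 - t i 0) / 3 by rewrite divr_gt0// subr_gt0.
  apply: filterS (eps_lt h0) => j hj [[/(_ i) h' _ _] _].
  move: h'; rewrite mxE [const_mx _ _ _]mxE => h'; lra.
have [h2|/existsNP[q /not_implyP[qp /not_implyP[hchk /negP]]]] :=
  pselect (forall q : 'I_P, q.+1 = p -> chk -> c p * (1 - 0) <= `|w q 0 + mu q|); last first.
  rewrite -ltNge subr0 mulr1 => h.
  have h0 : 0 < (c p - `|w q 0 + mu q|) / (2 * c p).
    by rewrite divr_gt0 ?subr_gt0// mulr_gt0// cp_gt0.
  apply: filterS (eps_lt h0) => j; rewrite ltr_pdivlMr ?mulr_gt0 ?cp_gt0//.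
  by move=> h'' [[_ /(_ q qp hchk) h' _] _]; move: h'; lra.
have [h3|/existsNP[q /not_implyP[qp /negP]]] :=
  pselect (forall q : 'I_P, (p < q.+1)%N -> `|w q 0 + mu q| < c q.+1 * (1 + 0)); last first.
  rewrite -leNgt addr0 mulr1 le_eqVlt => /orP[/eqP h|h].
    by exfalso; apply: nb; exists q.
  have h0 : 0 < (`|w q 0 + mu q| - c q.+1) / (2 * c q.+1).
    by rewrite divr_gt0 ?subr_gt0// mulr_gt0// c_gt0.
  apply: filterS (eps_lt h0) => j; rewrite ltr_pdivlMr ?mulr_gt0 ?c_gt0//.
  by move=> h'' [[_ _ /(_ q qp) h'] _]; move: h'; lra.
by exfalso; apply: nS; split.
Qed.

(** From inside, the closed constraint on the fit would lose the points with [V w i 0 = t i 0],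
    which may have positive mass. The fixed shift [e] of the corner absorbs them, and only the test
    boundaries are excluded. *)
Lemma region_shrink_sup t e w : 0 < e -> ~ boundary w ->
  \forall j \near \oo, ~ (reg 0 t `\` reg (- (2 * eps_ j)) (t + const_mx e)) w.
Proof.
move=> e0 nb; have [[h1 h2 h3]|nS] := pselect (reg 0 t w); last by apply: nearW => m [].
have n1 : \forall j \near \oo, forall i, V w i 0 <= (t + const_mx e) i 0 + - (2 * eps_ j).
  have h0 : 0 < e / 2 by rewrite divr_gt0.
  apply: filterS (eps_lt h0) => j hj i; have := h1 i; rewrite mxE [const_mx _ _ _]mxE addr0.
  lra.
have n2 : \forall j \near \oo, forall q : 'I_P, q.+1 = p -> chk ->
    c p * (1 - - (2 * eps_ j)) <= `|w q 0 + mu q|.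
  apply: filter_forall => q.
  have [qp|qp] := pselect (q.+1 = p); last by apply: nearW => m /qp.
  have [hchk|hchk] := boolP chk; last by apply: nearW.
  have : c p < `|w q 0 + mu q|.
    have := h2 q qp hchk; rewrite subr0 mulr1 le_eqVlt => /orP[/eqP h|//].
    by exfalso; apply: nb; exists q; rewrite qp.
  move=> h; have h0 : 0 < (`|w q 0 + mu q| - c p) / (2 * c p).
    by rewrite divr_gt0 ?subr_gt0// mulr_gt0// cp_gt0.
  by apply: filterS (eps_lt h0) => j; rewrite ltr_pdivlMr ?mulr_gt0 ?cp_gt0// => h'' _ _; lra.
have n3 : \forall j \near \oo, forall q : 'I_P, (p < q.+1)%N ->
    `|w q 0 + mu q| < c q.+1 * (1 + - (2 * eps_ j)).
  apply: filter_forall => q.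
  have [qp|qp] := pselect ((p < q.+1)%N); last by apply: nearW => m /qp.
  have := h3 q qp; rewrite addr0 mulr1 => h.
  have h0 : 0 < (c q.+1 - `|w q 0 + mu q|) / (2 * c q.+1).
    by rewrite divr_gt0 ?subr_gt0// mulr_gt0// c_gt0.
  by apply: filterS (eps_lt h0) => j; rewrite ltr_pdivlMr ?mulr_gt0 ?c_gt0// => h'' _; lra.
by apply: filterS3 n1 n2 n3 => m ? ? ? [_]; apply.
Qed.

Lemma measurable_norm_eq (q : 'I_P) (a b : R) : measurable [set w : 'cV[R]_P | `|w q 0 + a| = b].
Proof.
have mn : measurable_fun setT (fun w : 'cV[R]_P => `|w q 0 + a|).
  apply: measurableT_comp => //; apply: measurable_funD; first exact: measurable_entry.
  exact: measurable_cst.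
have := mn measurableT [set b] (measurable_set1 b); rewrite setTI.
by congr measurable.
Qed.

Lemma boundaryE : boundary = \bigcup_i (if insub i is Some q
  then [set w : 'cV[R]_P | `|w (q : 'I_P) 0 + mu q| = c q.+1] else set0).
Proof.
apply/seteqP; split => w.
  by move=> [q wq]; exists q => //; rewrite valK.
by move=> [i _]; case: insubP => // q _ _ wq; exists q.
Qed.

Lemma measurable_boundary : measurable boundary.
Proof.
rewrite boundaryE; apply: bigcupT_measurable => i; case: insubP => [q _ _|_] //.
exact: measurable_norm_eq.
Qed.

Lemma nu_boundary : nu P boundary = 0%E.
Proof.
have : (nu P).-negligible boundary.
  rewrite boundaryE; apply: negligible_bigcup => i; case: insubP => [q _ _|_].
    apply/negligibleP; [exact: measurable_norm_eq|exact: nu_norm_eq0].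
  exact: negligible_set0.
by move/negligibleP; apply; exact: measurable_boundary.
Qed.

Section CoreLimit.
Variables (N_ : nat -> nat) (C_ : forall m, 'M[R]_(P, N_ m)).
Variable r_ : forall m, 'cV[R]_(N_ m) -> R.
Hypothesis C_orth : forall m, C_ m *m (C_ m)^T = 1%:M.
Hypothesis mr_ : forall m, measurable_fun setT (@r_ m).
Hypothesis r_cvg : forall e, 0 < e ->
  pr (nu (N_ m)) [set z | e < `|@r_ m z - 1|] @[m --> \oo] --> (0 : R).

Local Notation ev m t := (sel_event p (V_ m) (mu_ m) (C_ m) (@r_ m) t).
Local Notation bad m e := [set z : 'cV[R]_(N_ m) | e < `|r_ z - 1|].

Let measurable_bad m (e : R) : measurable (bad m e).
Proof.
apply: measurable_lt_fun; first exact: measurable_cst.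
apply: measurableT_comp => //; apply: measurable_funB; [exact: mr_|exact: measurable_cst].
Qed.

Let nuC m (E : set 'cV[R]_P) : measurable E ->
  pr (nu (N_ m)) [set z | E (C_ m *m z)] = pr (nu P) E.
Proof.
move=> mE; rewrite /pr (@nu_gram _ _ _ P (C_ m) 1%:M)//; last by rewrite C_orth trmx1 mulmx1.
by congr (fine (nu P _)); apply/seteqP; split => w /=; rewrite mul1mx.
Qed.

Let c_ge0 (q : 'I_P) : (p < q.+1)%N -> 0 <= c q.+1.
Proof. by move=> /c_gt0/ltW. Qed.

Let ev_sub m t e : e < 1 ->
  ev m t `<=` bad m e `|` [set z | region p true (V_ m) (mu_ m) e t (C_ m *m z)] `|` bad m e.
Proof.
move=> e1 z [h1 h2 h3]; have [b|] := pselect (bad m e z); first by left; left.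
move=> /negP; rewrite -leNgt ler_norml => /andP[r1 r2]; left; right.
have r0 : 0 < r_ z by lra.
split.
- have e0 : 0 <= e by apply: le_trans (normr_ge0 (r_ z - 1)) _; rewrite ler_norml r1.
  by move=> i; apply: (le_trans (h1 i)); rewrite lerDl.
- move=> q qp _; have := h2 q qp; rewrite normrM normfV (gtr0_norm r0) ler_pdivlMr//.
  by apply: le_trans; apply: ler_wpM2l => //; lra.
- move=> q qp; have := h3 q qp; rewrite normrM normfV (gtr0_norm r0) ltr_pdivrMr//.
  by move/lt_le_trans; apply; apply: ler_wpM2l; [exact: c_ge0|lra].
Qed.

Let ev_sup m t e : 0 < e -> e < 1 ->
  [set z | region p true (V_ m) (mu_ m) (- e) t (C_ m *m z)] `<=` ev m t `|` bad m e.
Proof.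
move=> e0 e1 z [h1 h2 h3]; have [b|] := pselect (bad m e z); first by right.
move=> /negP; rewrite -leNgt ler_norml => /andP[r1 r2]; left.
have r0 : 0 < r_ z by lra.
split.
- by move=> i; apply: (le_trans (h1 i)); rewrite gerDl oppr_le0 ltW.
- move=> q qp; rewrite normrM normfV (gtr0_norm r0) ler_pdivlMr//.
  by apply: le_trans (h2 q qp isT); apply: ler_wpM2l => //; lra.
- move=> q qp; rewrite normrM normfV (gtr0_norm r0) ltr_pdivrMr//.
  by apply: (lt_le_trans (h3 q qp)); apply: ler_wpM2l; [exact: c_ge0|lra].
Qed.

Let mreg b W f e t : measurable_fun setT W -> measurable (region p b W f e t).
Proof. exact: measurable_region. Qed.

Let mpre m (E : set 'cV[R]_P) : measurable E -> measurable [set z | E (C_ m *m z)].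
Proof. exact: measurable_preimage_mulmx. Qed.

(** Three errors of size [a / 3] are added: the shrinking of the widened limit region to [reg 0 t],
    the replacement of the parameters at [m] by their limits, and the deviation of the ratio [r_]
    from 1. The first fixes [j], and with it [e], before [m] grows. The factor 2 in [2 * eps_ j]
    gives the strict gap that the second needs. *)
Lemma sel_event_upper t a : 0 < a -> exists2 e, 0 < e &
  \forall m \near \oo, pr (nu (N_ m)) (ev m (t + const_mx e)) <= pr (nu P) (reg 0 t) + a.
Proof.
move=> a0; have a30 : 0 < a / 3 by rewrite divr_gt0.
have mS e s : measurable (reg e s) by exact: mreg.
have H1 := @pr_cvg0 _ _ _ (nu P) (fun j => reg (2 * eps_ j) (t + const_mx (eps_ j)) `\` reg 0 t)
  boundary (fun j => measurableD (mS _ _) (mS _ _)) measurable_boundary nu_boundary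
  (@region_shrink_sub t).
have [j hj] : exists j, pr (nu P) (reg (2 * eps_ j) (t + const_mx (eps_ j)) `\` reg 0 t) < a / 3.
  by have [N _ hN] := eventually_lt H1 a30; exists N; apply: hN => /=.
exists (eps_ j); first exact: eps_gt0.
set s := t + const_mx (eps_ j) in hj *.
have lte : eps_ j < 2 * eps_ j by have := eps_gt0 j; lra.
have mSm m e : measurable (regionm m e s) by exact: mreg.
have H2 := @pr_cvg0 _ _ _ (nu P) (fun m => regionm m (eps_ j) s `\` reg (2 * eps_ j) s) set0
  (fun m => measurableD (mSm _ _) (mS _ _)) measurable0 (measure0 _)
  (fun w _ => region_eventually_sub s w lte).
apply: filterS2 (eventually_lt H2 a30) (eventually_lt (r_cvg (eps_gt0 j)) a30) => m hm hb.
have mev : measurable (ev m s) by exact: measurable_sel_event.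
have : pr (nu (N_ m)) (ev m s) <= pr (nu (N_ m)) (bad m (eps_ j)) +
    pr (nu (N_ m)) [set z | regionm m (eps_ j) s (C_ m *m z)].
  have mp : measurable [set z | regionm m (eps_ j) s (C_ m *m z)] by apply: mpre; exact: mSm.
  have mb : measurable (bad m (eps_ j)) by exact: measurable_bad.
  apply: (pr_leU (nu (N_ m)) mev mb mp).
  by move=> z /(ev_sub (eps_lt1 j)) [[|]|]; [left|right|left].
rewrite nuC//.
have : pr (nu P) (regionm m (eps_ j) s) <=
    pr (nu P) (regionm m (eps_ j) s `\` reg (2 * eps_ j) s) + pr (nu P) (reg (2 * eps_ j) s).
  apply: pr_leU => //; first exact: measurableD.
  by move=> w hw; have [|] := pselect (reg (2 * eps_ j) s w); [right|left].
have : pr (nu P) (reg (2 * eps_ j) s) <=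
    pr (nu P) (reg (2 * eps_ j) s `\` reg 0 t) + pr (nu P) (reg 0 t).
  apply: pr_leU => //; first exact: measurableD.
  by move=> w hw; have [|] := pselect (reg 0 t w); [right|left].
lra.
Qed.

Lemma sel_event_lower t a e : 0 < a -> 0 < e ->
  \forall m \near \oo, pr (nu P) (reg 0 t) - a <= pr (nu (N_ m)) (ev m (t + const_mx e)).
Proof.
move=> a0 e0; have a30 : 0 < a / 3 by rewrite divr_gt0.
set s := t + const_mx e.
have mS e' s' : measurable (reg e' s') by exact: mreg.
have H1 := @pr_cvg0 _ _ _ (nu P) (fun j => reg 0 t `\` reg (- (2 * eps_ j)) s)
  boundary (fun j => measurableD (mS _ _) (mS _ _)) measurable_boundary nu_boundary
  (fun w => @region_shrink_sup t e w e0).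
have [j hj] : exists j, pr (nu P) (reg 0 t `\` reg (- (2 * eps_ j)) s) < a / 3.
  by have [N _ hN] := eventually_lt H1 a30; exists N; apply: hN => /=.
have lte : - (2 * eps_ j) < - eps_ j by have := eps_gt0 j; lra.
have mSm m e' : measurable (regionm m e' s) by exact: mreg.
have H2 := @pr_cvg0 _ _ _ (nu P) (fun m => reg (- (2 * eps_ j)) s `\` regionm m (- eps_ j) s) set0
  (fun m => measurableD (mS _ _) (mSm _ _)) measurable0 (measure0 _)
  (fun w _ => region_eventually_sup s w lte).
apply: filterS2 (eventually_lt H2 a30) (eventually_lt (r_cvg (eps_gt0 j)) a30) => m hm hb.
have mev : measurable (ev m s) by exact: measurable_sel_event.
have : pr (nu (N_ m)) [set z | regionm m (- eps_ j) s (C_ m *m z)] <=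
    pr (nu (N_ m)) (ev m s) + pr (nu (N_ m)) (bad m (eps_ j)).
  have mp : measurable [set z | regionm m (- eps_ j) s (C_ m *m z)] by apply: mpre; exact: mSm.
  have mb : measurable (bad m (eps_ j)) by exact: measurable_bad.
  apply: (pr_leU (nu (N_ m)) mp mev mb).
  by apply: ev_sup; [exact: eps_gt0|exact: eps_lt1].
rewrite nuC//.
have : pr (nu P) (reg (- (2 * eps_ j)) s) <=
    pr (nu P) (reg (- (2 * eps_ j)) s `\` regionm m (- eps_ j) s) + pr (nu P) (regionm m (- eps_ j) s).
  apply: pr_leU => //; first exact: measurableD.
  by move=> w hw; have [|] := pselect (regionm m (- eps_ j) s w); [right|left].
have : pr (nu P) (reg 0 t) <=
    pr (nu P) (reg 0 t `\` reg (- (2 * eps_ j)) s) + pr (nu P) (reg (- (2 * eps_ j)) s).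
  apply: pr_leU => //; first exact: measurableD.
  by move=> w hw; have [|] := pselect (reg (- (2 * eps_ j)) s w); [right|left].
lra.
Qed.

End CoreLimit.
End Core.

(** Unless the ratio is more than [1 / 2] away from 1, the bounded statistic forces the absolute
    value of [w q 0 + mu_ m] below [2 * b], and each fixed [w] leaves this set once the mean is
    large. *)
Lemma escaping_event_cvg0 (N_ : nat -> nat) (C_ : forall m, 'M[R]_(P, N_ m))
    (r_ : forall m, 'cV[R]_(N_ m) -> R) (q : 'I_P) (mu_ : nat -> R) (b : R)
    (E_ : forall m, set 'cV[R]_(N_ m)) :
  (forall m, C_ m *m (C_ m)^T = 1%:M) ->
  (forall m, measurable_fun setT (@r_ m)) ->
  (forall e, 0 < e ->
    pr (nu (N_ m)) [set z | e < `|@r_ m z - 1|] @[m --> \oo] --> (0 : R)) ->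
  (forall M : R, \forall m \near \oo, M <= `|mu_ m|) -> 0 <= b ->
  (forall m, measurable (E_ m)) ->
  (forall m z, E_ m z -> `|((C_ m *m z) q 0 + mu_ m) / r_ m z| < b) ->
  pr (nu (N_ m)) (E_ m) @[m --> \oo] --> (0 : R).
Proof.
move=> C_orth mr r_cvg mu_infty b0 mE Esub.
pose D m := [set w : 'cV[R]_P | `|w q 0 + mu_ m| < b * 2].
have mD m : measurable (D m).
  apply: measurable_lt_fun; last exact: measurable_cst.
  apply: measurableT_comp => //; apply: measurable_funD; first exact: measurable_entry.
  exact: measurable_cst.
have D0 := @pr_cvg0 _ _ _ (nu P) D set0 mD measurable0 (measure0 _).
have {}D0 : pr (nu P) (D m) @[m --> \oo] --> (0 : R).
  apply: D0 => w _; apply: filterS (mu_infty (b * 2 + `|w q 0|)) => m hm; rewrite /D /=.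
  apply/negP; rewrite -leNgt; have := ler_normB (w q 0 + mu_ m) (w q 0).
  by rewrite addrAC subrr add0r; lra.
have mp m : measurable [set z | D m (C_ m *m z)] by exact: measurable_preimage_mulmx.
have mb m : measurable [set z | 2^-1 < `|r_ m z - 1|].
  apply: measurable_lt_fun; first exact: measurable_cst.
  by apply: measurableT_comp => //; apply: measurable_funB; [exact: mr|exact: measurable_cst].
have le m : pr (nu (N_ m)) (E_ m) <= pr (nu P) (D m) + pr (nu (N_ m)) [set z | 2^-1 < `|r_ m z - 1|].
  have -> : pr (nu P) (D m) = pr (nu (N_ m)) [set z | D m (C_ m *m z)].
    rewrite /pr (@nu_gram _ _ _ P (C_ m) 1%:M)//; last by rewrite C_orth trmx1 mulmx1.
    by congr (fine (nu P _)); apply/seteqP; split => w /=; rewrite mul1mx.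
  apply: (pr_leU (nu (N_ m)) (mE m) (mp m) (mb m)) => z /Esub zE.
  have [bz|/negP] := pselect (2^-1 < `|r_ m z - 1|); first by right.
  rewrite -leNgt ler_norml => /andP[r1 r2]; left; have r0 : 0 < r_ m z by lra.
  move: zE; rewrite normrM normfV (gtr0_norm r0) ltr_pdivrMr// => /lt_le_trans; apply.
  by apply: ler_wpM2l => //; lra.
apply: (@squeeze_cvgr _ _ _ _ (cst 0) (fun m => pr (nu P) (D m) + pr (nu (N_ m)) [set z | 2^-1 < `|r_ m z - 1|])).
- by apply: nearW => m; rewrite pr_ge0 le.
- exact: cvg_cst.
- by rewrite -[X in _ --> X]addr0; apply: (@cvgD _ R^o) => //; apply: r_cvg; rewrite invr_gt0.
Qed.

End LimitCore.

(** * Inverses of leading blocks *)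

Section PaddedInverse.
Variables (R : realType) (P : nat).
Implicit Types (p q : 'I_P.+1) (M : 'M[R]_P).

(** The inclusion of R^p into R^P, and [trunc] is the projection onto its image. They turn
    submatrices into matrix products, so that blocks of different sizes can be handled by algebra in
    R^P. *)
Definition emb p : 'M[R]_(P, p) := firstcols p 1%:M.
Definition trunc p : 'M[R]_P := \matrix_(i, j) ((i == j) && (i < p)%N)%:R.

Lemma firstcolsE m p (D : 'M[R]_(m, P)) : firstcols p D = D *m emb p.
Proof. by rewrite /emb /firstcols mulmx_colsub mulmx1. Qed.

Lemma lo_or_hi p (i : 'I_P) : (exists a : 'I_p, i = lo a) \/ (exists b : 'I_(P - p), i = hi b).
Proof.
have [ip|pi] := ltnP i p; [left|right].
  by exists (Ordinal ip); apply/val_inj.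
have ipP : (i - p < P - p)%N by rewrite ltn_sub2r// (leq_ltn_trans pi).
by exists (Ordinal ipP); apply/val_inj => /=; rewrite subnKC.
Qed.

Lemma emb_mul_lo p n (u : 'M[R]_(p, n)) (a : 'I_p) j : (emb p *m u) (lo a) j = u a j.
Proof.
rewrite mxE (bigD1 a)//= !mxE eqxx mul1r big1 ?addr0// => b ba.
rewrite !mxE; case: eqP => [/(congr1 val)/= e|_]; last by rewrite mul0r.
by move: ba; rewrite -(inj_eq val_inj) /= e eqxx.
Qed.

Lemma emb_mul_ge p n (u : 'M[R]_(p, n)) (i : 'I_P) j : (p <= i)%N -> (emb p *m u) i j = 0.
Proof.
move=> pi; rewrite mxE big1// => b _; rewrite !mxE.
case: eqP => [e|_]; last by rewrite mul0r.
by move: pi; rewrite e leqNgt /= ltn_ord.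
Qed.

Lemma emb_tr_mul p n (D : 'M[R]_(P, n)) (a : 'I_p) j : ((emb p)^T *m D) a j = D (lo a) j.
Proof.
rewrite mxE (bigD1 (lo a))//= !mxE eqxx mul1r big1 ?addr0// => b ba.
by rewrite !mxE (negbTE ba) mul0r.
Qed.

Lemma emb_orth p : (emb p)^T *m emb p = 1%:M.
Proof.
apply/matrixP => a b; rewrite emb_tr_mul !mxE.
by rewrite -(inj_eq val_inj) /= (inj_eq val_inj).
Qed.

Lemma emb_trunc p : emb p *m (emb p)^T = trunc p.
Proof.
apply/matrixP => i j; rewrite [RHS]mxE; have [ip|pi] := ltnP i p.
  have -> : i = lo (Ordinal ip) by apply/val_inj.
  by rewrite emb_mul_lo !mxE andbT eq_sym.
by rewrite emb_mul_ge// andbF.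
Qed.

Lemma trunc_tr p : (trunc p)^T = trunc p.
Proof. by rewrite -emb_trunc trmx_mul trmxK. Qed.

Lemma trunc_mulE p n (D : 'M[R]_(P, n)) i j : (trunc p *m D) i j = if (i < p)%N then D i j else 0.
Proof.
rewrite -emb_trunc -mulmxA; have [ip|pi] := ltnP i p; last by rewrite emb_mul_ge.
have -> : i = lo (Ordinal ip) by apply/val_inj.
by rewrite emb_mul_lo emb_tr_mul.
Qed.

Lemma trunc_emb p q : (p <= q)%N -> trunc q *m emb p = emb p.
Proof.
move=> pq; apply/matrixP => i j; rewrite trunc_mulE; case: ltnP => // qi.
by rewrite -[emb p]mulmx1 emb_mul_ge// (leq_trans pq).
Qed.

Lemma trunc_ord_max : trunc ord_max = 1%:M.
Proof. by apply/matrixP => i j; rewrite !mxE ltn_ord andbT. Qed.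

Lemma stack_lo p (u : 'cV[R]_p) (v : 'cV[R]_(P - p)) a j : stack u v (lo a) j = u a 0.
Proof.
rewrite /stack castmxE /= (_ : cast_ord _ _ = lshift _ a); last exact/val_inj.
by rewrite col_mxEu ord1.
Qed.

Lemma stack_hi p (u : 'cV[R]_p) (v : 'cV[R]_(P - p)) b j : stack u v (hi b) j = v b 0.
Proof.
rewrite /stack castmxE /= (_ : cast_ord _ _ = rshift p b); last exact/val_inj.
by rewrite col_mxEd ord1.
Qed.

Lemma stack0E p (u : 'cV[R]_p) : stack u 0 = emb p *m u.
Proof.
apply/matrixP => i j; rewrite ord1; have [[a ->]|[b ->]] := lo_or_hi p i.
  by rewrite stack_lo emb_mul_lo.
by rewrite stack_hi mxE emb_mul_ge//= leq_addr.
Qed.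

Lemma Qpp_emb M p : Qpp M p = (emb p)^T *m M *m emb p.
Proof.
apply/matrixP => a b; rewrite -mulmxA emb_tr_mul.
by rewrite -firstcolsE !mxE.
Qed.

(* Zero padding of the inverse of the leading block M[p:p] to a P x P matrix, so
   that the objects attached to different p live in one space. *)
Definition padinv M p : 'M[R]_P :=
  locked (emb p *m invmx (Qpp M p) *m (emb p)^T).

(** This is the shape of the finite-sample bias [scaled_bias], so that the convergence of the bias
    to [delta] becomes continuity of matrix products. *)
Lemma delta_padinv M (psi : 'I_P -> \bar R) p :
  delta M psi p = (padinv M p *m M - 1%:M) *m ((1%:M - trunc p) *m \col_i fine (psi i)).
Proof.
set f := \col_i fine (psi i); set g := (1%:M - trunc p) *m f.
have g_lo a : g (lo (p := p) a) 0 = 0.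
  by rewrite /g mulmxBl mul1mx [LHS]mxE [X in _ + X]mxE trunc_mulE /= ltn_ord subrr.
have g_hi b : g (hi (p := p) b) 0 = psi_tail psi p b 0.
  rewrite /g mulmxBl mul1mx [LHS]mxE [X in _ + X]mxE trunc_mulE /= ltnNge leq_addr /=.
  by rewrite subr0 !mxE.
have Mg : (emb p)^T *m (M *m g) = Qpn M p *m psi_tail psi p.
  apply/matrixP => a j; rewrite ord1 emb_tr_mul mxE.
  pose F i := M (lo a) i * g i 0.
  rewrite [LHS](_ : _ = \sum_i F i)//.
  rewrite (reindex_onto (cast_ord (subnKC (leq_ord p))) (cast_ord (esym (subnKC (leq_ord p)))))/=; last first.
    by move=> i _; apply/val_inj.
  rewrite (eq_bigl xpredT); last by move=> i; apply/eqP/val_inj.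
  rewrite big_split_ord /= big1 ?add0r => [|i _]; last first.
    by rewrite /F (_ : cast_ord _ _ = lo i) ?g_lo ?mulr0//; exact/val_inj.
  by rewrite mxE; apply: eq_bigr => i _; rewrite /F -/(hi i) g_hi !mxE.
apply/matrixP => i j; rewrite ord1 mulmxBl mul1mx [RHS]mxE.
rewrite /padinv -lock -!mulmxA Mg; have [[a ->]|[b ->]] := lo_or_hi p i.
  by rewrite /delta stack_lo emb_mul_lo mulmxA [X in _ + X]mxE g_lo subr0.
rewrite /delta stack_hi emb_mul_ge ?leq_addr//= [X in _ + X]mxE g_hi add0r.
by rewrite mxE.
Qed.

Definition quad n (M : 'M[R]_n) (x : 'cV[R]_n) : R := (x^T *m M *m x) 0 0.

Definition posdef n (M : 'M[R]_n) := M^T = M /\ forall x, x != 0 -> 0 < quad M x.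

Lemma posdef_unit n (M : 'M[R]_n) : posdef M -> M \in unitmx.
Proof.
move=> [_ pM]; rewrite -row_free_unit -kermx_eq0; apply/negPn/negP.
move=> /rowV0Pn[u /sub_kermxP uM u0].
have := pM u^T; rewrite /quad trmxK uM mul0mx mxE ltxx => /(_ _)/negP.
by apply => //; rewrite -trmx0 (inj_eq trmx_inj).
Qed.

Lemma posdef_block M p : posdef M -> posdef (Qpp M p).
Proof.
move=> [sM pM]; rewrite Qpp_emb; split.
  by rewrite trmx_mul trmx_mul trmxK sM mulmxA.
move=> x x0; have := pM (emb p *m x); rewrite /quad trmx_mul !mulmxA; apply.
apply: contra x0 => /eqP e.
by rewrite -[x]mul1mx -(emb_orth p) -mulmxA e mulmx0.
Qed.

Section Posdef.
Variable M : 'M[R]_P.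
Hypothesis pM : posdef M.

Local Notation N := (padinv M).

Lemma padinv_tr p : (N p)^T = N p.
Proof.
have [s _] := posdef_block p pM.
by rewrite /padinv -!lock trmx_mul trmxK trmx_mul trmx_inv s mulmxA.
Qed.

Lemma emb_padinv p : (emb p)^T *m M *m N p = (emb p)^T.
Proof.
rewrite /padinv -!lock !mulmxA -(Qpp_emb M p) mulmxV ?mul1mx//.
exact/posdef_unit/posdef_block.
Qed.

Lemma padinv_ge p (i : 'I_P) j : (p <= i)%N -> N p i j = 0.
Proof. by move=> pi; rewrite /padinv -!lock -mulmxA emb_mul_ge. Qed.

Lemma padinv_trunc p q : (p <= q)%N -> N p *m trunc q = N p.
Proof.
move=> pq; rewrite /padinv -!lock -!mulmxA; congr (_ *m (_ *m _)).
by rewrite -[LHS]trmxK trmx_mul trmxK trunc_tr trunc_emb.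
Qed.

Lemma trunc_mul_padinv p : trunc p *m M *m N p = trunc p.
Proof. by rewrite -emb_trunc -!mulmxA (mulmxA _ M) emb_padinv. Qed.

(** [N p *m M] is the projection onto the first [p] coordinates that is orthogonal for the inner
    product given by [M]. Ranges are nested, so composing two such projections gives the one with
    the smaller range. *)
Lemma padinv_mul_le p q : (p <= q)%N -> N p *m M *m N q = N p.
Proof.
move=> pq; rewrite -{1}(padinv_trunc pq) -!mulmxA (mulmxA (trunc q)) trunc_mul_padinv.
exact: padinv_trunc.
Qed.

Lemma padinv_mul_ge p q : (q <= p)%N -> N p *m M *m N q = N q.
Proof.
move=> qp; have [sM _] := pM.
by apply: trmx_inj; rewrite !trmx_mul sM !padinv_tr mulmxA padinv_mul_le.
Qed.

Definition bsize (i : 'I_P) : 'I_P.+1 := lift ord0 i.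

Lemma bsizeE i : bsize i = i.+1 :> nat. Proof. by []. Qed.

(** The entry is the quadratic form of [M] at column [i] of the padded inverse. That column is
    nonzero, because [M] maps it to a vector whose entry [i] is 1. *)
Lemma padinv_diag_gt0 i : 0 < N (bsize i) i i.
Proof.
have [_ posM] := pM; pose x := col i (N (bsize i)).
have -> : N (bsize i) i i = quad M x.
  rewrite /quad /x colE trmx_mul padinv_tr trmx_delta -!mulmxA (mulmxA M) (mulmxA (N _)) (mulmxA (N _)).
  by rewrite padinv_mul_le// -colE -rowE !mxE.
apply: posM; apply/negP => /eqP x0.
have : ((emb (bsize i))^T *m M *m x) = (emb (bsize i))^T *m delta_mx i 0.
  by rewrite /x colE mulmxA emb_padinv.
have ii : (i < bsize i)%N by rewrite bsizeE.
have lo_i : lo (p := bsize i) (Ordinal ii) = i by exact/val_inj.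
rewrite x0 mulmx0 => /matrixP/(_ (Ordinal ii) 0); rewrite emb_tr_mul lo_i !mxE !eqxx => /eqP.
by rewrite eq_sym oner_eq0.
Qed.

Definition xi (i : 'I_P) : R := Num.sqrt (N (bsize i) i i).

Lemma xi_gt0 i : 0 < xi i. Proof. by rewrite sqrtr_gt0 padinv_diag_gt0. Qed.

Lemma xi_sqr i : xi i ^+ 2 = N (bsize i) i i.
Proof. by rewrite sqr_sqrtr// ltW// padinv_diag_gt0. Qed.

(* The i-th row of [whiten] is computed from the leading block of size i+1 alone:
   the coordinate i of the whitened vector is the normalized error of the (i+1)-st
   test statistic, whatever P is. *)
Definition whiten : 'M[R]_P := \matrix_(i, j) (N (bsize i) i j / xi i).

Lemma whiten_row i : row i whiten = (xi i)^-1 *: row i (N (bsize i)).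
Proof. by apply/rowP => j; rewrite !mxE mulrC. Qed.

Lemma whiten_upper (i j : 'I_P) : (i < j)%N -> whiten i j = 0.
Proof. by move=> ij; rewrite mxE -[N _]padinv_tr mxE padinv_ge ?mul0r. Qed.

Lemma whiten_diag i : whiten i i = xi i.
Proof. by rewrite mxE -xi_sqr expr2 mulfK// gt_eqF// xi_gt0. Qed.

(** For [i <= j] the entry equals [N (bsize i) i j / (xi i * xi j)] by nestedness of the
    projections. It is 1 for [i = j], and for [i < j] it vanishes because column [j] lies outside
    the block of size [i.+1]. *)
Lemma whiten_gram : whiten *m M *m whiten^T = 1%:M.
Proof.
suff le (i j : 'I_P) : (i <= j)%N -> (whiten *m M *m whiten^T) i j = (i == j)%:R.
  have [sM _] := pM; apply/matrixP => i j; rewrite [RHS]mxE.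
  have [ij|ji] := leqP i j; first exact: le.
  transitivity ((whiten *m M *m whiten^T)^T i j).
    by rewrite !trmx_mul trmxK sM mulmxA.
  by rewrite mxE le ?(ltnW ji)// eq_sym.
move=> ij.
transitivity ((row i whiten *m M *m (row j whiten)^T) 0 0).
  by rewrite -row_mul mxE [RHS]mxE; apply: eq_bigr => l _; rewrite [row _ _ _ _]mxE !mxE.
rewrite !whiten_row linearZ /= -!scalemxAl -scalemxAr.
rewrite !rowE trmx_mul padinv_tr -!mulmxA (mulmxA M) (mulmxA (N _)) (mulmxA (N _)).
rewrite padinv_mul_le// trmx_delta -rowE -colE !mxE.
have [<-|nij] := eqVneq i j.
  by rewrite -xi_sqr expr2 mulKf ?mulVf// gt_eqF// xi_gt0.
have {}ij : (i < j)%N by rewrite ltn_neqAle nij.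
by rewrite -[N _]padinv_tr mxE padinv_ge// !mulr0.
Qed.

Lemma whiten_inv : whiten^T *m whiten *m M = 1%:M.
Proof.
have h : whiten *m (M *m whiten^T) = 1%:M by rewrite mulmxA whiten_gram.
apply: mulmx1C; rewrite mulmxA; exact: mulmx1C.
Qed.

Lemma whiten_trunc p : trunc p *m whiten *m trunc p = trunc p *m whiten.
Proof.
apply/matrixP => i j; rewrite -mulmxA !trunc_mulE; case: ltnP => // ip.
rewrite -[_ *m trunc p]trmxK trmx_mul trunc_tr mxE trunc_mulE mxE.
by case: ltnP => // pj; rewrite whiten_upper// (leq_trans ip).
Qed.

(** One triangular factor serves all block sizes at once. This is what makes the noise of the
    estimator with [p] parameters depend on the first [p] whitened coordinates only. *)
Lemma whiten_padinv p : whiten^T *m trunc p *m whiten = N p.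
Proof.
have TMN : trunc p *m (whiten *m M *m N p) = whiten *m M *m N p.
  apply/matrixP => i j; rewrite trunc_mulE; case: ltnP => // pi; apply/esym.
  have -> : (whiten *m M *m N p) i j = (row i whiten *m M *m N p) 0 j by rewrite -!row_mul [RHS]mxE.
  rewrite whiten_row -!scalemxAl rowE -!mulmxA (mulmxA (N _)) padinv_mul_ge; last first.
    by rewrite bsizeE (leq_trans pi).
  by rewrite -rowE !mxE padinv_ge ?mulr0.
transitivity (whiten^T *m trunc p *m whiten *m M *m N p).
  rewrite -(mulmxA (whiten^T)) -(mulmxA (whiten^T)) -(whiten_trunc p) -!mulmxA.
  by rewrite (mulmxA (trunc p) M) trunc_mul_padinv !mulmxA -(mulmxA _ whiten) -(mulmxA (whiten^T)) (mulmxA (trunc p)) whiten_trunc.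
by rewrite -!mulmxA (mulmxA whiten) TMN !mulmxA whiten_inv mul1mx.
Qed.

End Posdef.
End PaddedInverse.

(** * Entrywise limits of matrices *)

Section MatrixLimits.
Variable R : realType.

Lemma seq_cvgD (u v : nat -> R) (a b : R) : u m @[m --> \oo] --> a ->
  v m @[m --> \oo] --> b -> (u m + v m) @[m --> \oo] --> a + b.
Proof. exact: (@cvgD _ R^o). Qed.

Lemma seq_cvgM (u v : nat -> R) (a b : R) : u m @[m --> \oo] --> a ->
  v m @[m --> \oo] --> b -> (u m * v m) @[m --> \oo] --> a * b.
Proof. exact: cvgM. Qed.

Lemma seq_cvgN (u : nat -> R) (a : R) : u m @[m --> \oo] --> a ->
  (- u m) @[m --> \oo] --> - a.
Proof. exact: (@cvgN _ R^o). Qed.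

Lemma seq_cvgV (u : nat -> R) (a : R) : a != 0 -> u m @[m --> \oo] --> a ->
  (u m)^-1 @[m --> \oo] --> a^-1.
Proof. by move=> a0; exact: cvgV. Qed.

Lemma seq_cvg_sqrt (u : nat -> R) (a : R) : u m @[m --> \oo] --> a ->
  Num.sqrt (u m) @[m --> \oo] --> Num.sqrt a.
Proof. by move=> ua; apply: (@continuous_cvg _ _ _ _ _ _ (@Num.sqrt R)) => //; exact: sqrt_continuous. Qed.

Lemma seq_cvg_sum (I : Type) (r : seq I) (Pr : pred I) (F : nat -> I -> R) (l : I -> R) :
  (forall i, F m i @[m --> \oo] --> l i) ->
  (\sum_(i <- r | Pr i) F m i) @[m --> \oo] --> \sum_(i <- r | Pr i) l i.
Proof.
move=> Fl; elim: r => [|i r IH].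
  by under eq_fun do rewrite big_nil; rewrite big_nil; exact: cvg_cst.
under eq_fun do rewrite big_cons; rewrite big_cons; case: ifP => // _.
exact: seq_cvgD.
Qed.

Lemma seq_cvg_prod (I : Type) (r : seq I) (Pr : pred I) (F : nat -> I -> R) (l : I -> R) :
  (forall i, F m i @[m --> \oo] --> l i) ->
  (\prod_(i <- r | Pr i) F m i) @[m --> \oo] --> \prod_(i <- r | Pr i) l i.
Proof.
move=> Fl; elim: r => [|i r IH].
  by under eq_fun do rewrite big_nil; rewrite big_nil; exact: cvg_cst.
under eq_fun do rewrite big_cons; rewrite big_cons; case: ifP => // _.
exact: seq_cvgM.
Qed.

Definition mcvg m n (A_ : nat -> 'M[R]_(m, n)) (A : 'M[R]_(m, n)) :=
  forall i j, A_ l i j @[l --> \oo] --> A i j.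

Lemma mcvg_cst m n (A : 'M[R]_(m, n)) : mcvg (fun=> A) A.
Proof. by move=> i j; exact: cvg_cst. Qed.

Lemma mcvgM m n p (A_ : nat -> 'M[R]_(m, n)) A (B_ : nat -> 'M[R]_(n, p)) B :
  mcvg A_ A -> mcvg B_ B -> mcvg (fun l => A_ l *m B_ l) (A *m B).
Proof.
move=> hA hB i j; rewrite mxE; under eq_fun do rewrite mxE.
by apply: seq_cvg_sum => k; exact: seq_cvgM.
Qed.

Lemma mcvgD m n (A_ : nat -> 'M[R]_(m, n)) A (B_ : nat -> 'M[R]_(m, n)) B :
  mcvg A_ A -> mcvg B_ B -> mcvg (fun l => A_ l + B_ l) (A + B).
Proof.
by move=> hA hB i j; rewrite mxE; under eq_fun do rewrite mxE; exact: seq_cvgD.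
Qed.

Lemma mcvgB m n (A_ : nat -> 'M[R]_(m, n)) A (B_ : nat -> 'M[R]_(m, n)) B :
  mcvg A_ A -> mcvg B_ B -> mcvg (fun l => A_ l - B_ l) (A - B).
Proof.
move=> hA hB; apply: mcvgD => // i j; rewrite mxE; under eq_fun do rewrite mxE.
exact: seq_cvgN.
Qed.

Lemma mcvgZ m n (a_ : nat -> R) (a : R) (A_ : nat -> 'M[R]_(m, n)) A :
  a_ l @[l --> \oo] --> a -> mcvg A_ A -> mcvg (fun l => a_ l *: A_ l) (a *: A).
Proof.
by move=> ha hA i j; rewrite mxE; under eq_fun do rewrite mxE; exact: seq_cvgM.
Qed.

Lemma mcvg_tr m n (A_ : nat -> 'M[R]_(m, n)) A :
  mcvg A_ A -> mcvg (fun l => (A_ l)^T) A^T.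
Proof. move=> hA i j; rewrite mxE; under eq_fun do rewrite mxE; exact: hA. Qed.

Lemma det_cvg n (A_ : nat -> 'M[R]_n) A : mcvg A_ A ->
  \det (A_ l) @[l --> \oo] --> \det A.
Proof.
move=> hA; apply: seq_cvg_sum => s; apply: seq_cvgM; first exact: cvg_cst.
by apply: seq_cvg_prod.
Qed.

Lemma mcvg_inv n (A_ : nat -> 'M[R]_n) A : (forall l, A_ l \in unitmx) ->
  A \in unitmx -> mcvg A_ A -> mcvg (fun l => invmx (A_ l)) (invmx A).
Proof.
move=> uA_ uA hA i j; rewrite /invmx uA; under eq_fun do rewrite uA_.
rewrite !mxE; under eq_fun do rewrite !mxE.
apply: seq_cvgM.
  by apply: seq_cvgV; [rewrite -unitfE|exact: det_cvg].
apply: seq_cvgM; first exact: cvg_cst.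
apply: det_cvg => a b; rewrite !mxE; under eq_fun do rewrite !mxE; exact: hA.
Qed.

Lemma mcvg_entrywise m n (A_ : nat -> 'M[R]_(m, n)) A :
  A_ l @[l --> \oo] --> A -> mcvg A_ A.
Proof.
move=> hA i j; apply: (@continuous_cvg _ _ _ _ _ _ (fun M : 'M[R]_(m, n) => M i j)) => //.
exact: coord_continuous.
Qed.

Lemma quad_cvg n (A_ : nat -> 'M[R]_n) A x : mcvg A_ A ->
  quad (A_ l) x @[l --> \oo] --> quad A x.
Proof.
move=> hA; apply: mcvgM; last exact: mcvg_cst.
by apply: mcvgM => //; exact: mcvg_cst.
Qed.

(** The theorem assumes of [Q] only that it is invertible. Symmetry and a nonnegative quadratic form
    pass to the limit, and a vector on which a nonnegative form vanishes lies in the kernel. *)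
Lemma posdef_limit n (A_ : nat -> 'M[R]_n) A : (forall l, posdef (A_ l)) ->
  mcvg A_ A -> A \in unitmx -> posdef A.
Proof.
move=> pA hA uA.
have sA : A^T = A.
  apply/matrixP => i j; rewrite mxE; apply: (cvg_unique _ (hA j i)) => //.
  suff -> : (fun l => A_ l j i) = fun l => A_ l i j by exact: hA.
  by apply/funext => l; rewrite -[in LHS](pA l).1 mxE.
have ge0 x : 0 <= quad A x.
  have hx := quad_cvg (x := x) hA.
  rewrite -(cvg_lim _ hx)//; apply: limr_ge; first by apply/cvg_ex; exists (quad A x).
  apply: nearW => l; have [->|x0] := eqVneq x 0.
    by rewrite /quad trmx0 mul0mx mul0mx mxE.
  exact/ltW/(pA l).2.
split=> // x x0; rewrite lt_def ge0 andbT; apply: contra x0 => /eqP q0.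
suff Ax : A *m x = 0 by rewrite -[x]mul1mx -(mulVmx uA) -mulmxA Ax mulmx0.
pose y := A *m x; pose s := (y^T *m y) 0 0; pose v := quad A y.
(* 0 <= q(x - t y) = - 2 t |y|^2 + t^2 q(y) for all t forces y = 0 *)
have qE t : quad A (x - t *: y) = - (2 * t * s) + t ^+ 2 * v.
  have e1 : (x^T *m A *m y) 0 0 = s by rewrite /s /y trmx_mul sA.
  have e2 : (y^T *m A *m x) 0 0 = s by rewrite -mulmxA -/y.
  have subE (B C : 'M[R]_1) : (B - C) 0 0 = B 0 0 - C 0 0 by rewrite !mxE.
  have scE (a : R) (B : 'M[R]_1) : (a *: B) 0 0 = a * B 0 0 by rewrite !mxE.
  have tE : (x - t *: y)^T = x^T - t *: y^T by rewrite linearB/= linearZ.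
  rewrite /quad tE mulmxBr !mulmxBl -!scalemxAr -!scalemxAl !subE !scE.
  rewrite -/(quad A x) q0 e1 e2 -/(quad A y) -/v; ring.
have s0 : 0 <= s by rewrite /s -/(sqnorm y) sqnormE sumr_ge0// => i _; rewrite sqr_ge0.
have v0 : 0 <= v by exact: ge0.
have sz : s = 0.
  apply/eqP; rewrite eq_le s0 andbT leNgt; apply/negP => sp.
  (* The minimizer of the parabola would be [s / v]; with [v + 1] in the denominator the value is
     still negative, and [v = 0] is covered. *)
  have := ge0 (x - (s / (v + 1)) *: y); rewrite qE.
  have v1 : 0 < v + 1 by rewrite ltr_wpDl.
  have -> : - (2 * (s / (v + 1)) * s) + (s / (v + 1)) ^+ 2 * v = (s / (v + 1)) ^+ 2 * (- v - 2).
    by field; rewrite gt_eqF.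
  have : 0 < (s / (v + 1)) ^+ 2 by rewrite exprn_gt0// divr_gt0.
  move=> h; rewrite pmulr_rge0//; lra.
apply/matrixP => i j; rewrite ord1 [RHS]mxE -/y; apply/eqP.
move: sz; rewrite /s -/(sqnorm y) sqnormE => /eqP; rewrite psumr_eq0; last by move=> ? _; exact: sqr_ge0.
by move=> /allP/(_ i (mem_index_enum _)); rewrite sqrf_eq0.
Qed.

Lemma posdef_gram n P (X : 'M[R]_(n, P)) (a : R) : \rank X = P -> 0 < a ->
  posdef (a *: (X^T *m X)).
Proof.
move=> rX a0; split; first by rewrite linearZ/= trmx_mul trmxK.
move=> x x0; rewrite /quad -scalemxAr -scalemxAl [X in 0 < X]mxE mulr_gt0//.
have Xx : X *m x != 0.
  apply: contra x0 => /eqP Xx; have fX : row_free X^T by rewrite /row_free mxrank_tr rX.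
  by apply/eqP/trmx_inj/(row_free_inj fX); rewrite -trmx_mul Xx !trmx0 mul0mx.
rewrite (_ : _ 0 0 = sqnorm (X *m x)); last by rewrite /sqnorm trmx_mul !mulmxA.
rewrite lt_def sqnormE sumr_ge0 => [|i _]; last exact: sqr_ge0.
rewrite andbT psumr_eq0 => [|i _]; last exact: sqr_ge0.
apply: contra Xx => /allP h; apply/eqP/matrixP => i j; rewrite ord1 [RHS]mxE.
by have := h i (mem_index_enum _); rewrite sqrf_eq0 => /eqP.
Qed.

Section PaddedLimits.
Variables (P : nat) (M_ : nat -> 'M[R]_P) (M : 'M[R]_P).
Hypothesis pM_ : forall l, posdef (M_ l).
Hypothesis pM : posdef M.
Hypothesis M_cvg : mcvg M_ M.

Lemma padinv_cvg p : mcvg (fun l => padinv (M_ l) p) (padinv M p).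
Proof.
rewrite /padinv; under eq_fun do rewrite -lock; rewrite -lock.
apply: mcvgM; last exact: mcvg_cst.
apply: mcvgM; first exact: mcvg_cst.
apply: mcvg_inv => [l||]; try exact/posdef_unit/posdef_block.
move=> i j; rewrite !mxE; under eq_fun do rewrite !mxE; exact: M_cvg.
Qed.

Lemma xi_cvg i : xi (M_ l) i @[l --> \oo] --> xi M i.
Proof. exact/seq_cvg_sqrt/padinv_cvg. Qed.

Lemma whiten_cvg : mcvg (fun l => whiten (M_ l)) (whiten M).
Proof.
move=> i j; rewrite mxE; under eq_fun do rewrite mxE.
apply: seq_cvgM; first exact: padinv_cvg.
by apply: seq_cvgV; [rewrite gt_eqF// xi_gt0|exact: xi_cvg].
Qed.

End PaddedLimits.
End MatrixLimits.

(** * The selection event in normal coordinates *)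

Section FiniteSampleLaw.
Variables (R : realType) (P k : nat) (O : 'I_P.+1).
Variables (X : forall n, 'M[R]_(n, P)) (A : 'M[R]_(k, P)) (c : nat -> R).
Variables (n : nat) (known : bool) (theta : 'cV[R]_P) (sigma : R).
Hypothesis P_lt_n : (P < n)%N.
Hypothesis X_rank : \rank (X n) = P.
Hypothesis sigma_gt0 : 0 < sigma.
Hypothesis c_O : c O = 0.
Local Notation nu := (@std_normal_cv R).

Definition gram_mx : 'M[R]_P := locked (n%:R^-1 *: ((X n)^T *m X n)).
Local Notation M := gram_mx.
Definition local_param : 'cV[R]_P := Num.sqrt n%:R *: theta.
(** The chosen root need not be [sigma%:M], only [sigma] times some orthogonal matrix; the whitener
    has to carry it along. *)
Definition error_root : 'M[R]_n := root_mx (sigma ^+ 2)%:M.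
(* If z is the standardized error, [whitener *m z] is standard normal in R^P; its
   coordinate i is the noise of the statistic T_(i+1), and the error of the
   restricted estimator with p parameters depends on its first p coordinates only. *)
Definition whitener : 'M[R]_(P, n) :=
  locked ((sigma^-1 / Num.sqrt n%:R) *: (whiten M *m (X n)^T *m error_root)).
(** In the feasible case this is [sigma_hat / sigma]: by Pythagoras, the residual of the full
    least-squares fit has squared length [sigma ^+ 2] times the difference of the two squared
    norms. *)
Definition sigma_ratio (z : 'cV[R]_n) : R :=
  if known then 1 else Num.sqrt ((n - P)%:R^-1 * (sqnorm z - sqnorm (whitener *m z))).
Definition tmean (i : 'I_P) : R :=
  (padinv M (bsize i) *m M *m local_param) i 0 / (sigma * xi M i).
(** The truncation of the parameter does not change the value, as [scaled_biasE] shows, but it keeps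
    the first [p] components out of the formula. These may diverge along the sequence, while the
    bias must converge. *)
Definition scaled_bias p : 'cV[R]_P :=
  (padinv M p *m M - 1%:M) *m ((1%:M - trunc R p) *m local_param).
Definition scaled_fit p (w : 'cV[R]_P) : 'cV[R]_k :=
  A *m scaled_bias p + sigma *: (A *m (whiten M)^T *m trunc R p *m w).

Local Notation Yof z := (X n *m theta + error_root *m z).

Let n_gt0 : 0 < n%:R :> R.
Proof. by rewrite ltr0n (leq_ltn_trans _ P_lt_n). Qed.

Let sn_gt0 : 0 < Num.sqrt n%:R :> R.
Proof. by rewrite sqrtr_gt0. Qed.

Let sn2 : n%:R = Num.sqrt n%:R ^+ 2 :> R.
Proof. by rewrite sqr_sqrtr// ltW. Qed.

Lemma gram_posdef : posdef M.
Proof. by rewrite /gram_mx -lock; apply: posdef_gram => //; rewrite invr_gt0. Qed.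
Let pM := gram_posdef.

Lemma error_rootP : error_root *m error_root^T = (sigma ^+ 2)%:M.
Proof.
have e : (sigma ^+ 2)%:M = sigma%:M *m (sigma%:M)^T :> 'M[R]_n.
  by rewrite tr_scalar_mx -scalar_mxM expr2.
by rewrite /error_root e root_mxP.
Qed.

Lemma error_rootPV : error_root^T *m error_root = (sigma ^+ 2)%:M.
Proof.
have s2 : sigma ^+ 2 != 0 by rewrite sqrf_eq0 gt_eqF.
have h : error_root *m ((sigma ^+ 2)^-1 *: error_root^T) = 1%:M.
  by rewrite -scalemxAr error_rootP scale_scalar_mx mulVf.
have := mulmx1C h; rewrite -scalemxAl => /(congr1 (fun B => sigma ^+ 2 *: B)).
by rewrite scalerA divff// scale1r scale_scalar_mx mulr1.
Qed.

Lemma gramE : (X n)^T *m X n = n%:R *: M.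
Proof. by rewrite /gram_mx -lock scalerA divff ?scale1r// gt_eqF. Qed.

Lemma whitener_orth : whitener *m whitener^T = 1%:M.
Proof.
rewrite /whitener -lock linearZ/= -scalemxAl -scalemxAr scalerA !trmx_mul trmxK.
rewrite mulmxA -(mulmxA _ error_root) error_rootP mul_mx_scalar -scalemxAl.
rewrite mulmxA -(mulmxA _ (X n)^T) gramE -scalemxAr -scalemxAl (whiten_gram pM) !scalerA.
rewrite (_ : _ * _ = 1) ?scale1r//.
have := sn2; have := sn_gt0; set q := Num.sqrt _ => q0 ->.
by field; rewrite !gt_eqF.
Qed.

Lemma whiten_error (z : 'cV[R]_n) :
  whiten M *m ((X n)^T *m (error_root *m z)) = (sigma * Num.sqrt n%:R) *: (whitener *m z).
Proof.
rewrite /whitener -lock -scalemxAl scalerA !mulmxA (_ : _ * _ = 1) ?scale1r//.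
by field; rewrite !gt_eqF.
Qed.

Lemma restricted_lsE p (Y : 'cV[R]_n) :
  restricted_ls X Y p = n%:R^-1 *: (padinv M p *m ((X n)^T *m Y)).
Proof.
rewrite /restricted_ls stack0E /padinv -lock !firstcolsE.
have -> : (X n *m emb R p)^T *m (X n *m emb R p) = n%:R *: Qpp M p.
  by rewrite Qpp_emb trmx_mul !mulmxA -(mulmxA _ (X n)^T) gramE -scalemxAr -scalemxAl.
rewrite invmxZ; last first.
  by rewrite unitmxZ ?unitfE ?gt_eqF//; exact/posdef_unit/posdef_block.
by rewrite trmx_mul -!scalemxAl -scalemxAr !mulmxA.
Qed.

Lemma scaled_restricted_ls p (z : 'cV[R]_n) :
  Num.sqrt n%:R *: restricted_ls X (Yof z) p =
  padinv M p *m M *m local_param + sigma *: ((whiten M)^T *m trunc R p *m (whitener *m z)).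
Proof.
rewrite restricted_lsE scalerA mulmxDr mulmxDr scalerDr; congr (_ + _).
  rewrite (mulmxA (X n)^T) gramE /local_param -!scalemxAl -!scalemxAr !mulmxA !scalerA.
  congr (_ *: _); have := sn2; have := sn_gt0; set q := Num.sqrt _ => q0 ->.
  by field; rewrite gt_eqF.
rewrite -(whiten_padinv pM p) -!mulmxA whiten_error -!scalemxAr scalerA.
congr (_ *: _); have := sn2; have := sn_gt0; set q := Num.sqrt _ => q0 ->.
by field; rewrite gt_eqF.
Qed.

Lemma scaled_biasE p : scaled_bias p = padinv M p *m M *m local_param - local_param.
Proof.
have e : padinv M p *m M *m trunc R p = trunc R p.
  have [sM _] := pM; apply: trmx_inj.
  by rewrite !trmx_mul trunc_tr sM padinv_tr// mulmxA trunc_mul_padinv.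
have tz : (padinv M p *m M - 1%:M) *m trunc R p = 0 by rewrite mulmxBl mul1mx e subrr.
by rewrite /scaled_bias mulmxA mulmxBr mulmx1 tz subr0 mulmxBl mul1mx.
Qed.

Lemma scaled_error_restricted p (z : 'cV[R]_n) :
  Num.sqrt n%:R *: (A *m (restricted_ls X (Yof z) p - theta)) = scaled_fit p (whitener *m z).
Proof.
rewrite mulmxBr scalerBr !scalemxAr scaled_restricted_ls -/local_param.
by rewrite /scaled_fit scaled_biasE !mulmxDr !mulmxN -!scalemxAr [LHS]addrAC !mulmxA.
Qed.

Lemma diag1_emb (i : 'I_P) (B : 'M[R]_(bsize (P := P) i)) :
  diag1 B (bsize i) = (emb R (bsize i) *m B *m (emb R (bsize i))^T) i i.
Proof.
have ii : (i < bsize i)%N by rewrite bsizeE.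
have lo_i : lo (p := bsize i) (Ordinal ii) = i by exact/val_inj.
rewrite /diag1 /nth1; case: insubP => [u _ ui|]; last by rewrite /= ltnS leqnn.
have -> /= : u = Ordinal ii by apply/val_inj.
have := emb_mul_lo (B *m (emb R (bsize i))^T) (Ordinal ii) i; rewrite lo_i -mulmxA => ->.
have -> : B *m (emb R (bsize i))^T = (emb R (bsize i) *m B^T)^T by rewrite trmx_mul trmxK.
have := emb_mul_lo B^T (Ordinal ii) (Ordinal ii); rewrite lo_i [RHS]mxE => e.
by rewrite [RHS]mxE e.
Qed.

Lemma xi_nE i : xi_n X n (bsize i) = xi M i.
Proof.
rewrite /xi_n /xi diag1_emb /padinv -lock Qpp_emb.
by rewrite /gram_mx -lock !firstcolsE trmx_mul -scalemxAr -scalemxAl !mulmxA.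
Qed.

Lemma entry1E (x : 'cV[R]_P) i : entry1 x (bsize i) = x i 0.
Proof.
rewrite /entry1 /nth1; case: insubP => [u _ ui|]; last by rewrite /= ltn_ord.
by congr (x _ 0); exact/val_inj.
Qed.

(** The triangular shape leaves only the terms [j >= i], the truncation only [j <= i]; thus the
    noise of the statistic [i.+1] is a single coordinate. *)
Lemma whiten_tr_trunc i (w : 'cV[R]_P) :
  ((whiten M)^T *m trunc R (bsize i) *m w) i 0 = xi M i * w i 0.
Proof.
rewrite -mulmxA mxE (bigD1 i)//= big1 ?addr0 => [|j ji].
  by rewrite mxE whiten_diag// trunc_mulE bsizeE ltnSn.
rewrite trunc_mulE bsizeE ltnS [_^T _ _]mxE; case: leqP => [jj|_]; last by rewrite mulr0.
by rewrite whiten_upper ?mul0r// ltn_neqAle jj andbT.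
Qed.

Lemma sigma_hatE (z : 'cV[R]_n) : sigma_hat X (Yof z) =
  sigma * Num.sqrt ((n - P)%:R^-1 * (sqnorm z - sqnorm (whitener *m z))).
Proof.
rewrite /sigma_hat; set res := _ - _.
pose u := error_root *m z.
have resE : res = u - n%:R^-1 *: (X n *m (whiten M)^T *m (whiten M *m ((X n)^T *m u))).
  rewrite /res restricted_lsE -(whiten_padinv pM ord_max) trunc_ord_max mulmx1.
  rewrite mulmxDr -/u mulmxDr scalerDr mulmxDr.
  have -> : X n *m (n%:R^-1 *: ((whiten M)^T *m whiten M *m ((X n)^T *m (X n *m theta)))) = X n *m theta.
    rewrite (mulmxA (X n)^T) gramE -scalemxAl -!scalemxAr scalerA mulVf ?gt_eqF// scale1r.
    by rewrite (mulmxA (_ *m _)) whiten_inv// mul1mx.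
  by rewrite opprD addrACA subrr add0r -scalemxAr !mulmxA.
pose v := whiten M *m ((X n)^T *m u).
have vE : v = (sigma * Num.sqrt n%:R) *: (whitener *m z) by exact: whiten_error.
have uu : u^T *m u = sigma ^+ 2 *: (z^T *m z).
  by rewrite /u trmx_mul -mulmxA (mulmxA error_root^T) error_rootPV mul_scalar_mx -scalemxAr.
have UU (v' : 'cV[R]_P) : (X n *m (whiten M)^T *m v')^T *m (X n *m (whiten M)^T *m v') = n%:R *: (v'^T *m v').
  rewrite !trmx_mul !trmxK -!mulmxA (mulmxA (X n)^T) gramE -scalemxAl -!scalemxAr.
  by rewrite (mulmxA (whiten M)) (mulmxA (whiten M *m M)) whiten_gram// mul1mx.
have uX' (u' : 'cV[R]_n) (v' : 'cV[R]_P) :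
    u'^T *m (X n *m (whiten M)^T *m v') = (whiten M *m ((X n)^T *m u'))^T *m v'.
  by rewrite !trmx_mul trmxK !mulmxA.
have uX : u^T *m (X n *m (whiten M)^T *m v) = v^T *m v by exact: uX'.
have Xu : (X n *m (whiten M)^T *m v)^T *m u = v^T *m v.
  have dotC (a b : 'cV[R]_n) : a^T *m b = b^T *m a.
    by apply/matrixP => i j; rewrite !ord1 !mxE; apply: eq_bigr => l _; rewrite !mxE mulrC.
  by rewrite dotC uX.
have rr : res^T *m res = sigma ^+ 2 *: (z^T *m z - (whitener *m z)^T *m (whitener *m z)).
  have expand (a b : 'cV[R]_n) (s : R) : (a - s *: b)^T *m (a - s *: b) =
      (a^T *m a - s *: (a^T *m b)) - (s *: (b^T *m a) - (s * s) *: (b^T *m b)).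
    have -> : (a - s *: b)^T = a^T - s *: b^T by rewrite linearB/= linearZ.
    by rewrite mulmxBl !mulmxBr -!scalemxAl -!scalemxAr scalerA.
  rewrite resE -/v expand UU uX Xu uu scalerA -mulrA mulVf ?gt_eqF// mulr1 subrr subr0 scalerBr.
  congr (_ - _); rewrite vE; move: (whitener *m z) => y.
  have -> : ((sigma * Num.sqrt n%:R) *: y)^T = (sigma * Num.sqrt n%:R) *: y^T by rewrite linearZ.
  rewrite -scalemxAl -scalemxAr !scalerA; congr (_ *: _).
  have := sn2; have := sn_gt0; set q := Num.sqrt _ => q0 ->.
  by field; rewrite gt_eqF.
rewrite rr [X in _ * X]mxE [X in sigma ^+ 2 * X]mxE [X in _ + X]mxE mulrCA sqrtrM ?sqr_ge0//.
by rewrite sqrtr_sqr gtr0_norm.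
Qed.

Lemma tstatE i (z : 'cV[R]_n) : tstat X (Yof z) known sigma (bsize i) =
  ((whitener *m z) i 0 + tmean i) / sigma_ratio z.
Proof.
rewrite /tstat /= entry1E xi_nE.
have -> : Num.sqrt n%:R * restricted_ls X (Yof z) (bsize i) i 0 =
    (Num.sqrt n%:R *: restricted_ls X (Yof z) (bsize i)) i 0 by rewrite [RHS]mxE.
rewrite scaled_restricted_ls mxE [X in _ + X]mxE whiten_tr_trunc.
have -> : (if known then sigma else sigma_hat X (Yof z)) = sigma * sigma_ratio z.
  by rewrite /sigma_ratio sigma_hatE; case: known; rewrite ?mulr1.
have x0 := xi_gt0 pM i.
rewrite /tmean; set a := (_ *m _) i 0.
set y := (_ *m z) i 0.
have -> : a + sigma * (xi M i * y) = (y + a / (sigma * xi M i)) * (sigma * xi M i).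
  by field; rewrite !gt_eqF.
have -> : sigma * sigma_ratio z * xi M i = sigma * xi M i * sigma_ratio z by ring.
(* Only this factor is cancelled. The ratio may be [0], in which case both sides are [0] by
   convention. *)
have : sigma * xi M i != 0 by rewrite mulf_neq0// gt_eqF.
by move: (_ * xi _ _) => s s0; rewrite [(s * _)^-1]invfM mulrA mulfK.
Qed.

Lemma phatP (p : 'I_P.+1) (Y : 'cV[R]_n) : (O <= p)%N -> phat O X c Y known sigma = p <->
  c p <= `|tstat X Y known sigma p| /\
  forall q : 'I_P.+1, (p < q)%N -> `|tstat X Y known sigma q| < c q.
Proof.
move=> Op; rewrite /phat.
have hO : (O <= O)%N && (c O <= `|tstat X Y known sigma O|) by rewrite leqnn c_O normr_ge0.
case: arg_maxnP => // j /andP[Oj cj] jmax; split.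
  move=> <-; split => // q jq; rewrite ltNge; apply/negP => cq.
  have := jmax q; rewrite cq (leq_trans Oj (ltnW jq)) => /(_ isT).
  by rewrite /geq/= leqNgt jq.
move=> [cp lt]; have pj : (p <= j)%N by apply: jmax; rewrite Op cp.
apply/val_inj/eqP; rewrite /= eqn_leq pj andbT leqNgt.
by apply/negP => /lt; rewrite ltNge cj.
Qed.

Lemma scaled_error_selected (p : 'I_P.+1) (Y : 'cV[R]_n) : (O <= p)%N ->
  phat O X c Y known sigma = p ->
  scaled_error O X A c known theta sigma Y =
  Num.sqrt n%:R *: (A *m (restricted_ls X Y p - theta)).
Proof.
move=> Op hp; rewrite /scaled_error /post_selection hp; congr (_ *: (_ *m (_ - _))).
by rewrite (bigD1 p)//= eqxx scale1r big1 ?addr0// => q /andP[_ /negbTE]; rewrite eq_sym => ->; rewrite scale0r.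
Qed.

Lemma sel_event_iff (p : 'I_P.+1) t (z : 'cV[R]_n) : (O <= p)%N ->
  (orthant t (scaled_error O X A c known theta sigma (Yof z)) /\
   selects O X c known sigma p (Yof z)) <->
  sel_event c p (scaled_fit p) tmean whitener sigma_ratio t z.
Proof.
move=> Op; split.
  move=> [ort sel]; have [cp cq] := (phatP (Yof z) Op).1 sel.
  split.
  - by move=> i; have := ort i; rewrite (scaled_error_selected Op sel) scaled_error_restricted.
  - by move=> q qp; rewrite -tstatE (_ : bsize q = p)//; exact/val_inj.
  - by move=> q pq; rewrite -tstatE; apply: (cq (bsize q)).
move=> [h1 h2 h3].
have sel : phat O X c (Yof z) known sigma = p.
  apply/(phatP _ Op); split.
    have [i pi|p0] := unliftP ord0 p.
      by rewrite pi tstatE -pi; apply: h2; rewrite pi.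
    (* No coordinate carries a test for [p = 0]; then [O = 0] as well, and the critical value is
       [0]. *)
    have O0 : O = p by apply/val_inj => /=; move: Op; rewrite p0 /= leqn0 => /eqP.
    by rewrite -{1}O0 c_O normr_ge0.
  move=> q pq; have [i qi|q0] := unliftP ord0 q; last by rewrite q0 in pq.
  by rewrite qi tstatE; apply: h3; move: pq; rewrite qi.
split => // i; rewrite (scaled_error_selected Op sel) scaled_error_restricted; exact: h1.
Qed.

Lemma prYE (E : set 'cV[R]_n) : prY X theta sigma E = pr (nu n) [set z | E (Yof z)].
Proof. by rewrite /prY gaussianE. Qed.

End FiniteSampleLaw.

(** * Consistency of the variance estimate *)

Section VarianceConsistency.
Variables (R : realType) (P : nat) (N_ : nat -> nat) (C_ : forall m, 'M[R]_(P, N_ m)).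
Local Notation nu := (@std_normal_cv R).
Hypothesis C_orth : forall m, C_ m *m (C_ m)^T = 1%:M.
Hypothesis N_gt : forall m, (P < N_ m)%N.
Hypothesis N_ge : forall m, (m <= N_ m)%N.

Definition resid_ratio m (z : 'cV[R]_(N_ m)) : R :=
  Num.sqrt ((N_ m - P)%:R^-1 * (sqnorm z - sqnorm (C_ m *m z))).

Lemma measurable_resid_ratio m : measurable_fun setT (@resid_ratio m).
Proof.
apply: measurableT_comp; first by apply: continuous_measurable_fun; exact: sqrt_continuous.
apply: measurable_funM; first exact: measurable_cst.
apply: measurable_funB; first exact: measurable_sqnorm.
exact: (measurableT_comp (@measurable_sqnorm R P) (measurable_mulmx (C_ m))).
Qed.

Lemma norm_sqrt_sub1 (v : R) : 0 <= v -> `|Num.sqrt v - 1| <= `|v - 1|.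
Proof.
move=> v0; have s0 := sqrtr_ge0 v.
have -> : v - 1 = (Num.sqrt v - 1) * (Num.sqrt v + 1).
  by rewrite -{1}[v]sqr_sqrtr//; ring.
by rewrite normrM ler_peMr// ger0_norm ?addr_ge0// lerDr.
Qed.

(** The squared norm of the noise concentrates around [N_ m] at an exponential rate, while that of
    its whitened part has a law that does not change with [m] and is negligible against [N_ m]. *)
Lemma resid_ratio_cvg1 (e : R) : 0 < e ->
  pr (nu (N_ m)) [set z | e < `|@resid_ratio m z - 1|] @[m --> \oo] --> (0 : R).
Proof.
move=> e0; pose e' := Num.min e 1.
have e'0 : 0 < e' by rewrite lt_min e0 ltr01.
have e'e : e' <= e by rewrite ge_min lexx.
have e'1 : e' <= 1 by rewrite ge_min lexx orbT.
(* Each of the two squared norms contributes an error of at most [a * N_ m]. The passage from [N_ m]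
   to [N_ m - P] costs [P * (1 + e')], at most [N_ m * (e' / 2)] for large [m]; all together stay
   below [e' * N_ m]. The cap [e' <= 1] keeps the variance ratio nonnegative. *)
pose a := e' / 8; have a0 : 0 < a by rewrite divr_gt0.
have [rho /andP[rho0 rho1] conc] := sqnorm_concentration a0.
have msq n : measurable_fun setT (@sqnorm R n) by exact: measurable_sqnorm.
pose U m := [set z : 'cV[R]_(N_ m) | (1 + a) * (N_ m)%:R <= sqnorm z].
pose L m := [set z : 'cV[R]_(N_ m) | sqnorm z <= (1 - a) * (N_ m)%:R].
pose W m := [set w : 'cV[R]_P | a * m%:R < sqnorm w].
have mU m : measurable (U m) by apply: measurable_le_fun; [exact: measurable_cst|exact: msq].
have mL m : measurable (L m) by apply: measurable_le_fun; [exact: msq|exact: measurable_cst].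
have mW m : measurable (W m) by apply: measurable_lt_fun; [exact: measurable_cst|exact: msq].
have mWC m : measurable [set z | W m (C_ m *m z)] by exact: measurable_preimage_mulmx.
pose B m := [set z : 'cV[R]_(N_ m) | e < `|resid_ratio z - 1|].
have mB m : measurable (B m).
  apply: measurable_lt_fun; first exact: measurable_cst.
  by apply: measurableT_comp => //; apply: measurable_funB; [exact: measurable_resid_ratio|exact: measurable_cst].
have rhoN m : rho ^+ N_ m <= rho ^+ m.
  by apply: ler_wiXn2l => //; rewrite ?rho0// ltW.
have pU m : pr (nu (N_ m)) (U m) <= rho ^+ m.
  by apply: le_trans (rhoN m); rewrite -lee_fin (prE _ (mU m)); have [] := conc (N_ m).
have pL m : pr (nu (N_ m)) (L m) <= rho ^+ m.
  by apply: le_trans (rhoN m); rewrite -lee_fin (prE _ (mL m)); have [] := conc (N_ m).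
have pWC m : pr (nu (N_ m)) [set z | W m (C_ m *m z)] = pr (nu P) (W m).
  rewrite /pr (@nu_gram _ _ _ P (C_ m) 1%:M)//; last by rewrite C_orth trmx1 mulmx1.
  by congr (fine (nu P _)); apply/seteqP; split => w /=; rewrite mul1mx.
have W0 : pr (nu P) (W m) @[m --> \oo] --> (0 : R).
  apply: (@pr_cvg0 _ _ _ (nu P) W set0 mW measurable0 (measure0 _)) => w _.
  apply: filterS (nbhs_infty_ger (sqnorm w / a)) => m hm; apply/negP; rewrite -leNgt.
  by rewrite mulrC -ler_pdivrMr.
have near_le : \forall m \near \oo, pr (nu (N_ m)) (B m) <= rho ^+ m + rho ^+ m + pr (nu P) (W m).
  apply: filterS (nbhs_infty_ger (P%:R * (1 + e') / (e' / 2))) => m hm.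
  have Nm : P%:R * (1 + e') <= (N_ m)%:R * (e' / 2).
    rewrite -ler_pdivrMr ?divr_gt0//; apply: (le_trans hm); rewrite ler_nat; exact: N_ge.
  apply: (@le_trans _ _ (pr (nu (N_ m)) (U m `|` L m) + pr (nu (N_ m)) [set z | W m (C_ m *m z)])).
    apply: (pr_leU (nu (N_ m)) (mB m) (measurableU _ _ (mU m) (mL m)) (mWC m)).
    move=> z; rewrite /B /= => hz.
    have [zU|/negP] := pselect (U m z); first by left; left.
    rewrite -ltNge => zU.
    have [zL|/negP] := pselect (L m z); first by left; right.
    rewrite -ltNge => zL.
    have [zW|/negP] := pselect (W m (C_ m *m z)); first by right.
    rewrite -leNgt => zW; exfalso.
    have zW' : sqnorm (C_ m *m z) <= a * (N_ m)%:R.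
      by apply: (le_trans zW); rewrite ler_pM2l// ler_nat N_ge.
    have w0 : 0 <= sqnorm (C_ m *m z) by rewrite sqnormE sumr_ge0// => i _; exact: sqr_ge0.
    move: hz; apply/negP; rewrite -leNgt /resid_ratio.
    have NP : 0 < (N_ m - P)%:R :> R by rewrite ltr0n subn_gt0.
    set v := _^-1 * _.
    have v1 : `|v - 1| <= e'.
      rewrite ler_norml; move: zU zL zW' w0 Nm; rewrite /v.
      move: (sqnorm z) (sqnorm (C_ m *m z)) => s t zU zL zW' w0 Nm.
      have nE : (N_ m - P)%:R = (N_ m)%:R - P%:R :> R by rewrite natrB// ltnW.
      have P0 : 0 <= P%:R :> R by [].
      have eP : 0 <= e' * P%:R by rewrite mulr_ge0// ltW.
      have -> : (N_ m - P)%:R^-1 * (s - t) - 1 = (s - t - (N_ m - P)%:R) / (N_ m - P)%:R.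
        by rewrite [RHS]mulrBl divff ?gt_eqF// mulrC.
      by rewrite ler_pdivlMr// ler_pdivrMr// nE; apply/andP; split; move: zU zL zW'; rewrite /a; lra.
    have v0 : 0 <= v by move: v1; rewrite ler_norml => /andP[]; lra.
    exact: le_trans (norm_sqrt_sub1 v0) (le_trans v1 e'e).
  rewrite pWC lerD2r; apply: (le_trans (pr_leU (nu (N_ m)) (measurableU _ _ (mU m) (mL m)) (mU m) (mL m) _)) => //.
  exact: lerD.
apply: (@squeeze_cvgr _ _ _ _ (cst 0) (fun m => rho ^+ m + rho ^+ m + pr (nu P) (W m))).
- by apply: filterS near_le => m ->; rewrite pr_ge0.
- exact: cvg_cst.
have rho_cvg : rho ^+ m @[m --> \oo] --> (0 : R) by apply: cvg_expr; rewrite ger0_norm.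
rewrite -[X in _ --> X]addr0; apply: seq_cvgD => //.
by rewrite -[X in _ --> X]addr0; exact: seq_cvgD.
Qed.

End VarianceConsistency.

(** * The limit distributions *)

Section NormalScale.
Variable R : realType.
Local Notation TR := (measurableTypeR R).
Local Notation mu := (@lebesgue_measure R).
Local Notation N01 := (@normal_prob R 0 1).

Lemma ge0_integral_dilate (s : R) (f : R -> \bar R) : 0 < s ->
  measurable_fun [set: R] f -> (forall x, 0 <= f x)%E ->
  (\int[mu]_x f x = \int[mu]_x (s%:E * f (s * x)%R))%E.
Proof.
move=> s0 mf f0.
have ms : measurable_fun setT ((fun x => s * x) : TR -> TR).
  by apply: measurable_funM => //; exact: measurable_cst.
have s0' : 0 <= s by exact: ltW.
pose mu1 := measure_function_pushforward__canonical__measure_function_Measure mu ms.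
pose mu' := mscale (NngNum s0') mu1.
have mu'E (A : set R) : measurable A -> mu A = mu' A.
  move=> mA; apply: (@lebesgue_measure_unique _ mu') => // _ [[b c]] _ <-.
  transitivity (s%:E * mu `](b / s)%R, (c / s)%R]%classic)%E; last first.
    suff <- : (fun x => s * x) @^-1` `]b, c]%classic = `]b / s, c / s]%classic by [].
    by apply/seteqP; split => x /=; rewrite !in_itv/= ltr_pdivrMr// ler_pdivlMr// mulrC.
  rewrite !lebesgue_measure_itv/= !lte_fin ltr_pM2r ?invr_gt0//; case: ifP => _; last by rewrite mule0.
  by rewrite -!EFinB -EFinM; congr EFin; field; rewrite gt_eqF.
transitivity (\int[mu']_x f x)%E.
  by apply: eq_measure_integral => A mA _; exact: mu'E.
rewrite ge0_integral_mscale// ge0_integral_pushforward// preimage_setT.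
rewrite -ge0_integralZl//; first exact: measurableT_comp.
by move=> x _; exact: f0.
Qed.

Lemma measurable_preimage_scale (s : R) (J : set R) : measurable J ->
  measurable [set x | J (s * x)].
Proof.
move=> mJ; have ms : measurable_fun [set: R] (fun x => s * x).
  by apply: measurable_funM => //; exact: measurable_cst.
by have := ms measurableT J mJ; rewrite setTI.
Qed.

Lemma normal_prob_scale (s : R) (J : set R) : 0 < s -> measurable J ->
  normal_prob 0 s J = N01 [set x | J (s * x)].
Proof.
move=> s0 mJ.
have mJs : measurable [set x | J (s * x)] by exact: measurable_preimage_scale.
have key (r : R) K : measurable K -> normal_prob 0 r K = (\int[mu]_x ((\1_K x)%:E * (normal_pdf 0 r x)%:E))%E.
  move=> mK; rewrite -ge0_integral_normal_prob; last 2 first.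
  - by apply/measurable_EFinP; exact: measurable_indic.
  - by move=> x; rewrite lee_fin.
  by rewrite (@integral_indic _ TR R (normal_prob 0 r) setT measurableT K mK) setIT.
rewrite (key s J mJ) (key 1 _ mJs) (ge0_integral_dilate s0); last 2 first.
- apply: emeasurable_funM; apply/measurable_EFinP; first exact: measurable_indic.
  exact: measurable_normal_pdf.
- by move=> x; rewrite mule_ge0// lee_fin ?normal_pdf_ge0.
apply: eq_integral => x _; rewrite -!EFinM; congr EFin; rewrite mulrCA.
have -> : \1_J (s * x) = \1_[set x | J (s * x)] x :> R.
  by rewrite !indicE; congr (_%:R); congr nat_of_bool.
congr (_ * _); rewrite normal_pdf01 normal_pdfE ?gt_eqF// mulrA.
have -> : normal_peak 1 = s * normal_peak s.
  rewrite /normal_peak expr1n mul1r -mulrnAr sqrtrM ?sqr_ge0//.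
  by rewrite sqrtr_sqr gtr0_norm// invfM mulrA divff ?mul1r// gt_eqF.
congr (_ * expR _); rewrite subr0 -mulr_natr exprMn.
by field; rewrite gt_eqF.
Qed.

Lemma N01_oppr (J : set R) : measurable J -> N01 [set x | J (- x)] = N01 J.
Proof.
move=> mJ.
have mJs : measurable [set x | J (- x)].
  have ms : measurable_fun [set: R] (fun x => - x) by exact: oppr_measurable.
  by have := ms measurableT J mJ; rewrite setTI.
have key K : measurable K -> N01 K = (\int[N01]_x (\1_K x)%:E)%E.
  by move=> mK; rewrite (@integral_indic _ TR R N01 setT measurableT K mK) setIT.
rewrite !key// -[RHS]ge0_normal_oppr; last 2 first.
- by apply/measurable_EFinP; exact: measurable_indic.
- by move=> x; rewrite lee_fin.
by apply: eq_integral => x _; rewrite !indicE; congr (_%:R%:E); congr nat_of_bool.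
Qed.

(** One formula covers the point mass at [s = 0] and the proper normal law; the change of sign of
    [a] is the symmetry of N(0, 1). *)
Lemma DeltaE (s a b : R) : 0 <= s -> Delta s a b = fine (N01 [set x : R | `|s * x + a| < b]).
Proof.
move=> s0; rewrite /Delta.
have [->|sn0] := eqVneq s 0.
  have -> : [set x : R | `|0 * x + a| < b] = [set x | `|a| < b].
    by apply/seteqP; split => x /=; rewrite mul0r add0r.
  rewrite diracE; have [ab|ab] := boolP (`|a| < b).
    have -> : [set x : R | true] = setT by apply/seteqP; split.
    by rewrite mem_set/= ?sub0r ?normrN// probability_setT.
  have -> : [set x : R | false] = set0 by apply/seteqP; split.
  rewrite measure0 memNset//=; rewrite sub0r normrN; exact/negP.
have sp : 0 < s by rewrite lt_def sn0.
have mJ : measurable [set x : R | `|x - a| < b] by exact: measurable_lt_norm.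
rewrite normal_prob_scale// -N01_oppr//; last exact: (measurable_preimage_scale s mJ).
congr (fine (N01 _)); apply/seteqP; split => x /=;
  by rewrite mulrN -opprD normrN.
Qed.

End NormalScale.

(** * Conditioning a Gaussian coordinate on a linear image *)

Section GaussianTail.
Variable R : realType.
Local Notation TR := (measurableTypeR R).
Local Notation N01 := (@normal_prob R 0 1).
Local Notation nu := (@std_normal_cv R).

(** The first coordinate is integrated innermost, as is required for conditioning on the remaining
    ones. *)
Lemma nuS_swap n (E : set 'cV[R]_n.+1) : measurable E ->
  nu n.+1 E = (\int[nu n]_y N01 [set x | E (cons_cv x y)])%E.
Proof.
move=> mE; rewrite nuS//.
pose S : set (TR * 'cV[R]_n) := [set z | E (cons_cv (z.1 : R) z.2)].
have mS : measurable S by have := @measurable_cons_cv R n measurableT E mE; rewrite setTI.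
have mf : measurable_fun setT (EFin \o (\1_S : TR * 'cV[R]_n -> R)).
  by apply/measurable_EFinP; exact: measurable_indic.
have f0 (x : TR * 'cV[R]_n) : (0 <= (EFin \o (\1_S : TR * 'cV[R]_n -> R)) x)%E by rewrite lee_fin.
have H := @fubini_tonelli _ _ TR 'cV[R]_n R N01 (nu n) (EFin \o \1_S) mf f0.
transitivity (\int[N01]_x \int[nu n]_y ((\1_S (x, y) : R)%:E))%E.
  apply: eq_integral => x _; rewrite -[X in nu n X]setIT -integral_indic//.
  exact: measurable_cons_section.
rewrite [LHS]H; apply: eq_integral => y _; rewrite -[X in N01 X]setIT -integral_indic//.
have := @measurable_ysection _ _ TR 'cV[R]_n S y mS; congr measurable.
by apply/seteqP; split => x; rewrite /ysection/= => h; [exact: (set_mem h)|exact/mem_set].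
Qed.

Lemma measurable_N01_section n (E : set 'cV[R]_n.+1) : measurable E ->
  measurable_fun [set: 'cV[R]_n] (fun y => N01 [set x | E (cons_cv x y)]).
Proof.
move=> mE.
pose S : set (TR * 'cV[R]_n) := [set z | E (cons_cv (z.1 : R) z.2)].
have mS : measurable S by have := @measurable_cons_cv R n measurableT E mE; rewrite setTI.
have := @measurable_fun_ysection _ _ TR 'cV[R]_n R N01 S mS.
congr measurable_fun; apply/funext => y; congr (N01 _).
by apply/seteqP; split => x; rewrite /ysection/= => h; [exact: (set_mem h)|exact/mem_set].
Qed.

Lemma ge0_integral_gaussian n (S : 'M[R]_n) (D : set 'cV[R]_n) (f : 'cV[R]_n -> \bar R) :
  measurable D -> measurable_fun setT f -> (forall z, 0 <= f z)%E ->
  (\int[gaussian S]_(z in D) f z =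
   \int[nu n]_(y in [set y | D (root_mx S *m y)]) f (root_mx S *m y))%E.
Proof.
move=> mD mf f0.
have mr : measurable_fun [set: 'cV[R]_n] (fun z : 'cV[R]_n => root_mx S *m z) by exact: measurable_mulmx.
rewrite -(@ge0_integral_pushforward _ _ _ _ R _ mr (nu n) D f mD (measurable_funTS mf) (fun z _ => f0 z)).
by apply: eq_measure_integral => //= E mE _; exact: gaussianE.
Qed.

Lemma mulmx_tr_eq0 m n (Z : 'M[R]_(m, n)) : Z^T *m Z = 0 -> Z = 0.
Proof.
move=> ZZ; apply/matrixP => i j; rewrite [RHS]mxE.
have := congr1 (fun M : 'M[R]_n => M j j) ZZ; rewrite !mxE.
under eq_bigr do rewrite mxE -expr2.
move=> /eqP; rewrite psumr_eq0; last by move=> l _; rewrite sqr_ge0.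
by move=> /allP/(_ i); rewrite mem_index_enum => /(_ isT); rewrite /= sqrf_eq0 => /eqP.
Qed.

(** The difference [Z] of the two sides satisfies [B *m Z = 0], and [Z^T *m Z] is a multiple of
    [B *m Z]; hence [Z = 0]. The singular case is included, which a plain inverse would not
    allow. *)
Lemma ginv_gram m n (B : 'M[R]_(m, n)) (G : 'M[R]_m) :
  is_ginv (B *m B^T) G -> B^T *m G *m (B *m B^T) = B^T.
Proof.
move=> hG; apply/eqP; rewrite -subr_eq0; apply/eqP.
have Z0 : B *m (B^T *m G *m (B *m B^T) - B^T) = 0.
  by rewrite mulmxBr !mulmxA -(mulmxA (_ *m G)) hG subrr.
apply: mulmx_tr_eq0.
have -> : (B^T *m G *m (B *m B^T) - B^T)^T *m (B^T *m G *m (B *m B^T) - B^T) =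
  ((B *m B^T) *m G^T - 1%:M) *m (B *m (B^T *m G *m (B *m B^T) - B^T)).
  rewrite [in RHS]mulmxA; congr (_ *m _).
  rewrite linearB/= !trmx_mul !trmxK mulmxBl mul1mx; congr (_ - _).
  by rewrite !mulmxA.
by rewrite Z0 mulmx0.
Qed.

Lemma measurable_orthant k (t : 'cV[R]_k) : measurable (orthant t).
Proof.
apply: measurable_forall_fin => j; apply: measurable_le_fun; last exact: measurable_cst.
exact: measurable_entry.
Qed.

(* The pair (l w, B w) is jointly Gaussian; given B w = z, its first component is
   normal with mean b z and variance zeta^2. *)
Lemma conditional_tail k n (B : 'M[R]_(k, n)) (l : 'rV[R]_n) (b : 'rV[R]_k)
    (zeta m d : R) (t : 'cV[R]_k) : 0 <= zeta ->
  b *m (B *m B^T) = l *m B^T -> zeta ^+ 2 + (b *m (B *m B^T) *m b^T) 0 0 = (l *m l^T) 0 0 ->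
  pr (nu n) [set w | (forall j, (B *m w) j 0 <= t j 0) /\ d <= `|(l *m w) 0 0 + m|] =
  (\int[gaussian (B *m B^T)]_(z in orthant t) (1 - Delta zeta (m + (b *m z) 0 0) d))%R.
Proof.
move=> zeta0 bB zb.
pose E := [set u : 'cV[R]_k.+1 | (forall j, u (lift ord0 j) 0 <= t j 0) /\ d <= `|u ord0 0 + m|].
have mE : measurable E.
  apply: measurableI; last exact: (measurable_coord ord0 (measurable_ge_norm m d)).
  apply: measurable_forall_fin => j; apply: measurable_le_fun; last exact: measurable_cst.
  exact: measurable_entry.
pose B1 := @col_mx R 1 k n l B.
pose rt := root_mx (B *m B^T).
(* By equality of Gram matrices, [(l w, B w)] has the law of [(zeta x + b rt y, rt y)] with
   independent standard normal [x] and [y]. Integrating over [x] for fixed [y] gives the conditional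
   probability. *)
pose B2 := @block_mx R 1 k 1 k zeta%:M (b *m rt) 0 rt.
have BB : B1 *m B1^T = B2 *m B2^T.
  rewrite /B1 /B2 (@tr_col_mx _ 1 k) mul_col_row tr_block_mx mulmx_block.
  rewrite !trmx0 !mulmx0 !mul0mx !add0r trmx_mul !mulmxA.
  rewrite -[b *m rt *m _]mulmxA -[rt *m _]/(root_mx _ *m _) root_mxP.
  have bB' : l *m B^T = b *m B *m B^T by rewrite -bB mulmxA.
  have zb' : l *m l^T = (zeta * zeta)%:M + b *m B *m B^T *m b^T.
    rewrite [LHS]mx11_scalar -zb raddfD/= -expr2; congr (_ + _).
    by rewrite -mx11_scalar !mulmxA.
  congr block_mx; rewrite ?tr_scalar_mx -?scalar_mxM ?mulmxA //.
  by rewrite -[LHS]trmxK trmx_mul trmxK bB' !trmx_mul trmxK mulmxA.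
rewrite /pr.
have -> : [set w | (forall j, (B *m w) j 0 <= t j 0) /\ d <= `|(l *m w) 0 0 + m|] = [set w | E (B1 *m w)].
  have B1E w : B1 *m w = cons_cv ((l *m w) 0 0) (B *m w).
    rewrite /B1 mul_col_mx; apply/matrixP => i j; rewrite ord1; have [q ->|->] := unliftP ord0 i.
      rewrite cons_cvS (_ : lift ord0 q = rshift 1 q); last exact/val_inj.
      exact: (@col_mxEd R 1 k 1).
    rewrite cons_cv0 (_ : ord0 = lshift k (ord0 : 'I_1)); last exact/val_inj.
    by apply: (etrans (@col_mxEu R 1 k 1 _ _ _ _)); rewrite !ord1.
  by apply/seteqP; split => w; rewrite /E /= B1E cons_cv0 => -[h1 h2]; split => // j;
    have := h1 j; rewrite cons_cvS.
rewrite (nu_gram BB mE).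
rewrite nuS_swap; last exact: measurable_preimage_mulmx.
rewrite /Rintegral; congr fine.
have mE' : measurable [set u : 'cV[R]_k.+1 | d <= `|(@row_mx R 1 1 k zeta%:M b *m u) 0 0 + m|].
  have := measurable_preimage_mulmx (@row_mx R 1 1 k zeta%:M b) (measurable_coord 0 (measurable_ge_norm m d)).
  by [].
have mf : measurable_fun setT (fun z : 'cV[R]_k => N01 [set x | d <= `|(zeta * x + (b *m z) 0 0) + m|]).
  have := measurable_N01_section mE'; congr measurable_fun; apply/funext => z; congr (N01 _).
  by apply/seteqP; split => x /=; rewrite mul_block_cons !mxE eqxx mulr1n mulrC.
have cplE (z : 'cV[R]_k) : N01 [set x : R | d <= `|(zeta * x + (b *m z) 0 0) + m|] =
    (1 - Delta zeta (m + (b *m z) 0 0) d)%:E.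
  have ml : measurable [set x : R | `|zeta * x + (m + (b *m z) 0 0)| < d].
    exact: (measurable_preimage_scale zeta (measurable_lt_norm (m + (b *m z) 0 0) d)).
  rewrite DeltaE// EFinB fineK ?fin_num_measure//.
  rewrite -(@probability_setC _ _ _ N01 _ ml); congr (N01 _).
  by apply/seteqP; split => x /=; rewrite addrAC addrA leNgt => /negP.
transitivity (\int[gaussian (B *m B^T)]_(z in orthant t) N01 [set x : R | (d <= `|(zeta * x + (b *m z) 0 0) + m|)%R])%E; last first.
  by apply: eq_integral => z _; rewrite cplE.
rewrite ge0_integral_gaussian//; last exact: measurable_orthant.
rewrite [RHS]integral_mkcond; apply: eq_integral => y _; rewrite /patch.
case: ifPn => [/set_mem/= h|/negP h].
  congr (N01 _); apply/seteqP; split => x; rewrite /= mul_cons_block /E /= cons_cv0.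
    by case=> _; rewrite mulmxA.
  by rewrite mulmxA => h2; split => // j; rewrite cons_cvS scaler0 add0r; exact: h.
rewrite (_ : [set x | _] = set0) ?measure0//; apply/seteqP; split => x //=.
rewrite mul_cons_block /E /= => -[h1 _]; apply: h; apply/mem_set => j /=.
by have := h1 j; rewrite cons_cvS scaler0 add0r.
Qed.

End GaussianTail.

(** * Evaluation of the limiting probabilities *)

Section LimitFormula.
Variables (R : realType) (P : nat) (Q : 'M[R]_P) (c : nat -> R).
Variables (psi : 'I_P -> \bar R) (s : R).
Hypothesis pQ : posdef Q.
Hypothesis s_gt0 : 0 < s.
Local Notation N01 := (@normal_prob R 0 1).
Local Notation nu := (@std_normal_cv R).

Definition mean_ratio (i : 'I_P) : R := mean_limit Q psi (bsize i) / (s * xi Q i).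

Lemma xi_infE i : xi_inf Q (bsize i) = xi Q i.
Proof. by rewrite /xi_inf /xi diag1_emb /padinv -lock. Qed.

Lemma scale_norm_mean i x : `|s * xi Q i * x + mean_limit Q psi (bsize i)| = s * xi Q i * `|x + mean_ratio i|.
Proof.
have sx : 0 < s * xi Q i by rewrite mulr_gt0// xi_gt0.
rewrite -{2}[s * xi Q i]gtr0_norm// -normrM mulrDr /mean_ratio; congr `|_ + _|.
by rewrite mulrC divfK// gt_eqF.
Qed.

Lemma Delta_xiE i : Delta_xi Q c psi s (bsize i) =
  fine (N01 [set x | `|x + mean_ratio i| < c i.+1]).
Proof.
have sx : 0 < s * xi Q i by rewrite mulr_gt0// xi_gt0.
rewrite /Delta_xi xi_infE bsizeE DeltaE; last exact: ltW.
congr (fine (N01 _)); apply/seteqP; split => x /=;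
  by rewrite scale_norm_mean -[c _ * _ * _]mulrA [c _ * _]mulrC ltr_pM2l.
Qed.

Lemma stay_prodE (p : 'I_P.+1) : stay_prod Q c psi s p =
  \prod_(i < P | (p < i.+1)%N) fine (N01 [set x | `|x + mean_ratio i| < c i.+1]).
Proof.
rewrite /stay_prod big_mkcond big_ord_recl [X in X * _ = _]/= mul1r -big_mkcond.
by apply: eq_big => [i|i _]; rewrite ?Delta_xiE// bsizeE.
Qed.

Section Regions.
Variables (k : nat) (p : 'I_P.+1) (a : 'cV[R]_k) (B : 'M[R]_(k, P)).
Local Notation V := (fun w : 'cV[R]_P => a + B *m trunc R p *m w).

(** The factor of [region] at [e = 0] that involves only the first [p] coordinates; the remaining
    constraints, one for each later coordinate, split off by independence. *)
Definition fit_event (chk : bool) (t : 'cV[R]_k) : set 'cV[R]_P :=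
  [set w | (forall j, V w j 0 <= t j 0) /\
     forall i : 'I_P, i.+1 = p -> chk -> c p <= `|w i 0 + mean_ratio i|].

Lemma measurable_fit_event chk t : measurable (fit_event chk t).
Proof.
apply: measurableI.
  apply: measurable_forall_fin => j; apply: measurable_le_fun; last exact: measurable_cst.
  apply: measurable_entry_comp; apply: measurable_fun_mx => i l.
  rewrite (_ : (fun _ => _) = fun w : 'cV[R]_P => a i l + (B *m trunc R p *m w) i l); last first.
    by apply/funext => w; rewrite mxE.
  apply: measurable_funD; first exact: measurable_cst.
  by apply: measurable_entry_comp; exact: measurable_mulmx.
apply: measurable_forall_fin => i; apply: measurable_imply => _; apply: measurable_imply => _.
exact: (measurable_coord i (measurable_ge_norm (mean_ratio i) (c p))).
Qed.

Lemma pr_region chk t : pr (nu P) (region c p chk V mean_ratio 0 t) =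
  pr (nu P) (fit_event chk t) * stay_prod Q c psi s p.
Proof.
rewrite stay_prodE /pr.
pose r := seq.filter (fun i : 'I_P => (p < i.+1)%N) (index_enum 'I_P).
pose J (i : 'I_P) := [set x : R | `|x + mean_ratio i| < c i.+1].
have mJ i : measurable (J i) by exact: measurable_lt_norm.
have ur : uniq r by rewrite filter_uniq// index_enum_uniq.
have fr i : i \in r -> free_coord i (fit_event chk t).
  rewrite mem_filter => /andP[pi _] w w' ww' [h1 h2]; split => [j|j jp ck].
    have := h1 j; suff -> : B *m trunc R p *m w = B *m trunc R p *m w' by [].
    rewrite -!mulmxA; congr (_ *m _); apply/matrixP => l m; rewrite !trunc_mulE ord1.
    by case: ltnP => // lp; apply: ww'; apply: contraTneq lp => ->; rewrite -leqNgt.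
  rewrite -ww'; first exact: h2.
  by apply: contraTneq pi => <-; rewrite jp ltnn.
have := nu_indep_coords ur (measurable_fit_event chk t) fr mJ.
rewrite big_filter => <-; congr (fine (nu P _)).
apply/seteqP; split => w /=.
  move=> [h1 h2 h3]; split; first split.
  - by move=> j; rewrite -[t j 0]addr0; exact: h1.
  - by move=> i ip ck; have := h2 i ip ck; rewrite subr0 mulr1.
  - move=> i; rewrite mem_filter => /andP[pi _]; have := h3 i pi.
    by rewrite addr0 mulr1.
move=> [[h1 h2] h3]; split.
- by move=> j; rewrite addr0; exact: h1.
- by move=> i ip ck; rewrite subr0 mulr1; exact: h2.
- by move=> i pi; rewrite addr0 mulr1; apply: h3; rewrite mem_filter pi mem_index_enum.
Qed.

End Regions.

(** For standard normal [w], [b *m (B *m w)] is the linear regression of [f^T *m w] on [B *m w]. The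
    last quantity is the squared norm of the residual [f - B^T *m b^T]; its sign ensures that the
    square root in [zeta_inf] is that of a nonnegative number. *)
Lemma regression_split k n (B : 'M[R]_(k, n)) (G : 'M[R]_k) (f : 'cV[R]_n) :
  let b := (B *m f)^T *m G in is_ginv (B *m B^T) G ->
  [/\ b *m (B *m B^T) = f^T *m B^T, b *m (B *m f) = f^T *m B^T *m b^T &
    0 <= (f^T *m f) 0 0 - (b *m (B *m f)) 0 0].
Proof.
move=> b hG.
have bA : b *m (B *m B^T) = f^T *m B^T.
  by rewrite /b trmx_mul -!mulmxA [B^T *m _]mulmxA (ginv_gram hG).
have bC : b *m (B *m f) = f^T *m B^T *m b^T.
  have <- : (b *m (B *m f))^T = b *m (B *m f) by rewrite [b *m _]mx11_scalar tr_scalar_mx.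
  by rewrite trmx_mul trmx_mul.
clearbody b; split => //.
pose h : 'cV[R]_n := f - B^T *m b^T.
have h0 : 0 <= sqnorm h by rewrite sqnormE sumr_ge0// => j _; exact: sqr_ge0.
suff -> : (f^T *m f) 0 0 - (b *m (B *m f)) 0 0 = sqnorm h by [].
have hT : h^T = f^T - b *m B by rewrite -[b in RHS]trmxK -[B in RHS]trmxK -trmx_mul -linearB.
have bBb : b *m B *m (B^T *m b^T) = f^T *m (B^T *m b^T) by rewrite !mulmxA -bA !mulmxA.
have hE : h^T *m h = f^T *m f - b *m (B *m f).
  by rewrite hT /h mulmxBl !mulmxBr bBb opprB addrA subrK -mulmxA.
by rewrite /sqnorm hE !mxE.
Qed.

Variables (k : nat) (A : 'M[R]_(k, P)) (ginv : 'I_P.+1 -> 'M[R]_k).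
Hypothesis ginvP : forall p : 'I_P.+1, (0 < p)%N -> is_ginv (Acov Q A p) (ginv p).

Definition half_cov (p : 'I_P.+1) : 'M[R]_(k, P) := A *m (whiten Q)^T *m trunc R p.

Definition limit_fit (p : 'I_P.+1) (w : 'cV[R]_P) : 'cV[R]_k :=
  A *m delta Q psi p + (s *: (A *m (whiten Q)^T)) *m trunc R p *m w.

Lemma trunc_idem p : trunc R p *m trunc R p = trunc R p :> 'M[R]_P.
Proof. by apply/matrixP => i j; rewrite trunc_mulE !mxE; case: (i < p)%N; rewrite ?andbF. Qed.

Lemma half_cov_gram p : half_cov p *m (half_cov p)^T = Acov Q A p.
Proof.
rewrite /half_cov !trmx_mul trmxK trunc_tr -!mulmxA (mulmxA (trunc R p)) trunc_idem.
rewrite (mulmxA (trunc R p)) (mulmxA _^T) (mulmxA _^T) whiten_padinv//.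
by rewrite /padinv -lock /Acov !firstcolsE trmx_mul !mulmxA.
Qed.

(** Up to the variance, [Cinf] is the covariance between the limiting fit [half_cov *m w] and the
    noise [xi Q i * w i 0] of the last component included. *)
Lemma CinfE i : Cinf Q A (bsize i) = half_cov (bsize i) *m (xi Q i *: delta_mx i 0).
Proof.
have -> : xi Q i *: delta_mx i 0 = trunc R (bsize i) *m whiten Q *m delta_mx i 0 :> 'cV[R]_P.
  apply/matrixP => j l; rewrite ord1 -colE [RHS]mxE trunc_mulE bsizeE ltnS [LHS]mxE [X in _ * X]mxE eqxx andbT.
  have [->|ji] := eqVneq j i; first by rewrite leqnn mulr1 whiten_diag.
  rewrite mulr0; case: leqP => // le.
  by rewrite whiten_upper// ltn_neqAle le andbT.
rewrite /half_cov -!mulmxA (mulmxA (trunc R _)) trunc_idem.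
rewrite (mulmxA (trunc R _)) (mulmxA _^T) (mulmxA _^T) whiten_padinv//.
rewrite /padinv -lock /Cinf !firstcolsE -!mulmxA; do 3 congr (_ *m _).
by apply/matrixP => a b; rewrite emb_tr_mul !mxE ord1 eqxx andbT -(inj_eq val_inj).
Qed.

Lemma fit_leE p (w : 'cV[R]_P) (t : 'cV[R]_k) j :
  ((A *m delta Q psi p + (s *: (A *m (whiten Q)^T)) *m trunc R p *m w) j 0 <= t j 0) =
  (((s *: half_cov p) *m w) j 0 <= (t - A *m delta Q psi p) j 0).
Proof.
rewrite /half_cov !scalemxAl; move: (A *m delta _ _ _) (_ *m w) => u v.
by rewrite !mxE lerBrDl.
Qed.

Lemma pr_head (p : 'I_P.+1) t :
  pr (nu P) (region c p false (limit_fit p) mean_ratio 0 t) =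
  Phi_cdf Q A s p (t - A *m delta Q psi p) * stay_prod Q c psi s p.
Proof.
rewrite pr_region; congr (_ * _).
rewrite /Phi_cdf /Phi (@gaussian_gram _ _ _ _ (s *: half_cov p)); last exact: measurable_orthant.
  congr fine; congr (nu P _); apply/seteqP; split => w; rewrite /fit_event /= /orthant /=.
    by move=> [h _] j; have := h j; rewrite fit_leE.
  by move=> h; split => // j; rewrite fit_leE; exact: h.
by rewrite -half_cov_gram linearZ/= -scalemxAr -scalemxAl scalerA expr2.
Qed.

(** After multiplication by [s * xi Q i] the test of coordinate [i] concerns [s *: f^T *m w], the
    form treated by [conditional_tail]; [regression_split] supplies the covariance identities. *)
Lemma pr_tail i t :
  pr (nu P) (region c (bsize i) true (limit_fit (bsize i)) mean_ratio 0 t) =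
  tail_term Q A c ginv psi s (bsize i) t.
Proof.
rewrite pr_region; congr (_ * _); set p := bsize i.
pose f : 'cV[R]_P := xi Q i *: delta_mx i 0.
pose Bc := half_cov p.
have ff : f^T *m f = (xi Q i ^+ 2)%:M.
  apply/matrixP => a b; rewrite !ord1 mxE (bigD1 i)//= big1 => [|j ji].
    by rewrite !mxE !eqxx !mulr1 addr0 mulr1n expr2.
  by rewrite !mxE (negbTE ji) !mulr0.
have hG : is_ginv (Bc *m Bc^T) (ginv p) by rewrite half_cov_gram; exact: ginvP.
have [bA bC zz] := regression_split f hG.
have CE : (Bc *m f)^T *m ginv p = b_inf Q A ginv p by rewrite /b_inf CinfE.
rewrite {}CE in bA bC zz.
have CE : Bc *m f = Cinf Q A p by rewrite CinfE.
rewrite {}CE ff [X in _ <= X - _]mxE eqxx mulr1n in bC zz.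
have zeta_sqr : zeta_inf Q A ginv p ^+ 2 = xi Q i ^+ 2 - (b_inf Q A ginv p *m Cinf Q A p) 0 0.
  by rewrite /zeta_inf xi_infE sqr_sqrtr.
have zeta0 : 0 <= s * zeta_inf Q A ginv p by rewrite mulr_ge0 ?sqrtr_ge0// ltW.
rewrite /Phi -half_cov_gram.
have -> : s ^+ 2 *: (half_cov p *m (half_cov p)^T) = (s *: Bc) *m (s *: Bc)^T.
  by rewrite linearZ/= -scalemxAr -scalemxAl scalerA expr2.
rewrite -(@conditional_tail _ _ _ (s *: Bc) (s *: f^T)) //.
- have chkE (w : 'cV[R]_P) : (c p * s * xi_inf Q p <= `|((s *: f^T) *m w) 0 0 + mean_limit Q psi p|) =
      (c p <= `|w i 0 + mean_ratio i|).
    have -> : ((s *: f^T) *m w) 0 0 = s * xi Q i * w i 0.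
      rewrite mxE (bigD1 i)//= big1 => [|j ji]; last by rewrite !mxE (negbTE ji) !mulr0 mul0r.
      by rewrite !mxE !eqxx mulr1 addr0.
    by rewrite scale_norm_mean xi_infE -mulrA [c _ * _]mulrC ler_pM2l// mulr_gt0// xi_gt0.
  congr (pr (nu P) _); rewrite /fit_event; apply/seteqP; split => w /=.
    move=> [h1 h2]; split => [j|]; first by rewrite -fit_leE; exact: h1.
    by rewrite chkE; apply: h2.
  move=> [h1 h2]; split => [j|j jp _]; first by rewrite fit_leE; exact: h1.
  have -> : j = i by apply/val_inj/succn_inj.
  by rewrite -chkE.
- by rewrite linearZ/= -!scalemxAr -!scalemxAl -!scalemxAr bA.
- have -> : (s *: Bc) *m (s *: Bc)^T = s ^+ 2 *: (Bc *m Bc^T).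
    by rewrite linearZ/= -scalemxAr -scalemxAl scalerA expr2.
  rewrite -scalemxAr -scalemxAl bA [(s *: f^T)^T]linearZ/= trmxK.
  rewrite -scalemxAr scalerA ff -scalemxAl [X in _ + X]mxE [RHS]mxE [in RHS]mxE eqxx mulr1n exprMn zeta_sqr bC.
  by ring.
Qed.

Section Selection.
Variables (a : 'cV[R]_0) (B : 'M[R]_(0, P)) (t : 'cV[R]_0).
Local Notation V p := (fun w : 'cV[R]_P => a + B *m trunc R p *m w).

(** A fit without coordinates imposes no constraint, so only the tests remain. *)
Lemma pr_head_selection (p : 'I_P.+1) :
  pr (nu P) (region c p false (V p) mean_ratio 0 t) = stay_prod Q c psi s p.
Proof.
rewrite pr_region (_ : fit_event _ _ _ _ _ = setT) ?pr_setT ?mul1r//.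
by apply/seteqP; split => w //= _; split => // -[].
Qed.

Lemma pr_tail_selection i :
  pr (nu P) (region c (bsize i) true (V (bsize i)) mean_ratio 0 t) =
  (1 - Delta_xi Q c psi s (bsize i)) * stay_prod Q c psi s (bsize i).
Proof.
rewrite pr_region; congr (_ * _); rewrite Delta_xiE.
have mJ : measurable [set x : R | `|x + mean_ratio i| < c i.+1] by exact: measurable_lt_norm.
have -> : fit_event (bsize i) a B true t =
    [set w | (~` [set x : R | `|x + mean_ratio i| < c i.+1]) (w i 0)].
  apply/seteqP; split => w /=.
    by move=> [_ h]; apply/negP; rewrite -leNgt; exact: h.
  move=> /negP; rewrite -leNgt => h; split=> [[]//|j ji _].
  by rewrite (_ : j = i)//; exact/val_inj/succn_inj.
rewrite /pr nu_coord ?probability_setC//; last exact: measurableC.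
by rewrite -[in LHS](fineK (fin_num_measure N01 _ mJ)).
Qed.

End Selection.
End LimitFormula.

(** * Subsequences and limits of distribution functions *)

Section Subsequences.
Variable R : realType.

Lemma increasing_seq_comp (f g : nat -> nat) :
  increasing_seq f -> increasing_seq g -> increasing_seq (f \o g).
Proof. by move=> hf hg m n; rewrite -(hg m n); exact: hf. Qed.

Lemma increasing_seq_ge (f : nat -> nat) : increasing_seq f -> forall n, (n <= f n)%N.
Proof.
move=> hf; elim=> // n IH; apply: (leq_ltn_trans IH).
by rewrite ltnNge; have := hf n.+1 n; rewrite leEnat => ->; rewrite ltnn.
Qed.

Lemma increasing_seq_cvg (f : nat -> nat) : increasing_seq f -> f m @[m --> \oo] --> \oo.
Proof.
move=> hf B [N _ NB]; exists N => // m /= Nm; apply: NB => /=.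
exact: leq_trans (increasing_seq_ge hf m).
Qed.

Lemma subseq_cvg (T : topologicalType) (u : nat -> T) (l : T) (f : nat -> nat) :
  increasing_seq f -> u m @[m --> \oo] --> l -> u (f m) @[m --> \oo] --> l.
Proof. by move=> hf ul; exact: cvg_comp (increasing_seq_cvg hf) ul. Qed.

(** [contract] identifies the extended reals with [-1, 1], and their metric is the one transported
    by it, so the bounded real case applies. *)
Lemma ereal_bolzano_weierstrass (u : nat -> \bar R) :
  exists2 f, increasing_seq f & exists l : \bar R, u (f m) @[m --> \oo] --> l.
Proof.
have bu : bounded_fun (fun n => contract (u n) : R^o).
  exists 1; split; first exact: num_real.
  by move=> x x1 n _ /=; apply: (le_trans (contract_le1 _)); exact: ltW.
have [f incf cf] := bolzano_weierstrass bu.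
exists f => //; exists (expand (limn (fun n => contract (u (f n)) : R^o))).
set c := limn _ in cf *.
have c1 : `|c| <= 1.
  rewrite ler_norml; apply/andP; split; [apply: limr_ge|apply: limr_le] => //;
    by apply: nearW => n; have := contract_le1 (u (f n)); rewrite ler_norml => /andP[].
apply/cvg_ballP => e e0; rewrite /ball /= /ereal_ball expandK ?inE//.
move/cvgrPdist_lt : cf => /(_ e e0).
by [].
Qed.

Lemma params_subsequence P (theta : nat -> 'cV[R]_P) (sigma : nat -> R) (slo shi : R) (phi : nat -> nat) :
  (forall n, (P < n)%N -> slo <= sigma n <= shi) -> increasing_seq phi ->
  exists (chi : nat -> nat) (psi : 'I_P -> \bar R) (s : R),
    [/\ increasing_seq chi, params_cvg theta sigma (phi \o chi) psi s, slo <= s <= shi & forall m, (P < phi (chi m))%N].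
Proof.
move=> sb hphi.
pose u i n := (Num.sqrt (phi n)%:R * theta (phi n) i 0)%:E.
have [chi hchi cchi] : exists2 chi, increasing_seq chi &
    forall i, i \in enum 'I_P -> exists l : \bar R, u i (chi m) @[m --> \oo] --> l.
  elim: (enum 'I_P) => [|i r [chi hchi H]]; first by exists id.
  have [f hf [l fl]] := ereal_bolzano_weierstrass (u i \o chi).
  exists (chi \o f); first exact: increasing_seq_comp.
  move=> j; rewrite inE => /orP[/eqP ->|jr]; first by exists l.
  by have [l' hl'] := H j jr; exists l'; exact: (subseq_cvg hf hl').
(* The limit is taken in the extended reals too; the bounds on [sigma] then force it to be
   finite. *)
have [f hf [l fl]] := ereal_bolzano_weierstrass (fun n => (sigma (phi (chi n)))%:E).
have /choice[psi hpsi] : forall i, exists l : \bar R, u i (chi (f m)) @[m --> \oo] --> l.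
  by move=> i; have [|l' hl'] := cchi i; rewrite ?mem_enum//; exists l'; exact: (subseq_cvg hf hl').
have hcf : increasing_seq (chi \o f) by exact: increasing_seq_comp.
have ev : \forall n \near \oo, slo <= sigma (phi (chi (f n))) <= shi.
  exists P.+1 => // n /= Pn; apply: sb; apply: (leq_trans Pn).
  by rewrite (leq_trans (increasing_seq_ge hcf n))// increasing_seq_ge.
have ll : (slo%:E <= l <= shi%:E)%E.
  by apply/andP; split; [apply: (cvge_ge _ fl)|apply: (cvge_le _ fl)];
    apply: filterS ev => n /andP[]; rewrite lee_fin.
have [s ls] : exists s, l = s%:E.
  case: l {fl} ll => [s _|/andP[_]|/andP[]]; [by exists s|by rewrite leye_eq|by rewrite leeNy_eq].
rewrite {}ls in fl ll; have [_ cs] := proj1 (fine_cvgP _ _) fl.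
(* The shift puts every sample size of the subsequence above [P], where the rank and variance
   assumptions apply. *)
have hsh : increasing_seq (addn P.+1) by move=> m n; rewrite leEnat leq_add2l.
have hcfs : increasing_seq (chi \o f \o addn P.+1) by exact: increasing_seq_comp.
exists (chi \o f \o addn P.+1), psi, s; split => //.
- split; first by move=> i; exact: (subseq_cvg hsh (hpsi i)).
  exact: (subseq_cvg hsh cs).
- move=> m; apply: (@leq_trans (P.+1 + m)); first exact: leq_addr.
  by rewrite (leq_trans (increasing_seq_ge hcf _))// increasing_seq_ge.
Qed.

End Subsequences.

(** * Continuity points of monotone functions and of cdfs *)

Section MonotoneContinuity.
Variable R : realType.

(** A monotone function has countably many discontinuities, and a nonempty open interval is not a
    null set. Continuity is stated as a small increment, the form in which it lifts to [k]
    dimensions. *)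
Lemma nondecreasing_continuity_point (h : R -> R) (a b : R) :
  {homo h : x y / x <= y} -> a < b ->
  exists2 x, a < x < b & forall e, 0 < e -> exists2 d, 0 < d & h (x + d) - h (x - d) < e.
Proof.
move=> nd ab.
have cD : countable [set x | x \in (`]a, b[) /\ discontinuity h x].
  by apply: discontinuity_countable => x y _ _; exact: nd.
have [x xab ndx] : exists2 x, x \in (`]a, b[) & ~ discontinuity h x.
  apply: contrapT => H.
  have : lebesgue_measure (`]a, b[%classic : set R) = 0%E.
    apply: countable_lebesgue_measure0; apply: sub_countable cD.
    apply: subset_card_le => x xab; split => //.
    by apply: contrapT => nx; apply: H; exists x.
  by rewrite lebesgue_measure_itv/= lte_fin ab -EFinB => -[] /eqP; rewrite subr_eq0 gt_eqF.
exists x; first by rewrite in_itv/= in xab.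
have cl : cvg (h y @[y --> x^'-]).
  apply: nondecreasing_at_left_is_cvgr.
    by apply: nearW => z u v _ _; exact: nd.
  by apply: nearW => z; exists (h x) => _ [y /= + <-]; rewrite in_itv/= => /andP[_ /ltW/nd].
have cr : cvg (h y @[y --> x^'+]).
  apply: nondecreasing_at_right_is_cvgr.
    by apply: nearW => z u v _ _; exact: nd.
  by apply: nearW => z; exists (h x) => _ [y /= + <-]; rewrite in_itv/= => /andP[/ltW/nd].
have lr : lim (h y @[y --> x^'-]) = lim (h y @[y --> x^'+]).
  by apply/eqP/negPn/negP => ne; apply: ndx; split.
move=> e e0; have e2 : 0 < e / 2 by rewrite divr_gt0.
move/cvgrPdist_lt : cl => /(_ _ e2) cl; move/cvgrPdist_lt : cr => /(_ _ e2); rewrite -lr => cr.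
near x^'- => y1; near x^'+ => y2.
have h1 : `|lim (h y @[y --> x^'-]) - h y1| < e / 2 by near: y1.
have h2 : `|lim (h y @[y --> x^'-]) - h y2| < e / 2 by near: y2.
have xy1 : y1 < x by near: y1; exact: nbhs_left_lt.
have xy2 : x < y2 by near: y2; exact: nbhs_right_gt.
exists (Num.min (x - y1) (y2 - x)); first by rewrite lt_min !subr_gt0 xy1.
set d := Num.min _ _.
have d1 : d <= x - y1 by rewrite ge_min lexx.
have d2 : d <= y2 - x by rewrite ge_min lexx orbT.
have g1 : h y1 <= h (x - d) by apply: nd; rewrite lerBrDr -lerBrDl.
have g2 : h (x + d) <= h y2 by apply: nd; rewrite -lerBrDl.
move: h1 h2; rewrite !ltr_norml => /andP[_ h1] /andP[h2 _]; lra.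
Unshelve. all: by end_near. Qed.
End MonotoneContinuity.

Section CdfLimit.
Variables (R : realType) (k : nat).
Implicit Types (H : 'cV[R]_k -> R) (t : 'cV[R]_k).

Lemma cdf_le H t t' : is_cdf H -> (forall i, t i 0 <= t' i 0) -> H t <= H t'.
Proof.
move=> [mu muH] tt'; rewrite !muH fine_le ?fin_num_measure//; try exact: measurable_orthant.
apply: le_measure; rewrite ?inE; try exact: measurable_orthant.
by move=> z /= zt i; apply: (le_trans (zt i)).
Qed.

Lemma cdf_right_continuous H t a : is_cdf H -> 0 < a ->
  exists2 e, 0 < e & H (t + const_mx e) <= H t + a.
Proof.
move=> [mu muH] a0; pose F n := orthant (t + const_mx (eps_ R n)).
have FE : \bigcap_n F n = orthant t.
  apply/seteqP; split => z /= h i; last first.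
    move=> _ j; rewrite !mxE (le_trans (h j))// lerDl ltW// eps_gt0//.
  rewrite leNgt; apply/negP; rewrite -subr_gt0 => tz.
  have [N _ hN] := eventually_lt (@eps_cvg0 R) tz.
  have := hN N (leqnn N); rewrite /= ltNge => /negP; apply.
  by have := h N I i; rewrite !mxE lerBlDl.
have cF : mu (F n) @[n --> \oo] --> mu (orthant t).
  rewrite -FE; apply: nonincreasing_cvg_mu.
  - by rewrite ltey_eq fin_num_measure//; exact: measurable_orthant.
  - by move=> n; exact: measurable_orthant.
  - by rewrite FE; exact: measurable_orthant.
  - move=> m n mn; apply/subsetPset => z zn i; apply: (le_trans (zn i)).
    by rewrite !mxE lerD2l lef_pV2 ?posrE// ler_nat ltnS ltnS.
have {}cF : H (t + const_mx (eps_ R n)) @[n --> \oo] --> H t.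
  rewrite muH; under eq_fun do rewrite muH.
  by apply: fine_cvg; rewrite fineK// fin_num_measure//; exact: measurable_orthant.
have Ha : H t < H t + a by rewrite ltrDl.
have [n _ hn] := eventually_lt cF Ha.
by exists (eps_ R n); [exact: eps_gt0|apply/ltW/(hn n) => /=].
Qed.

(** Every point within distance [d] of [t] lies componentwise between [t - const_mx d] and
    [t + const_mx d]; by monotonicity, control along the diagonal suffices. *)
Lemma cdf_continuous_at H t : is_cdf H ->
  (forall e, 0 < e -> exists2 d, 0 < d & H (t + const_mx d) - H (t - const_mx d) < e) ->
  {for t, continuous H}.
Proof.
move=> cH hd; move=> B /nbhs_ballP[e /= e0 He]; have [d d0 hde] := hd e e0.
apply/nbhs_ballP; exists d => //= z tz; apply: He; rewrite /ball/=.
have zt i : `|t i 0 - z i 0| < d by have [_ tz'] := tz; exact: (tz' i 0).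
have h1 : H z <= H (t + const_mx d).
  by apply: cdf_le => // i; rewrite !mxE; have := zt i; rewrite ltr_norml => /andP[]; lra.
have h2 : H (t - const_mx d) <= H z.
  by apply: cdf_le => // i; rewrite !mxE; have := zt i; rewrite ltr_norml => /andP[]; lra.
have h3 : H t <= H (t + const_mx d) by apply: cdf_le => // i; rewrite !mxE lerDl ltW.
have h4 : H (t - const_mx d) <= H t by apply: cdf_le => // i; rewrite !mxE gerBl ltW.
by rewrite ltr_norml; lra.
Qed.

(** The upper bound at one [e] extends to all smaller shifts by monotonicity. The lower bound, which
    holds for every shift, is brought back to [t] by right-continuity of [H]. *)
Lemma weak_limit_unique (F_ : nat -> 'cV[R]_k -> R) (F H : 'cV[R]_k -> R) : is_cdf H ->
  (forall t, {for t, continuous H} -> F_ n t @[n --> \oo] --> H t) ->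
  (forall n t x y, x <= y -> F_ n (t + const_mx x) <= F_ n (t + const_mx y)) ->
  (forall t a, 0 < a -> exists2 e, 0 < e & \forall n \near \oo, F_ n (t + const_mx e) <= F t + a) ->
  (forall t a e, 0 < a -> 0 < e -> \forall n \near \oo, F t - a <= F_ n (t + const_mx e)) ->
  forall t, H t = F t.
Proof.
move=> cH FH mono up low t.
pose h x := H (t + const_mx x).
have nh : {homo h : x y / x <= y}.
  by move=> x y xy; apply: cdf_le => // i; rewrite !mxE lerD2l.
have cont e : 0 < e -> exists2 x, 0 < x < e & F_ n (t + const_mx x) @[n --> \oo] --> H (t + const_mx x).
  move=> e0; have [x xe hx] := nondecreasing_continuity_point nh e0; exists x => //.
  apply/FH/cdf_continuous_at => // e' /hx[d d0 hd]; exists d => //.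
  move: hd; rewrite /h.
  have -> y : t + const_mx (x + y) = t + const_mx x + const_mx y.
    by apply/matrixP => i j; rewrite !mxE addrA.
  have -> : t + const_mx (x - d) = t + const_mx x - const_mx d.
    by apply/matrixP => i j; rewrite !mxE addrA.
  by [].
apply/le_anti/andP; split; apply/ler_addgt0Pr => a a0.
  have [e e0 he] := up t a a0; have [x /andP[x0 xe] cx] := cont e e0.
  apply: (@le_trans _ _ (H (t + const_mx x))).
    by apply: cdf_le => // i; rewrite !mxE lerDl ltW.
  apply: (cvgr_to_le cx); apply: filterS he => n; apply: le_trans; apply: mono; exact: ltW.
have a2 : 0 < a / 2 by rewrite divr_gt0.
have [e e0 he] := cdf_right_continuous t cH a2.
have [x /andP[x0 xe] cx] := cont e e0.
rewrite -lerBlDr.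
suff : F t - a / 2 <= H (t + const_mx x).
  have : H (t + const_mx x) <= H (t + const_mx e) by apply: nh; exact: ltW.
  lra.
by apply: (cvgr_to_ge cx); exact: low.
Qed.
End CdfLimit.

(** * Accumulation points *)

Section SelectionLaws.
Variables (R : realType) (P k : nat) (O : 'I_P.+1).
Variables (X : forall n, 'M[R]_(n, P)) (A : 'M[R]_(k, P)) (c : nat -> R).
Variables (n : nat) (known : bool) (theta : 'cV[R]_P) (sigma : R).
Hypothesis P_lt_n : (P < n)%N.
Hypothesis X_rank : \rank (X n) = P.
Hypothesis sigma_gt0 : 0 < sigma.
Hypothesis c_O : c O = 0.
Local Notation nu := (@std_normal_cv R).
Local Notation Yof z := (X n *m theta + error_root n sigma *m z).

(** The number of rows is left open: [B = A] gives the weighted conditional cdf, and the empty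
    matrix gives the selection probability. *)
Definition fit_sel_event l (B : 'M[R]_(l, P)) (p : 'I_P.+1) (t : 'cV[R]_l) : set 'cV[R]_n :=
  sel_event c p (scaled_fit X B n theta sigma p) (tmean X n theta sigma)
    (whitener X n sigma) (sigma_ratio X known sigma) t.

Definition fit_sel_prob l (B : 'M[R]_(l, P)) p t := pr (nu n) (fit_sel_event B p t).

Lemma measurable_sigma_ratio : measurable_fun [set: 'cV[R]_n] (sigma_ratio X known sigma).
Proof.
rewrite /sigma_ratio; case: known; first exact: measurable_cst.
apply: measurableT_comp; first by apply: continuous_measurable_fun; exact: sqrt_continuous.
apply: measurable_funM; first exact: measurable_cst.
apply: measurable_funB; first exact: measurable_sqnorm.
exact: (measurableT_comp (@measurable_sqnorm R P) (measurable_mulmx _)).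
Qed.

Lemma measurable_affine m1 m2 (a : 'cV[R]_m1) (s : R) (B : 'M[R]_(m1, m2)) :
  measurable_fun [set: 'cV[R]_m2] (fun w : 'cV[R]_m2 => a + s *: (B *m w)).
Proof.
apply: measurable_fun_mx => i j.
rewrite (_ : (fun _ => _) = fun w : 'cV[R]_m2 => a i j + s * (B *m w) i j); last first.
  by apply/funext => w; rewrite mxE [X in _ + X]mxE.
apply: measurable_funD; first exact: measurable_cst.
apply: measurable_funM; first exact: measurable_cst.
by apply: measurable_entry_comp; exact: measurable_mulmx.
Qed.

Lemma measurable_fit_sel_event l (B : 'M[R]_(l, P)) p t : measurable (fit_sel_event B p t).
Proof.
apply: measurable_sel_event; last exact: measurable_sigma_ratio.
exact: measurable_affine.
Qed.

Lemma fit_sel_prob_le l (B : 'M[R]_(l, P)) p (t : 'cV[R]_l) x y : x <= y ->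
  fit_sel_prob B p (t + const_mx x) <= fit_sel_prob B p (t + const_mx y).
Proof.
move=> xy; apply: pr_le; try exact: measurable_fit_sel_event.
move=> z [h1 h2 h3]; split => // i; apply: (le_trans (h1 i)).
by rewrite !mxE lerD2l.
Qed.

Lemma fit_sel_eventE (p : 'I_P.+1) t : (O <= p)%N ->
  fit_sel_event A p t = [set z | orthant t (scaled_error O X A c known theta sigma (Yof z)) /\
    selects O X c known sigma p (Yof z)].
Proof.
move=> Op; have iff := @sel_event_iff R P k O X A c n known theta sigma P_lt_n X_rank sigma_gt0 c_O p t _ Op.
by apply/seteqP; split => z h; [exact: (iff z).2 h|exact: (iff z).1 h].
Qed.

Lemma selectsE (p : 'I_P.+1) t : (O <= p)%N ->
  [set z | selects O X c known sigma p (Yof z)] = fit_sel_event (0 : 'M[R]_(0, P)) p t.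
Proof.
move=> Op; have iff := @sel_event_iff R P 0 O X 0 c n known theta sigma P_lt_n X_rank sigma_gt0 c_O p t _ Op.
apply/seteqP; split => z h; last by have [] := (iff z).2 h.
by apply: (iff z).1; split => // -[].
Qed.

Lemma sel_probE (p : 'I_P.+1) t : (O <= p)%N ->
  sel_prob O X c known n theta sigma p = fit_sel_prob (0 : 'M[R]_(0, P)) p t.
Proof. by move=> Op; rewrite /sel_prob prYE (selectsE t Op). Qed.

Lemma measurable_selects (p : 'I_P.+1) : (O <= p)%N ->
  measurable [set z | selects O X c known sigma p (Yof z)].
Proof. by move=> Op; rewrite (selectsE 0 Op); exact: measurable_fit_sel_event. Qed.

Local Notation err := (@scaled_error R P k O X A c known n theta sigma).
Local Notation sel := (@selects R P O X c known n sigma).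

Lemma joint_fitE (p : 'I_P.+1) t : (O <= p)%N ->
  prY X theta sigma (err @^-1` orthant t `&` sel p) =
  fit_sel_prob A p t.
Proof. by move=> Op; rewrite prYE /fit_sel_prob (fit_sel_eventE t Op). Qed.

Lemma joint_selectsE (p : 'I_P.+1) (B : set 'cV[R]_k) : (O <= p)%N ->
  [set z | (err @^-1` B `&` sel p) (Yof z)] =
  [set z | B (scaled_fit X A n theta sigma p (whitener X n sigma *m z))] `&`
  [set z | selects O X c known sigma p (Yof z)].
Proof.
move=> Op; apply/seteqP; split => z /= [h1 h2]; split => //; move: h1; rewrite /preimage/=;
  by rewrite (scaled_error_selected A theta Op h2) scaled_error_restricted.
Qed.

Lemma joint_le_sel_prob (p : 'I_P.+1) (B : set 'cV[R]_k) : (O <= p)%N -> measurable B ->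
  0 <= prY X theta sigma (err @^-1` B `&` sel p)
    <= sel_prob O X c known n theta sigma p.
Proof.
move=> Op mB; rewrite /sel_prob !prYE pr_ge0/= joint_selectsE//.
have ms := measurable_selects Op.
apply: pr_le => //.
apply: measurableI => //.
have mf : measurable_fun [set: 'cV[R]_n] (scaled_fit X A n theta sigma p \o mulmx (whitener X n sigma)).
  by apply: measurableT_comp; [exact: measurable_affine|exact: measurable_mulmx].
by have := mf measurableT B mB; rewrite setTI.
Qed.

(** If the selection probability is [0], the left side vanishes, and the joint probability on the
    right is squeezed to [0] by [joint_le_sel_prob]. *)
Lemma Glaw_cond_mul (p : 'I_P.+1) (B : set 'cV[R]_k) : (O <= p)%N -> measurable B ->
  Glaw_cond O X A c known n theta sigma p B * sel_prob O X c known n theta sigma p =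
  prY X theta sigma (err @^-1` B `&` sel p).
Proof.
move=> Op mB; have /andP[h0 h1] := joint_le_sel_prob Op mB; rewrite /Glaw_cond.
have [s0|s0] := eqVneq (sel_prob O X c known n theta sigma p) 0; last by rewrite divfK.
by rewrite s0 mulr0; apply/le_anti; rewrite h0 -s0 h1.
Qed.

Lemma Gcdf_cond_mul (p : 'I_P.+1) t : (O <= p)%N ->
  Gcdf_cond O X A c known n theta sigma p t * sel_prob O X c known n theta sigma p = fit_sel_prob A p t.
Proof.
by move=> Op; rewrite /Gcdf_cond Glaw_cond_mul ?joint_fitE//; exact: measurable_orthant.
Qed.

Lemma phat_ge (Y : 'cV[R]_n) : (O <= phat O X c Y known sigma)%N.
Proof.
rewrite /phat; have hO : (O <= O)%N && (c O <= `|tstat X Y known sigma O|) by rewrite leqnn c_O normr_ge0.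
by case: arg_maxnP => // j /andP[].
Qed.

Lemma Gcdf_sum t : Gcdf O X A c known n theta sigma t =
  \sum_(p < P.+1 | (O <= p)%N) fit_sel_prob A p t.
Proof.
(* The induction carries measurability along, since the event is seen to be measurable as a finite
   disjoint union over the selected order. *)
have H (r : seq 'I_P.+1) : uniq r -> (forall p, p \in r -> (O <= p)%N) ->
    measurable [set z | orthant t (err (Yof z)) /\ phat O X c (Yof z) known sigma \in r] /\
    pr (nu n) [set z | orthant t (err (Yof z)) /\ phat O X c (Yof z) known sigma \in r] =
    \sum_(p <- r) fit_sel_prob A p t.
  elim: r => [|p r IH] /=.
    move=> _ _; rewrite big_nil (_ : [set z | _] = set0); last by apply/seteqP; split => z //= [].
    by split; [exact: measurable0|rewrite /pr measure0].
  move=> /andP[pr_ ur] hr; have [|mr sr] := IH ur; first by move=> q qr; apply: hr; rewrite inE qr orbT.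
  have Op : (O <= p)%N by apply: hr; rewrite mem_head.
  have mp := measurable_fit_sel_event A p t.
  have -> : [set z | orthant t (err (Yof z)) /\ phat O X c (Yof z) known sigma \in p :: r] =
      fit_sel_event A p t `|` [set z | orthant t (err (Yof z)) /\ phat O X c (Yof z) known sigma \in r].
    rewrite fit_sel_eventE//; apply/seteqP; split => z /=.
      by rewrite inE => -[h /orP[/eqP hp|hp]]; [left|right].
    by rewrite inE => -[[h hp]|[h ->]]; rewrite ?orbT//; split => //; rewrite [phat _ _ _ _ _ _]hp eqxx.
  split; first exact: measurableU.
  rewrite big_cons -sr /pr measureU//.
    by rewrite fineD// fin_num_measure.
  rewrite fit_sel_eventE//; apply/seteqP; split => z //= [[_ hp] [_]].
  by rewrite [phat _ _ _ _ _ _]hp (negbTE pr_).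
pose r := seq.filter (fun p : 'I_P.+1 => (O <= p)%N) (index_enum 'I_P.+1).
have [||_ ] := H r; first by rewrite filter_uniq// index_enum_uniq.
  by move=> p; rewrite mem_filter => /andP[].
rewrite big_filter => <-; rewrite /Gcdf /Glaw prYE; congr (pr (nu n) _).
apply/seteqP; split => z /=; last by case.
by move=> h; split => //; rewrite mem_filter phat_ge mem_index_enum.
Qed.

Lemma coord_bound (y : 'cV[R]_k) : exists j : nat, forall i, y i 0 <= j%:R.
Proof.
pose b := \sum_i `|y i 0|.
have b0 : 0 <= b by rewrite sumr_ge0.
exists (Num.bound b) => i; apply: (le_trans (ler_norm _)); apply: (@le_trans _ _ b).
  by rewrite /b (bigD1 i)//= lerDl sumr_ge0.
exact/ltW/archi_boundP.
Qed.

Lemma sel_prob_le_fit (p : 'I_P.+1) a : (O <= p)%N -> 0 < a ->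
  exists t, sel_prob O X c known n theta sigma p - a <= fit_sel_prob A p t.
Proof.
move=> Op a0; pose F (j : nat) := fit_sel_event A p (const_mx j%:R).
have FE : \bigcup_j F j = [set z | sel p (Yof z)].
  apply/seteqP; split => z.
    by move=> [j _]; rewrite /F fit_sel_eventE// => -[].
  move=> h; have [j hj] := coord_bound (err (Yof z)).
  by exists j => //; rewrite /F fit_sel_eventE//; split => // i; rewrite [X in _ <= X]mxE.
have mF j : measurable (F j) by exact: measurable_fit_sel_event.
have cF : pr (nu n) (F j) @[j --> \oo] --> sel_prob O X c known n theta sigma p.
  rewrite /sel_prob prYE -FE; apply: fine_cvg.
  rewrite fineK ?fin_num_measure//; last exact: bigcupT_measurable.
  apply: nondecreasing_cvg_mu => //; first exact: bigcupT_measurable.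
  move=> i j ij; apply/subsetPset => z [h1 h2 h3]; split => // l; apply: (le_trans (h1 l)).
  by rewrite !mxE ler_nat.
have sa : sel_prob O X c known n theta sigma p - a < sel_prob O X c known n theta sigma p by rewrite gtrBl.
have [j _ hj] := eventually_gt cF sa.
by exists (const_mx j%:R); apply/ltW/(hj j) => /=.
Qed.

(** The total variation distance of a nonnegative measure from zero does not exceed its total mass,
    and the mass is approached by orthants with corner tending to infinity. *)
Lemma sup_weighted_bounds (p : 'I_P.+1) : (O <= p)%N ->
  0 <= sup [set Glaw_cond O X A c known n theta sigma p B * sel_prob O X c known n theta sigma p
           | B in @measurable _ 'cV[R]_k]
    <= total_mass (fun t => Gcdf_cond O X A c known n theta sigma p t * sel_prob O X c known n theta sigma p).
Proof.
move=> Op; set S := [set _ | _ in _].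
have FE t : Gcdf_cond O X A c known n theta sigma p t * sel_prob O X c known n theta sigma p =
    fit_sel_prob A p t by exact: Gcdf_cond_mul.
have SB x : S x -> 0 <= x <= sel_prob O X c known n theta sigma p.
  by move=> [B mB <-]; rewrite Glaw_cond_mul//; exact: joint_le_sel_prob.
have S0 : S (Glaw_cond O X A c known n theta sigma p set0 * sel_prob O X c known n theta sigma p).
  by exists set0.
have uS : ubound S (sel_prob O X c known n theta sigma p) by move=> x /SB/andP[].
apply/andP; split.
  have /andP[h _] := SB _ S0; apply: (le_trans h).
  by apply: ub_le_sup S0; exists (sel_prob O X c known n theta sigma p).
apply: (@le_trans _ _ (sel_prob O X c known n theta sigma p)).
  by apply: ge_sup => //; exists (Glaw_cond O X A c known n theta sigma p set0 * sel_prob O X c known n theta sigma p).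
apply/ler_addgt0Pr => a a0.
have [t ht] := sel_prob_le_fit Op a0.
rewrite -lerBlDr; apply: (le_trans ht); rewrite -FE.
apply: ub_le_sup; last by exists t.
exists 1 => _ [t' _ <-]; rewrite FE; apply: pr_le1; exact: measurable_fit_sel_event.
Qed.
End SelectionLaws.

(** * Limits along a subsequence with convergent parameters *)

Section Asymptotics.
Variables (R : realType) (P : nat) (O : 'I_P.+1).
Variables (X : forall n, 'M[R]_(n, P)) (Q : 'M[R]_P) (c : nat -> R) (known : bool).
Variables (N_ : nat -> nat) (th_ : nat -> 'cV[R]_P) (sg_ : nat -> R).
Variables (psi : 'I_P -> \bar R) (s : R).
Hypothesis N_gt : forall m, (P < N_ m)%N.
Hypothesis N_ge : forall m, (m <= N_ m)%N.
Hypothesis X_rank : forall n, (P < n)%N -> \rank (X n) = P.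
Hypothesis X_cvg : n%:R^-1 *: ((X n)^T *m X n) @[n --> \oo] --> Q.
Hypothesis Q_unit : Q \in unitmx.
Hypothesis c_O : c O = 0.
Hypothesis c_pos : forall p, (O < p <= P)%N -> 0 < c p.
Hypothesis sg_gt0 : forall m, 0 < sg_ m.
Hypothesis s_gt0 : 0 < s.
Hypothesis psi_cvg : forall i, (Num.sqrt (N_ m)%:R * th_ m i 0)%:E @[m --> \oo] --> psi i.
Hypothesis sg_cvg : sg_ m @[m --> \oo] --> s.
Local Notation nu := (@std_normal_cv R).
Local Notation M_ m := (gram_mx X (N_ m)).
Local Notation u_ m := (local_param (N_ m) (th_ m)).
Local Notation pst := (pstar O psi).

Lemma gram_cvg : mcvg (fun m => M_ m) Q.
Proof.
have N_oo : N_ m @[m --> \oo] --> \oo.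
  by move=> B [N _ NB]; exists N => // m /= Nm; apply: NB => /=; exact: leq_trans (N_ge m).
have h := cvg_comp N_ _ N_oo X_cvg.
by move=> i j; rewrite /gram_mx; under eq_fun do rewrite -lock; exact: mcvg_entrywise.
Qed.

Lemma gram_pd m : posdef (M_ m).
Proof. by apply: gram_posdef; [exact: N_gt|exact: X_rank]. Qed.

Lemma limit_posdef : posdef Q.
Proof. exact: posdef_limit gram_pd gram_cvg Q_unit. Qed.

Lemma pstar_spec : [/\ (O <= pst)%N,
  pst = O \/ exists2 q : 'I_P, pst = bsize q & (`|psi q| = +oo)%E &
  forall q : 'I_P, (pst < q.+1)%N -> psi q \is a fin_num].
Proof.
rewrite /pstar; have hO : (O == O) || ((O < O)%N && (`|nth1 0%E psi O| == +oo)%E) by rewrite eqxx.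
case: arg_maxnP => // p hp pmax.
have Op : (O <= p)%N by have := pmax O hO.
split => //.
  have [->|pO] := eqVneq p O; first by left.
  move: hp; rewrite (negbTE pO)/= => /andP[ltOp /eqP hinf].
  right; have p0 : (0 < p)%N by apply: leq_ltn_trans ltOp.
  have pP : (p.-1 < P)%N by rewrite prednK// -ltnS.
  exists (Ordinal pP); first by apply/val_inj; rewrite /= /bump/= add1n prednK.
  move: hinf; rewrite /nth1; case: insubP => [q _ qp|]; last by rewrite pP.
  by move=> <-; congr (`|psi _|)%E; exact/val_inj.
move=> q pq; rewrite fin_numE; apply/negPn/negP => hq.
have hb : (bsize q == O) || ((O < bsize q)%N && (`|nth1 0%E psi (bsize q)| == +oo)%E).
  apply/orP; right; rewrite bsizeE (leq_ltn_trans Op pq)/=.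
  rewrite /nth1; case: insubP => [q' _ qq|]; last by rewrite /= ltn_ord.
  have -> : q' = q by exact/val_inj.
  by move: hq => /=; case: (psi q) => [x||]//=; rewrite eqxx.
have : (q.+1 <= p)%N := pmax _ hb.
by rewrite leqNgt pq.
Qed.

Lemma coord_cvg (q : 'I_P) : (pst < q.+1)%N -> u_ m q 0 @[m --> \oo] --> fine (psi q).
Proof.
move=> pq; have [_ _ fin] := pstar_spec; have := @psi_cvg q.
rewrite -{1}(fineK (fin q pq)) => /fine_cvgP[_] h.
by under eq_fun do rewrite mxE.
Qed.

Lemma coord_diverges (q : 'I_P) : `|psi q|%E = +oo%E -> forall M : R, \forall m \near \oo, M <= `|u_ m q 0|.
Proof.
move=> hq M; have := @psi_cvg q; case: (psi q) hq => [x||]// _.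
  move=> /cvgeyPge/(_ M); apply: filterS => m; rewrite lee_fin mxE => h.
  exact: le_trans h (ler_norm _).
move=> /cvgeNyPle/(_ (- M)); apply: filterS => m; rewrite lee_fin mxE => h.
by rewrite -normrN; apply: le_trans (ler_norm _); rewrite lerNr.
Qed.

Lemma tail_param_cvg (p : 'I_P.+1) : (pst <= p)%N ->
  mcvg (fun m => (1%:M - trunc R p) *m u_ m) ((1%:M - trunc R p) *m \col_i fine (psi i)).
Proof.
move=> pp; have E (v : 'cV[R]_P) i j : ((1%:M - trunc R p) *m v) i j = if (i < p)%N then 0 else v i j.
  rewrite mulmxBl mul1mx mxE [X in _ + X]mxE trunc_mulE; case: ifP; rewrite ?subrr ?subr0//.
move=> i j; rewrite E; under eq_fun do rewrite E.
case: ltnP => pi; first exact: cvg_cst.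
by rewrite ord1 mxE; apply: coord_cvg; rewrite ltnS (leq_trans pp).
Qed.

Lemma scaled_bias_cvg (p : 'I_P.+1) : (pst <= p)%N ->
  mcvg (fun m => scaled_bias X (N_ m) (th_ m) p) (delta Q psi p).
Proof.
move=> pp; rewrite delta_padinv; apply: mcvgM; last exact: tail_param_cvg.
apply: mcvgB; last exact: mcvg_cst.
by apply: mcvgM; [exact: (padinv_cvg gram_pd limit_posdef gram_cvg)|exact: gram_cvg].
Qed.

Lemma scaled_fit_cvg k (A : 'M[R]_(k, P)) (p : 'I_P.+1) w i : (pst <= p)%N ->
  scaled_fit X A (N_ m) (th_ m) (sg_ m) p w i 0 @[m --> \oo] --> limit_fit Q psi s A p w i 0.
Proof.
move=> pp; have lE : limit_fit Q psi s A p w = A *m delta Q psi p + s *: (A *m (whiten Q)^T *m trunc R p *m w).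
  by rewrite /limit_fit !scalemxAl.
rewrite lE; move: i (0 : 'I_1); apply: mcvgD.
  by apply: mcvgM; [exact: mcvg_cst|exact: scaled_bias_cvg].
apply: mcvgZ => //; apply: mcvgM; last exact: mcvg_cst.
apply: mcvgM; last exact: mcvg_cst.
apply: mcvgM; first exact: mcvg_cst.
apply: mcvg_tr; exact: (whiten_cvg gram_pd limit_posdef gram_cvg).
Qed.

Lemma tmeanE m (q : 'I_P) : tmean X (N_ m) (th_ m) (sg_ m) q =
  (scaled_bias X (N_ m) (th_ m) (bsize q) q 0 + u_ m q 0) / (sg_ m * xi (M_ m) q).
Proof.
rewrite /tmean; congr (_ / _).
rewrite scaled_biasE//; last exact: X_rank.
by rewrite [X in _ = X + _]mxE [X in _ = _ + X + _]mxE subrK.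
Qed.

Lemma tscale_cvg (q : 'I_P) : (sg_ m * xi (M_ m) q)^-1 @[m --> \oo] --> (s * xi Q q)^-1.
Proof.
apply: seq_cvgV; first by rewrite gt_eqF// mulr_gt0// (xi_gt0 limit_posdef).
by apply: seq_cvgM => //; exact: (xi_cvg gram_pd limit_posdef gram_cvg).
Qed.

Lemma tmean_cvg (q : 'I_P) : (pst < q.+1)%N ->
  tmean X (N_ m) (th_ m) (sg_ m) q @[m --> \oo] --> mean_ratio Q psi s q.
Proof.
move=> pq; under eq_fun do rewrite tmeanE.
apply: seq_cvgM; last exact: tscale_cvg.
rewrite /mean_limit entry1E; apply: seq_cvgD; first by apply: scaled_bias_cvg; exact: ltnW.
rewrite /nth1; case: insubP => [q' _ qq|]; last by rewrite /= ltn_ord.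
have -> : q' = q by exact/val_inj.
exact: coord_cvg.
Qed.

(** The bias part involves only the components beyond [pstar], which converge, so it cannot cancel
    the diverging component [q]; the scale in the denominator stays bounded. *)
Lemma tmean_diverges (q : 'I_P) : pst = bsize q -> `|psi q|%E = +oo%E ->
  forall M : R, \forall m \near \oo, M <= `|tmean X (N_ m) (th_ m) (sg_ m) q|.
Proof.
move=> pq hq M.
have cb : scaled_bias X (N_ m) (th_ m) (bsize q) q 0 @[m --> \oo] --> delta Q psi (bsize q) q 0.
  by apply: scaled_bias_cvg; rewrite pq.
pose b := delta Q psi (bsize q) q 0.
have x0 : 0 < s * xi Q q by rewrite mulr_gt0// (xi_gt0 limit_posdef).
have cx : (sg_ m * xi (M_ m) q) @[m --> \oo] --> s * xi Q q.
  by apply: seq_cvgM => //; exact: (xi_cvg gram_pd limit_posdef gram_cvg).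
have e1 : \forall m \near \oo, scaled_bias X (N_ m) (th_ m) (bsize q) q 0 < b + 1 by apply: (eventually_lt cb); rewrite ltrDl.
have e2 : \forall m \near \oo, b - 1 < scaled_bias X (N_ m) (th_ m) (bsize q) q 0 by apply: (eventually_gt cb); rewrite gtrBl.
have e3 : \forall m \near \oo, sg_ m * xi (M_ m) q < s * xi Q q + 1 by apply: (eventually_lt cx); rewrite ltrDl.
have e4 := coord_diverges hq (`|M| * (s * xi Q q + 1) + `|b| + 1).
apply: filterS2 (filterI e1 e2) (filterI e3 e4) => m [h1 h2] [h3 h4].
have y0 : 0 < sg_ m * xi (M_ m) q by rewrite mulr_gt0// (xi_gt0 (gram_pd m)).
apply: (le_trans (ler_norm _)).
rewrite tmeanE normrM normfV (gtr0_norm y0) ler_pdivlMr//.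
move: h1 h2 h3 h4 y0; move: (scaled_bias _ _ _ _ _ _) (u_ _ _ _) (_ * xi _ _) (s * _) => v u y z h1 h2 h3 h4 y0.
have hv : `|v| <= `|b| + 1.
  by rewrite ler_norml; have := ler_norm b; have := ler_norm (- b); rewrite normrN => b1 b2; apply/andP; split; lra.
have hu : `|u| <= `|v + u| + `|v|.
  by rewrite -{1}(addrK v u) [u + v]addrC; exact: ler_normB.
have hM : `|M| * y <= `|M| * (z + 1) by apply: ler_wpM2l => //; exact: ltW.
lra.
Qed.

Local Notation C_ m := (whitener X (N_ m) (sg_ m)).
Local Notation r_ m := (@sigma_ratio R P X (N_ m) known (sg_ m)).
Local Notation F_ B p m t := (fit_sel_prob X c (N_ m) known (th_ m) (sg_ m) B p t).

(** At [p = pstar] the lower bound is dropped: there the test rejects in the limit, or [p = O] and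
    the critical value is [0]. *)
Definition region_prob l (B : 'M[R]_(l, P)) (p : 'I_P.+1) t :=
  pr (nu P) (region c p (pst < p)%N (limit_fit Q psi s B p) (mean_ratio Q psi s) 0 t).

Lemma whitener_orthonormal m : C_ m *m (C_ m)^T = 1%:M.
Proof. by apply: whitener_orth => //; exact: X_rank. Qed.

Lemma measurable_ratio m : measurable_fun setT (r_ m).
Proof. exact: measurable_sigma_ratio. Qed.

Lemma sigma_ratio_cvg1 (e : R) : 0 < e ->
  pr (nu (N_ m)) [set z | e < `|r_ m z - 1|] @[m --> \oo] --> (0 : R).
Proof.
move=> e0; have := resid_ratio_cvg1 whitener_orthonormal N_gt N_ge e0.
rewrite /sigma_ratio; case: known => // _.
under eq_fun => m.
  rewrite (_ : [set z | _] = set0); last first.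
    apply/seteqP; split => z //=; rewrite subrr normr0 => h.
    by have := lt_trans h e0; rewrite ltxx.
  rewrite /pr measure0; over.
exact: cvg_cst.
Qed.

Section AboveThreshold.
Variables (l : nat) (B : 'M[R]_(l, P)) (p : 'I_P.+1).
Hypothesis pst_le : (pst <= p)%N.

Let c_gt0 (q : 'I_P) : (p < q.+1)%N -> 0 < c q.+1.
Proof.
move=> pq; apply: c_pos; rewrite ltn_ord andbT.
by have [Op _ _] := pstar_spec; apply: leq_ltn_trans pq; exact: leq_trans pst_le.
Qed.

Let cp_ge0 : 0 <= c p.
Proof.
have [Op _ _] := pstar_spec.
have [->|pO] := eqVneq p O; first by rewrite c_O.
have pP : (p <= P)%N by rewrite -ltnS ltn_ord.
apply/ltW/c_pos; rewrite pP andbT ltn_neqAle (leq_trans Op pst_le) andbT.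
by rewrite eq_sym.
Qed.

Let cp_gt0 : (pst < p)%N -> 0 < c p.
Proof.
have [Op _ _] := pstar_spec => pp; apply: c_pos.
by rewrite (leq_ltn_trans Op pp)/= -ltnS ltn_ord.
Qed.

Let mV_ m : measurable_fun setT (scaled_fit X B (N_ m) (th_ m) (sg_ m) p).
Proof. exact: measurable_affine. Qed.

Let mV : measurable_fun setT (limit_fit Q psi s B p).
Proof.
rewrite (_ : limit_fit _ _ _ _ _ = fun w => B *m delta Q psi p + s *: (B *m (whiten Q)^T *m trunc R p *m w)).
  exact: measurable_affine.
by apply/funext => w; rewrite /limit_fit !scalemxAl.
Qed.

Let V_cvg w i : scaled_fit X B (N_ m) (th_ m) (sg_ m) p w i 0 @[m --> \oo] --> limit_fit Q psi s B p w i 0.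
Proof. exact: scaled_fit_cvg. Qed.

Let mu_cvg (q : 'I_P) : (p < q.+1)%N -> tmean X (N_ m) (th_ m) (sg_ m) q @[m --> \oo] --> mean_ratio Q psi s q.
Proof. by move=> pq; apply: tmean_cvg; exact: leq_ltn_trans pq. Qed.

Let mu_chk (q : 'I_P) : q.+1 = p -> (pst < p)%N ->
  tmean X (N_ m) (th_ m) (sg_ m) q @[m --> \oo] --> mean_ratio Q psi s q.
Proof. by move=> <-; exact: tmean_cvg. Qed.

Let mu_nchk (q : 'I_P) : q.+1 = p -> ~~ (pst < p)%N ->
  c p = 0 \/ forall M : R, \forall m \near \oo, M <= `|tmean X (N_ m) (th_ m) (sg_ m) q|.
Proof.
move=> qp npp; have pE : pst = p by apply/val_inj/anti_leq; rewrite pst_le leqNgt npp.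
have [_ [pO|[q' pq' hq']] _] := pstar_spec; first by left; rewrite -pE pO.
right; have -> : q = q' by apply/val_inj/succn_inj; rewrite qp -pE pq'.
exact: tmean_diverges.
Qed.

Lemma fit_sel_prob_upper t a : 0 < a -> exists2 e, 0 < e &
  \forall m \near \oo, F_ B p m (t + const_mx e) <= region_prob B p t + a.
Proof.
exact: (sel_event_upper c_gt0 cp_ge0 cp_gt0 mV_ mV V_cvg mu_cvg mu_chk whitener_orthonormal measurable_ratio sigma_ratio_cvg1).
Qed.

Lemma fit_sel_prob_lower t a e : 0 < a -> 0 < e ->
  \forall m \near \oo, region_prob B p t - a <= F_ B p m (t + const_mx e).
Proof.
exact: (sel_event_lower c_gt0 cp_ge0 cp_gt0 mV_ mV V_cvg mu_cvg mu_chk mu_nchk whitener_orthonormal measurable_ratio sigma_ratio_cvg1).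
Qed.

End AboveThreshold.

(** Selecting [p] requires the statistic of index [pstar] to stay below its critical value. This
    bound does not see the corner, which may therefore move with [m]. *)
Lemma fit_sel_prob_below l (B : 'M[R]_(l, P)) (p : 'I_P.+1) (t_ : nat -> 'cV[R]_l) :
  (O <= p)%N -> (p < pst)%N -> F_ B p m (t_ m) @[m --> \oo] --> (0 : R).
Proof.
move=> Op pp; have [_ [pO|[q pq hq]] _] := pstar_spec; first by move: pp; rewrite pO ltnNge Op.
have qE : q.+1 = pst :> nat by rewrite pq.
apply: (escaping_event_cvg0 (b := c q.+1) whitener_orthonormal measurable_ratio sigma_ratio_cvg1 (tmean_diverges pq hq)).
- by apply/ltW/c_pos; rewrite ltn_ord andbT qE (leq_ltn_trans Op).
- by move=> m; exact: measurable_fit_sel_event.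
- by move=> m z [_ _ h]; apply: h; rewrite qE.
Qed.

Lemma above_threshold (p : 'I_P.+1) : (pst < p)%N -> exists i : 'I_P, p = bsize i.
Proof.
move=> pp; have p0 : (0 < p)%N by apply: leq_ltn_trans pp.
have pP : (p.-1 < P)%N by rewrite prednK// -ltnS.
by exists (Ordinal pP); apply/val_inj; rewrite /= /bump/= add1n prednK.
Qed.

Lemma sel_prob_limit (p : 'I_P.+1) : (O <= p)%N ->
  sel_prob O X c known (N_ m) (th_ m) (sg_ m) p @[m --> \oo] --> pi_inf O Q c psi s p.
Proof.
move=> Op.
have E m t : sel_prob O X c known (N_ m) (th_ m) (sg_ m) p = F_ (0 : 'M[R]_(0, P)) p m t.
  by apply: sel_probE => //; exact: X_rank.
rewrite /pi_inf; have [pp|pp] := leqP pst p; last first.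
  have -> : (p == pst) = false by apply/negbTE; apply: contraTneq pp => ->; rewrite ltnn.
  rewrite ltnNge (ltnW pp)/=; under eq_fun => m do rewrite (E m 0).
  exact: fit_sel_prob_below.
set x := (X in _ --> X).
have xE : region_prob (0 : 'M[R]_(0, P)) p 0 = x.
  rewrite /x /region_prob; case: ifPn => [lt|nlt].
    have [i ->] := above_threshold lt.
    exact: (pr_tail_selection _ _ limit_posdef s_gt0).
  have pE : p = pst by apply/val_inj/anti_leq; rewrite pp leqNgt nlt.
  rewrite [in RHS]pE eqxx -pE; exact: (pr_head_selection _ _ limit_posdef s_gt0).
rewrite -xE; apply/cvgrPdist_le => e e0.
(* In dimension zero the corner is immaterial, so the upper and lower bounds concern the same
   probability and give convergence outright. *)
have [d d0 up] := fit_sel_prob_upper (0 : 'M[R]_(0, P)) pp 0 e0.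
have low := fit_sel_prob_lower (0 : 'M[R]_(0, P)) pp 0 e0 d0.
apply: filterS2 up low => m; rewrite -E => h1 h2.
by rewrite ler_norml; apply/andP; split; lra.
Qed.

Section WeakLimits.
Variables (k : nat) (A : 'M[R]_(k, P)) (ginv : 'I_P.+1 -> 'M[R]_k).
Hypothesis ginvP : forall p : 'I_P.+1, (0 < p)%N -> is_ginv (Acov Q A p) (ginv p).

Definition term_limit (p : 'I_P.+1) t :=
  if (pst < p)%N then tail_term Q A c ginv psi s p t
  else if p == pst then head_term O Q A c psi s t else 0.

Lemma region_probE (p : 'I_P.+1) t : (pst <= p)%N -> region_prob A p t = term_limit p t.
Proof.
move=> pp; rewrite /region_prob /term_limit; case: ifPn => [lt|nlt].
  by have [i ->] := above_threshold lt; rewrite (pr_tail _ _ limit_posdef s_gt0 ginvP).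
have pE : p = pst by apply/val_inj/anti_leq; rewrite pp leqNgt nlt.
by rewrite (pr_head _ _ limit_posdef s_gt0) pE eqxx.
Qed.

Lemma term_upper (p : 'I_P.+1) t a : (O <= p)%N -> 0 < a -> exists2 e, 0 < e &
  \forall m \near \oo, F_ A p m (t + const_mx e) <= term_limit p t + a.
Proof.
move=> Op a0; have [pp|pp] := leqP pst p.
  by rewrite -region_probE//; exact: fit_sel_prob_upper.
exists 1 => //; have -> : term_limit p t = 0.
  rewrite /term_limit ltnNge (ltnW pp)/= ifF//.
  by apply/negbTE; apply: contraTneq pp => ->; rewrite ltnn.
rewrite add0r.
by apply: filterS (eventually_lt (fit_sel_prob_below A (fun=> t + const_mx 1) Op pp) a0) => m /ltW.
Qed.

Lemma term_lower (p : 'I_P.+1) t a e : (O <= p)%N -> 0 < a -> 0 < e ->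
  \forall m \near \oo, term_limit p t - a <= F_ A p m (t + const_mx e).
Proof.
move=> Op a0 e0; have [pp|pp] := leqP pst p.
  by rewrite -region_probE//; exact: fit_sel_prob_lower.
have -> : term_limit p t = 0.
  rewrite /term_limit ltnNge (ltnW pp)/= ifF//.
  by apply/negbTE; apply: contraTneq pp => ->; rewrite ltnn.
by apply: nearW => m; rewrite sub0r (le_trans _ (pr_ge0 _ _))// oppr_le0 ltW.
Qed.

Lemma weighted_cdf_limit (p : 'I_P.+1) (H : 'cV[R]_k -> R) : (O <= p)%N -> is_cdf H ->
  (forall t, {for t, continuous H} -> F_ A p m t @[m --> \oo] --> H t) ->
  forall t, H t = term_limit p t.
Proof.
move=> Op cH FH; apply: (weak_limit_unique cH FH).
- by move=> m t x y xy; exact: fit_sel_prob_le.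
- by move=> t a; exact: term_upper.
- by move=> t a e; exact: term_lower.
Qed.

Lemma sum_upper (r : seq 'I_P.+1) t a : (forall p, p \in r -> (O <= p)%N) -> 0 < a -> exists2 e, 0 < e &
  \forall m \near \oo, \sum_(p <- r) F_ A p m (t + const_mx e) <= \sum_(p <- r) term_limit p t + a.
Proof.
elim: r a => [|p r IH] a Or a0.
  by exists 1 => //; apply: nearW => m; rewrite !big_nil add0r ltW.
have a2 : 0 < a / 2 by rewrite divr_gt0.
have [|e e0 he] := IH (a / 2) _ a2; first by move=> q qr; apply: Or; rewrite inE qr orbT.
have [|d d0 hd] := @term_upper p t (a / 2) _ a2; first by apply: Or; rewrite mem_head.
(* The upper bounds survive a smaller shift by monotonicity in the corner, so the minimum serves all
   terms. *)
exists (Num.min e d); first by rewrite lt_min e0.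
apply: filterS2 he hd => m h1 h2; rewrite !big_cons.
have h3 : \sum_(q <- r) F_ A q m (t + const_mx (Num.min e d)) <= \sum_(q <- r) F_ A q m (t + const_mx e).
  by apply: ler_sum => q _; apply: fit_sel_prob_le; rewrite // ge_min lexx.
have h4 : F_ A p m (t + const_mx (Num.min e d)) <= F_ A p m (t + const_mx d).
  by apply: fit_sel_prob_le; rewrite // ge_min lexx orbT.
lra.
Qed.

Lemma sum_lower (r : seq 'I_P.+1) t a e : (forall p, p \in r -> (O <= p)%N) -> 0 < a -> 0 < e ->
  \forall m \near \oo, \sum_(p <- r) term_limit p t - a <= \sum_(p <- r) F_ A p m (t + const_mx e).
Proof.
elim: r a => [|p r IH] a Or a0 e0.
  by apply: nearW => m; rewrite !big_nil sub0r oppr_le0 ltW.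
have a2 : 0 < a / 2 by rewrite divr_gt0.
have he := IH (a / 2) (fun q qr => Or q (mem_behead (s := p :: r) qr)) a2 e0.
have hd := @term_lower p t (a / 2) e (Or p (mem_head _ _)) a2 e0.
by apply: filterS2 he hd => m h1 h2; rewrite !big_cons; lra.
Qed.

Lemma Ginf_sum t : Ginf O Q A c ginv psi s t = \sum_(p < P.+1 | (O <= p)%N) term_limit p t.
Proof.
have [Op _ _] := pstar_spec.
rewrite (bigD1 pst)//= /Ginf {1}/term_limit ltnn eqxx; congr (_ + _).
rewrite [RHS](bigID (fun p : 'I_P.+1 => (pst < p)%N))/= [X in _ = _ + X]big1 ?addr0 => [|p].
  apply: eq_big => [p|p pp]; last by rewrite /term_limit pp.
  have [pp|pp] := ltnP pst p; rewrite ?andbF// (leq_trans Op (ltnW pp))/=.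
  by rewrite andbT; apply/esym; apply: contraTneq pp => ->; rewrite ltnn.
by move=> /andP[/andP[_ /negbTE ne] /negbTE nlt]; rewrite /term_limit nlt ne.
Qed.

Lemma Gcdf_limit (H : 'cV[R]_k -> R) : is_cdf H ->
  (forall t, {for t, continuous H} ->
     Gcdf O X A c known (N_ m) (th_ m) (sg_ m) t @[m --> \oo] --> H t) ->
  forall t, H t = Ginf O Q A c ginv psi s t.
Proof.
move=> cH GH t; rewrite Ginf_sum -big_filter; move: t.
set r := seq.filter _ _.
have Or p : p \in r -> (O <= p)%N by rewrite mem_filter => /andP[].
apply: (weak_limit_unique (F_ := fun m t => \sum_(p <- r) F_ A p m t) cH).
- move=> t /GH; rewrite (_ : (fun m => Gcdf O X A c known (N_ m) (th_ m) (sg_ m) t) =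
    (fun m => \sum_(p <- r) F_ A p m t))//; apply/funext => m.
  by rewrite Gcdf_sum ?big_filter//; exact: X_rank.
- by move=> m t x y xy; apply: ler_sum => p _; exact: fit_sel_prob_le.
- by move=> t a; exact: sum_upper.
- by move=> t a e; exact: sum_lower.
Qed.

End WeakLimits.
End Asymptotics.

Theorem mainTheorem6 (R : realType) (P k : nat) (O : 'I_P.+1)
    (X : forall n, 'M[R]_(n, P)) (Q : 'M[R]_P) (A : 'M[R]_(k, P))
    (c : nat -> R) (ginv : 'I_P.+1 -> 'M[R]_k)
    (theta : nat -> 'cV[R]_P) (sigma : nat -> R) (slo shi : R)
    (P_ge1 : (1 <= P)%N) (O_lt_P : (O < P)%N)
    (X_rank : forall n, (P < n)%N -> \rank (X n) = P)
    (X_cvg : n%:R^-1 *: ((X n)^T *m X n) @[n --> \oo] --> Q)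
    (Q_unit : Q \in unitmx)
    (k_bounds : (1 <= k <= P)%N) (A_rank : \rank A = k)
    (c_O : c O = 0) (c_pos : forall p, (O < p <= P)%N -> 0 < c p)
    (ginvP : forall p : 'I_P.+1, (0 < p)%N -> is_ginv (Acov Q A p) (ginv p))
    (slo_pos : 0 < slo) (slo_le_shi : slo <= shi)
    (sigma_bounds : forall n, (P < n)%N -> slo <= sigma n <= shi) :
  (forall phi : nat -> nat, increasing_seq phi ->
     exists (chi : nat -> nat) (psi : 'I_P -> \bar R) (s : R),
       [/\ increasing_seq chi, params_cvg theta sigma (phi \o chi) psi s
         & slo <= s <= shi])
  /\
  (forall known : bool,
   (* (a) *)
   (forall (phi : nat -> nat) (H : 'cV[R]_k -> R),
      increasing_seq phi -> is_cdf H ->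
      weak_cvg (fun m => Gcdf O X A c known (phi m) (theta (phi m)) (sigma (phi m))) H ->
      exists (chi : nat -> nat) (psi : 'I_P -> \bar R) (s : R),
        [/\ increasing_seq chi, params_cvg theta sigma (phi \o chi) psi s
          & forall t, H t = Ginf O Q A c ginv psi s t])
   /\
   (* (b) *)
   (forall (phi : nat -> nat) (v : 'I_P.+1 -> R),
      increasing_seq phi ->
      (forall p : 'I_P.+1, (O <= p)%N ->
         sel_prob O X c known (phi m) (theta (phi m)) (sigma (phi m)) p
           @[m --> \oo] --> v p) ->
      exists (chi : nat -> nat) (psi : 'I_P -> \bar R) (s : R),
        [/\ increasing_seq chi, params_cvg theta sigma (phi \o chi) psi s
          & forall p : 'I_P.+1, (O <= p)%N -> v p = pi_inf O Q c psi s p])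
   /\
   (* (c) *)
   (forall (p : 'I_P.+1), (O <= p)%N ->
    forall (phi : nat -> nat) (H : 'cV[R]_k -> R),
      increasing_seq phi -> is_cdf H ->
      weak_cvg (fun m t =>
        Gcdf_cond O X A c known (phi m) (theta (phi m)) (sigma (phi m)) p t
        * sel_prob O X c known (phi m) (theta (phi m)) (sigma (phi m)) p) H ->
      exists (chi : nat -> nat) (psi : 'I_P -> \bar R) (s : R),
        [/\ increasing_seq chi, params_cvg theta sigma (phi \o chi) psi s
          & [/\ p = pstar O psi ->
                  forall t, H t = head_term O Q A c psi s t,
                (pstar O psi < p)%N ->
                  forall t, H t = tail_term Q A c ginv psi s p t
              & (p < pstar O psi)%N ->
                  (forall t, H t = 0) /\
                  sup [set Glaw_cond O X A c known (phi m)
                             (theta (phi m)) (sigma (phi m)) p B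
                           * sel_prob O X c known (phi m)
                               (theta (phi m)) (sigma (phi m)) p
                      | B in @measurable _ 'cV[R]_k] @[m --> \oo] --> (0 : R)]])).
Proof.
have sigma_gt0 n : (P < n)%N -> 0 < sigma n.
  by move=> /sigma_bounds/andP[h _]; exact: lt_le_trans h.
split.
  move=> phi hphi; have [chi [psi [s [h1 h2 h3 _]]]] := params_subsequence theta sigma_bounds hphi.
  by exists chi, psi, s.
move=> known; split; [|split].
- move=> phi H hphi cH [wH _].
  have [chi [psi [s [hchi [cpsi cs] /andP[sl _] N_gt]]]] := params_subsequence theta sigma_bounds hphi.
  exists chi, psi, s; split => //.
  have N_ge m : (m <= phi (chi m))%N by exact: (increasing_seq_ge (increasing_seq_comp hphi hchi)).
  apply: (Gcdf_limit N_gt N_ge X_rank X_cvg Q_unit c_O c_pos _ _ cpsi cs ginvP cH) => //.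
  + by move=> m; exact: sigma_gt0 (N_gt m).
  + exact: lt_le_trans sl.
  + move=> t /wH ct.
    exact: (@subseq_cvg R (fun m => Gcdf O X A c known (phi m) (theta (phi m)) (sigma (phi m)) t) _ _ hchi ct).
- move=> phi v hphi cv.
  have [chi [psi [s [hchi [cpsi cs] /andP[sl _] N_gt]]]] := params_subsequence theta sigma_bounds hphi.
  exists chi, psi, s; split => // p Op.
  have N_ge m : (m <= phi (chi m))%N by exact: (increasing_seq_ge (increasing_seq_comp hphi hchi)).
  have sc : sel_prob O X c known (phi (chi m)) (theta (phi (chi m))) (sigma (phi (chi m))) p
      @[m --> \oo] --> v p by exact: (subseq_cvg hchi (cv p Op)).
  have sl' : sel_prob O X c known (phi (chi m)) (theta (phi (chi m))) (sigma (phi (chi m))) p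
      @[m --> \oo] --> pi_inf O Q c psi s p.
    apply: (sel_prob_limit known N_gt N_ge X_rank X_cvg Q_unit c_O c_pos _ _ cpsi cs Op).
      by move=> m; exact: sigma_gt0 (N_gt m).
    exact: lt_le_trans sl.
  exact: (cvg_unique _ sc sl').
- move=> p Op phi H hphi cH [wH mass].
  have [chi [psi [s [hchi [cpsi cs] /andP[sl _] N_gt]]]] := params_subsequence theta sigma_bounds hphi.
  exists chi, psi, s; split => //.
  have N_ge m : (m <= phi (chi m))%N by exact: (increasing_seq_ge (increasing_seq_comp hphi hchi)).
  have HE : forall t, H t = term_limit O Q c psi s A ginv p t.
    apply: (weighted_cdf_limit (known := known) N_gt N_ge X_rank X_cvg Q_unit c_O c_pos _ _ cpsi cs ginvP Op cH).
    + by move=> m; exact: sigma_gt0 (N_gt m).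
    + exact: lt_le_trans sl.
    + move=> t /wH ct; have := subseq_cvg hchi ct.
      rewrite (_ : (fun m => _) = fun m => fit_sel_prob X c (phi (chi m)) known (theta (phi (chi m)))
        (sigma (phi (chi m))) A p t)//; apply/funext => m.
      by rewrite Gcdf_cond_mul//; [exact: X_rank (N_gt m)|exact: sigma_gt0 (N_gt m)].
  split.
  + by move=> pE t; rewrite HE /term_limit -pE ltnn eqxx.
  + by move=> pp t; rewrite HE /term_limit pp.
  + move=> pp; have H0 t : H t = 0.
      rewrite HE /term_limit ltnNge (ltnW pp)/= ifF//.
      by apply/negbTE; apply: contraTneq pp => ->; rewrite ltnn.
    split => //.
    (* Weak convergence includes that of the total mass. As the limit is zero, the mass vanishes
       along all of [phi], not only along the subsequence [phi \o chi], and it dominates the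
       supremum over all measurable sets. *)
    have tm0 : total_mass H = 0.
      rewrite /total_mass (_ : range H = [set 0]) ?sup1//; apply/seteqP; split => x /=.
        by move=> [t _ <-].
      by move=> ->; exists 0.
    rewrite tm0 in mass.
    have ev : \forall m \near \oo, (P < phi m)%N.
      by exists P.+1 => // m /= Pm; exact: leq_trans (increasing_seq_ge hphi m).
    apply: (squeeze_cvgr _ (cvg_cst 0) mass); apply: filterS ev => m Pm.
    exact: (@sup_weighted_bounds R P k O X A c (phi m) known (theta (phi m)) (sigma (phi m)) Pm (X_rank _ Pm) (sigma_gt0 _ Pm) c_O p Op).
Qed.
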